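(* Let $d\ge1$, let $E\subset\mathbb{R}^d$ be closed, and set $d':=\max(d,2)$. For any $N\ge1$, $G^N\in\mathbf{P}_{sym}(E^N)$ and $f\in\mathbf{P}(E)$ there holds: (i) for all $1\le j\le\ell\le N$: $\ \Omega_j(G^N;f)\le2\,\Omega_\ell(G^N;f)$; (ii) for all $1\le j\le N$: $\ \Omega_j(G^N;f)\le\Omega_\infty(G^N;f)+\frac{j^2}{N}$. (iii) For any $k>0$ and any $0<\gamma<\frac{1}{d+1+d/k}$, there exists an explicit constant $C:=C(d,\gamma,k)$ such that (for all such $f$, all $N\ge2$ and all such $G^N$) $$\Omega_\infty(G^N;f)\le C\,\mathscr{M}_k^{1/k}\Big(\Omega_2(G^N;f)+\frac1N\Big)^{\gamma},\qquad \mathscr{M}_k:=M_k(f)+M_k(G^N_1).$$ (iv) For any $k>0$ and any $0<\gamma<\frac{1}{d'+d'/k}$, there exists a constant $C:=C(d,\gamma,k)$ such that (for all such $f$, $N$, $G^N$) $$|\Omega_N(G^N;f)-\Omega_\infty(G^N;f)|\le C\,\frac{M_k(f)^{1/k}}{N^{\gamma}}.$$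
   Context: $\mathbf{P}(Z)$: Borel probability measures on $Z$; $\mathbf{P}_{sym}(E^N)$: those on $E^N$ invariant under permutations of the coordinates; $G^N_j$: marginal of $G^N$ on the first $j$ coordinates; $M_k(\rho):=\int_E\langle v\rangle^k\rho(dv)$ with $\langle v\rangle:=\sqrt{1+|v|^2}$ (possibly $+\infty$). $d_E(x,y):=\min(|x-y|,1)$ on $E$ and $d_{E^j}(X,Y):=\frac1j\sum_{i=1}^jd_E(x_i,y_i)$ on $E^j$; $W_1$ is the Monge-Kantorovich-Wasserstein distance on $\mathbf{P}(E^j)$ (exponent 1) with cost $d_{E^j}$. $\mu^N_X:=\frac1N\sum_{i=1}^N\delta_{x_i}$ for $X\in E^N$. $\Omega_j(G^N;f):=W_1(G^N_j,f^{\otimes j})$ for $1\le j\le N$, and $\Omega_\infty(G^N;f):=\int_{E^N}W_1(\mu^N_X,f)\,G^N(dX)$. *)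

(* Defs.v *)
From HB Require Import structures.
From mathcomp Require Import all_boot all_order all_algebra all_fingroup.
From mathcomp Require Import all_classical all_reals all_analysis.

Set Implicit Arguments.
Unset Strict Implicit.
Unset Printing Implicit Defensive.

Import Order.TTheory GRing.Theory Num.Theory.
Import numFieldNormedType.Exports.

Local Open Scope classical_set_scope.
Local Open Scope ring_scope.
Local Open Scope ereal_scope.

(* T^n is the type n.-tuple T with the product sigma-algebra; for T a subspace
   of R^d with its Borel sigma-algebra this is the Borel sigma-algebra of the
   product topology, because T is second countable. *)

Section product_of_probabilities.
Context d1 d2 (T1 : measurableType d1) (T2 : measurableType d2) (R : realType).
Variables (P1 : probability T1 R) (P2 : probability T2 R).

Definition prod_probability : set (T1 * T2) -> \bar R := P1 \x P2.

HB.instance Definition _ := Measure.copy prod_probability (P1 \x P2).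

Let prod_probability_setT : prod_probability setT = 1.
Proof.
rewrite /prod_probability -setXTT product_measure1E//.
transitivity (P1 setT * P2 setT) => //.
by rewrite !probability_setT mule1.
Qed.

HB.instance Definition _ :=
  Measure_isProbability.Build _ _ _ prod_probability prod_probability_setT.

End product_of_probabilities.

Section tuple_maps.
Context dT (T : measurableType dT).

Definition cons_pair n (z : T * n.-tuple T) : n.+1.-tuple T :=
  [tuple of z.1 :: z.2].

Let measurable_cons_pair n : measurable_fun setT (@cons_pair n).
Proof. exact: measurable_cons. Qed.

HB.instance Definition _ n :=
  isMeasurableFun.Build _ _ _ _ (@cons_pair n) (@measurable_cons_pair n).

Definition first_coords j N (hj : (j <= N)%N) (X : N.-tuple T) : j.-tuple T :=
  [tuple tnth X (widen_ord hj i) | i < j].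

Let measurable_first_coords j N (hj : (j <= N)%N) :
  measurable_fun setT (first_coords hj).
Proof.
apply/measurable_fun_tnthP => i.
rewrite (_ : _ \o _ = fun X => tnth X (widen_ord hj i)).
  exact: measurable_tnth.
by apply/funext => X /=; rewrite tnth_mktuple.
Qed.

HB.instance Definition _ j N (hj : (j <= N)%N) :=
  isMeasurableFun.Build _ _ _ _ (first_coords hj)
    (@measurable_first_coords j N hj).

Definition sole_coord (X : 1.-tuple T) : T := thead X.

Let measurable_sole_coord : measurable_fun setT sole_coord.
Proof. exact: measurable_tnth. Qed.

HB.instance Definition _ :=
  isMeasurableFun.Build _ _ _ _ sole_coord measurable_sole_coord.

Definition permute N (s : 'S_N) (X : N.-tuple T) : N.-tuple T :=
  [tuple tnth X (s i) | i < N].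

End tuple_maps.

Section laws.
Context dT (T : measurableType dT) (R : realType).

Definition symmetric_law N (G : probability (N.-tuple T) R) : Prop :=
  forall (s : 'S_N) (A : set (N.-tuple T)), measurable A ->
    pushforward G (permute s) A = G A.

Definition marginal j N (hj : (j <= N)%N) (G : probability (N.-tuple T) R) :
    probability (j.-tuple T) R :=
  distribution G (first_coords hj).

Fixpoint tensor_power (f : probability T R) (j : nat) :
    probability (j.-tuple T) R :=
  match j with
  | 0%N => dirac [tuple]
  | n.+1 => distribution (prod_probability f (tensor_power f n)) (@cons_pair _ T n)
  end.

Definition empirical N (X : N.-tuple T) : {measure set T -> \bar R} :=
  mscale ((N%:R^-1)%:nng)%R (msum (fun i => \d_(nth point X i)) N).

Definition couplings (mu nu : {measure set T -> \bar R}) :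
    set (probability (T * T)%type R) :=
  [set p | forall A : set T, measurable A ->
     pushforward p fst A = mu A /\ pushforward p snd A = nu A].

Definition wasserstein1 (c : T -> T -> R) (mu nu : {measure set T -> \bar R}) :
    \bar R :=
  ereal_inf [set \int[p]_z (c z.1 z.2)%:E | p in couplings mu nu].

Definition tuple_dist (c : T -> T -> R) j (X Y : j.-tuple T) : R :=
  (j%:R^-1 * \sum_(i < j) c (tnth X i) (tnth Y i))%R.

End laws.

Section euclidean.
Context (R : realType) (d : nat).

(* The library's norm on 'rV[R]_d is the sup norm. *)
Definition enorm (v : 'rV[R]_d) : R := Num.sqrt (\sum_(i < d) v ord0 i ^+ 2)%R.

Definition bracket (v : 'rV[R]_d) : R := Num.sqrt (1 + enorm v ^+ 2)%R.

End euclidean.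

Section borel_subspace.
Context (R : realType) (d : nat) (E : set 'rV[R]_d).

(* E as a topological subspace of R^d; E0 provides the distinguished point
   that measurable types carry in the library. *)
Definition subspace_of (E0 : E !=set0) : Type := set_type E.

Variable E0 : E !=set0.

HB.instance Definition _ := Topological.copy (subspace_of E0) (set_type E).
HB.instance Definition _ := isPointed.Build (subspace_of E0)
  (exist _ (projT1 (cid E0)) (mem_set (projT2 (cid E0)))).

Definition borel : measurableType (sigma_display (@open (subspace_of E0))) :=
  g_sigma_algebraType (@open (subspace_of E0)).

Definition emb (x : borel) : 'rV[R]_d := @set_val _ E x.

Definition dE (x y : borel) : R := Num.min (enorm (emb x - emb y)) 1%R.

Definition moment (k : R) (rho : {measure set borel -> \bar R}) : \bar R :=
  \int[rho]_v (bracket (emb v) `^ k)%:E.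

Section chaos.
Context (N : nat).
Implicit Types (G : probability (N.-tuple borel) R) (f : probability borel R).

Definition Omega j (hj : (j <= N)%N) G f : \bar R :=
  wasserstein1 (@tuple_dist _ borel R dE j) (marginal hj G) (tensor_power f j).

Definition Omega_oo G f : \bar R :=
  \int[G]_X wasserstein1 dE (empirical R X) f.

(* M_k(G_1), where the marginal on E^1 is read as a law on E. *)
Definition moment1 (h1 : (1 <= N)%N) (k : R) G : \bar R :=
  moment k (distribution (marginal h1 G) (@sole_coord _ borel)).

End chaos.

End borel_subspace.

(* Main.v *)
Require Import Defs.
From HB Require Import structures.
From mathcomp Require Import all_boot all_order all_algebra all_fingroup.
From mathcomp Require Import all_classical all_reals all_analysis.
From mathcomp Require Import measurable_realfun.
From mathcomp Require Import ring lra zify.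

(** A coupling of the empirical measure of [X] with [f] only has to tell which
    particle goes where. It can be replaced by an index plan, a law on pairs
    (index, point) whose first marginal is uniform and whose second is [f]
    ([coupling_plan]). Index plans do not depend on [X], and the cost of each of
    them is 1-Lipschitz in [X]; so is therefore the distance [W X] from the
    empirical measure to [f], and near optimal plans can be kept constant on
    countably many cells ([plan_selection]).

    Three comparisons follow. Averaging a coupling of [l] particles over the
    cyclic shifts of a block of [j] of them gives [omega_monotone], with constant
    one. Drawing [j] independent pairs from a plan between the empirical measure
    and [f] gives [j] distinct particles of [X], hence a sample
    of the [j]-th marginal, up to a collision of probability at most [j ^ 2 / N]
    ([omega_le_w1_empirical]). At full size, the two notions of chaos differ by at
    most the mean of [W] over independent samples of [f]. One direction is the
    Lipschitz property ([w1_empirical_le_omega]). For the other, a sample [X] of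
    [G] and an independent sample [Y] of the product law are matched optimally;
    the dual potentials of the assignment problem bound the cost by [W X + W Y]
    ([assignment_duality], [matching_le]), and a common uniform permutation
    restores the law of [Y], which the matching had disturbed
    ([omega_le_w1_empirical_iid]).

    The rates come from nested dyadic partitions. [W X] is at most a sum over the
    scales of the discrepancies between [X] and [f] on the cells ([tree_bound]).
    The second moment of a discrepancy only involves pairs of particles: a coupling
    of the two-particle marginal with the product law bounds it by [1 / N] and the
    probability that the coupling separates two points into different cells
    ([Ex_discrepancy_le]). For one grid this probability is not controlled by the
    distance of the points, but its mean over translations of the grid is
    ([shifted_grid_separation]). For independent samples nothing is separated and
    only [1 / N] remains, whence the better exponent in that case. The side of the
    cube outside of which the mass is discarded and the number of scales are then
    chosen in [rate_optimization]. *)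

Set Implicit Arguments.
Unset Strict Implicit.
Unset Printing Implicit Defensive.

Import Order.TTheory GRing.Theory Num.Theory.
Import numFieldNormedType.Exports.

Local Open Scope classical_set_scope.
Local Open Scope ring_scope.

(** * Mixtures of measures *)

Section mixture.
Local Open Scope ereal_scope.
Context d1 d2 (X : measurableType d1) (Y : measurableType d2) (R : realType).
Variables (P : {measure set X -> \bar R}) (k : X -> {measure set Y -> \bar R}).

Definition mixture (mk : forall A, measurable A ->
    measurable_fun setT (fun x => k x A)) : set Y -> \bar R :=
  fun A => \int[P]_x k x A.

Variable mk : forall A, measurable A -> measurable_fun setT (fun x => k x A).
Let M := mixture mk.

Let mixture0 : M set0 = 0.
Proof. by rewrite /M/mixture integral0_eq. Qed.

Let mixture_ge0 A : 0 <= M A.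
Proof. exact: integral_ge0. Qed.

Let mixture_sigma_additive : semi_sigma_additive M.
Proof.
move=> F mF tF mUF; rewrite /M /mixture.
have -> : \int[P]_x k x (\bigcup_n F n) = \sum_(n <oo) \int[P]_x k x (F n).
  rewrite -integral_nneseries//; last by move=> n; exact: mk.
  apply: eq_integral => x _.
  by rewrite measure_semi_bigcup.
by apply: is_cvg_ereal_nneg_natsum => n _; exact: integral_ge0.
Qed.

HB.instance Definition _ := isMeasure.Build _ _ _ M
  mixture0 mixture_ge0 mixture_sigma_additive.

Definition mixture_measure : {measure set Y -> \bar R} := M.

Import HBNNSimple.

Let sintegral_mixtureM (h : {nnsfun Y >-> R}) :
  measurable_fun setT (fun x => sintegral (k x) h).
Proof.
rewrite (_ : (fun x => _) = fun x => \sum_(r \in range h) r%:E * k x (h @^-1` [set r])); last first.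
  by apply/funext => x; rewrite sintegralE.
apply: emeasurable_fsum => // r.
by apply: measurable_funeM; apply: mk; exact: measurable_sfunP.
Qed.

Let sintegral_mixture (h : {nnsfun Y >-> R}) :
  sintegral M h = \int[P]_x sintegral (k x) h.
Proof.
under eq_integral do rewrite sintegralE.
rewrite ge0_integral_fsum//; last 2 first.
  by move=> r; apply: measurable_funeM; apply: mk; exact: measurable_sfunP.
  by move=> n x _; exact: nnsfun_mulemu_ge0.
rewrite sintegralE /=; apply: eq_fsbigr => // r rh.
have [r0|r0] := leP 0%R r.
  by rewrite ge0_integralZl//; apply: mk; exact: measurable_sfunP.
rewrite preimage_nnfun0// measure0 mule0 integral0_eq// => x _.
by rewrite measure0 mule0.
Qed.

Section int.
Variables (g : Y -> \bar R).
Hypotheses (mg : measurable_fun setT g) (g0 : forall y, 0 <= g y).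

Lemma measurable_integral_mixture :
  measurable_fun setT (fun x => \int[k x]_y g y).
Proof.
pose h := nnsfun_approx measurableT mg.
apply: (emeasurable_fun_cvg (fun n x => sintegral (k x) (h n))) => // x _.
rewrite (_ : \int[k x]_y g y = \int[k x]_y limn (fun n => (h n y)%:E)); last first.
  apply: eq_integral => y _.
  by apply/esym/cvg_lim => //; exact/cvg_nnsfun_approx.
rewrite (_ : (fun n => _) = fun n => \int[k x]_y (EFin \o h n) y); last first.
  by apply/funext => n; rewrite integralT_nnsfun.
apply: cvg_monotone_convergence => //.
- by move=> n; exact/measurable_EFinP.
- by move=> n y _; rewrite lee_fin.
- by move=> t _ n m nm; rewrite lee_fin; apply/lefP/nd_nnsfun_approx.
Qed.

Lemma ge0_integral_mixture :
  \int[mixture_measure]_y g y = \int[P]_x \int[k x]_y g y.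
Proof.
pose h := nnsfun_approx measurableT mg.
have nd x n m : (n <= m)%N -> (h n x)%:E <= (h m x)%:E.
  by move=> nm; rewrite lee_fin; exact/lefP/nd_nnsfun_approx.
transitivity (limn (fun n => \int[mixture_measure]_x (EFin \o h n) x)).
  rewrite -monotone_convergence//.
  - apply: eq_integral => t _.
    by apply/esym/cvg_lim => //; exact: cvg_nnsfun_approx.
  - by move=> n; exact/measurable_EFinP.
  - by move=> n x _; rewrite lee_fin.
  - by move=> x _ n m nm; exact: nd.
transitivity (limn (fun n => \int[P]_x \int[k x]_y (EFin \o h n) y)).
  apply: congr_lim; apply/funext => n.
  rewrite integralT_nnsfun sintegral_mixture; apply: eq_integral => x _.
  by rewrite integralT_nnsfun.
rewrite -[LHS]monotone_convergence//; last 3 first.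
- move=> n; rewrite (_ : (fun x => _) = fun x => sintegral (k x) (h n))//.
  by apply/funext => x; rewrite integralT_nnsfun.
- by move=> n x _; apply: integral_ge0 => y _; rewrite lee_fin.
- move=> x _ m n mn; apply: ge0_le_integral => //.
  + by move=> y _; rewrite lee_fin.
  + exact/measurable_EFinP.
  + exact/measurable_EFinP.
  + by move=> t _; exact: nd.
apply: eq_integral => x _.
rewrite -monotone_convergence//.
- apply: eq_integral => t _.
  by apply/cvg_lim => //; exact: cvg_nnsfun_approx.
- by move=> n; exact/measurable_EFinP.
- by move=> n y _; rewrite lee_fin.
- by move=> y _ n m nm; exact: nd.
Qed.
End int.

End mixture.

Section probability_of.
Local Open Scope ereal_scope.
Context d (T : measurableType d) (R : realType).
(** An alias that remembers why the total mass is one, so that a structure of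
    probability can be attached to it. *)
Definition as_probability (m : {measure set T -> \bar R}) (_ : m setT = 1) :
  set T -> \bar R := m.
Variables (m : {measure set T -> \bar R}) (m1 : m setT = 1).
HB.instance Definition _ := Measure.copy (as_probability m1) m.
HB.instance Definition _ := Measure_isProbability.Build _ _ _ (as_probability m1) m1.
Definition probability_of : probability T R := as_probability m1.
End probability_of.

(** * Expectations of bounded measurable functions *)

Section expectation.
Context d (T : measurableType d) (R : realType).
Implicit Types (P Q : probability T R) (g h : T -> R).

(** Every function integrated below is of this kind, except for the moments: it
    makes integrability automatic, and expectations real numbers. *)
Definition bmfun g := measurable_fun setT g /\ exists M, forall x, `|g x| <= M.

(** On bounded measurable functions this is the integral ([ExE]); the default
    value taken by [fine] never matters. *)
Definition Ex P g : R := fine (\int[P]_x (g x)%:E)%E.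

Lemma bm_integrable P g : bmfun g -> P.-integrable setT (EFin \o g).
Proof.
move=> [mg [M gM]]; apply: measurable_bounded_integrable => //.
  exact: (le_lt_trans (probability_le1 P measurableT) (ltry 1)).
exists M; split; first by rewrite num_real.
by move=> x Mx y _ /=; rewrite (le_trans (gM y))// ltW.
Qed.

Lemma ExE P g : bmfun g -> (\int[P]_x (g x)%:E)%E = (Ex P g)%:E.
Proof.
by move=> bg; rewrite /Ex fineK//; apply: integrable_fin_num => //; exact: bm_integrable.
Qed.

Lemma bm_cst (a : R) : bmfun (fun _ => a).
Proof. by split=> //; exists `|a|. Qed.

Lemma bmD g h : bmfun g -> bmfun h -> bmfun (fun x => g x + h x).
Proof.
move=> [mg [M gM]] [mh [M' hM]]; split; first exact: measurable_funD.
by exists (M + M') => x; rewrite (le_trans (ler_normD _ _))// lerD.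
Qed.

Lemma bmM g h : bmfun g -> bmfun h -> bmfun (fun x => g x * h x).
Proof.
move=> [mg [M gM]] [mh [M' hM]]; split; first exact: measurable_funM.
by exists (M * M') => x; rewrite normrM ler_pM.
Qed.

Lemma bmZ (a : R) g : bmfun g -> bmfun (fun x => a * g x).
Proof. by move=> bg; apply: bmM => //; exact: bm_cst. Qed.

Lemma bmN g : bmfun g -> bmfun (fun x => - g x).
Proof.
by move=> /(bmZ (-1)); congr bmfun; apply/funext => x; rewrite mulN1r.
Qed.

Lemma bmB g h : bmfun g -> bmfun h -> bmfun (fun x => g x - h x).
Proof. by move=> bg /bmN; exact: bmD. Qed.

Lemma bm_sum (I : Type) (r : seq I) (S : pred I) (F : I -> T -> R) :
  (forall i, bmfun (F i)) -> bmfun (fun x => \sum_(i <- r | S i) F i x).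
Proof.
move=> bF; elim: r => [|i r IH].
  by under eq_fun do rewrite big_nil; exact: bm_cst.
under eq_fun do rewrite big_cons.
by case: (S i) => //; apply: bmD.
Qed.

Lemma bm_bool (b : T -> bool) :
  measurable [set x | b x] -> bmfun (fun x => (b x)%:R).
Proof.
move=> mb; split; last first.
  by exists 1 => x; case: (b x); rewrite ?normr1 ?normr0.
rewrite (_ : (fun _ => _) = \1_[set x | b x]); first exact: measurable_indic.
by apply/funext => x; rewrite indicE mem_setE.
Qed.

Lemma bm_between (a c : R) g : measurable_fun setT g -> (forall x, a <= g x <= c) -> bmfun g.
Proof.
move=> mg h; split => //; exists (`|a| + `|c|) => x.
have /andP[ag gc] := h x.
rewrite ler_norml; apply/andP; split.
  rewrite (le_trans _ ag)// lerNl (le_trans (ler_norm _))// normrN.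
  by rewrite lerDl.
by rewrite (le_trans gc)// (le_trans (ler_norm _))// lerDr.
Qed.

Lemma bm_min g h : bmfun g -> bmfun h -> bmfun (fun x => Num.min (g x) (h x)).
Proof.
move=> [mg [M gM]] [mh [M' hM]]; split; first exact: measurable_minr.
exists (Num.max M M') => x.
by rewrite minEle; case: ifP => _; rewrite le_max ?gM ?hM ?orbT.
Qed.

Lemma Ex_cst P (a : R) : Ex P (fun _ => a) = a.
Proof. rewrite /Ex integral_cst// [X in (_ * X)%E](_ : _ = 1%E) ?mule1//.
exact: probability_setT. Qed.

Lemma ExD P g h : bmfun g -> bmfun h -> Ex P (fun x => g x + h x) = Ex P g + Ex P h.
Proof.
move=> bg bh; apply: EFin_inj; rewrite -ExE ?EFinD; last exact: bmD.
rewrite -!ExE// -integralD//; exact: bm_integrable.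
Qed.

Lemma ExZ P (a : R) g : bmfun g -> Ex P (fun x => a * g x) = a * Ex P g.
Proof.
move=> bg; apply: EFin_inj; rewrite -ExE ?EFinM; last exact: bmZ.
rewrite -!ExE// -integralZl//; exact: bm_integrable.
Qed.

Lemma ExN P g : bmfun g -> Ex P (fun x => - g x) = - Ex P g.
Proof.
move=> bg; rewrite -mulN1r -ExZ//; congr Ex; apply/funext => x.
by rewrite mulN1r.
Qed.

Lemma ExB P g h : bmfun g -> bmfun h -> Ex P (fun x => g x - h x) = Ex P g - Ex P h.
Proof. by move=> bg bh; rewrite ExD ?ExN//; exact: bmN. Qed.

Lemma Ex_sum P (I : Type) (r : seq I) (S : pred I) (F : I -> T -> R) :
  (forall i, bmfun (F i)) ->
  Ex P (fun x => \sum_(i <- r | S i) F i x) = \sum_(i <- r | S i) Ex P (F i).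
Proof.
move=> bF; elim: r => [|i r IH].
  by under eq_fun do rewrite big_nil; rewrite Ex_cst big_nil.
rewrite big_cons -IH; under eq_fun do rewrite big_cons.
by case: (S i) => //; rewrite ExD//; exact: bm_sum.
Qed.

Lemma Ex_le P g h : bmfun g -> bmfun h -> (forall x, g x <= h x) -> Ex P g <= Ex P h.
Proof.
move=> bg bh gh; rewrite -lee_fin -!ExE//.
by apply: le_integral => //; [exact: bm_integrable..|move=> x _; rewrite lee_fin].
Qed.

Lemma Ex_ge0 P g : (forall x, 0 <= g x) -> 0 <= Ex P g.
Proof. by move=> g0; rewrite fine_ge0// integral_ge0// => x _; rewrite lee_fin. Qed.

Lemma Ex_le_cst P g (a : R) : bmfun g -> (forall x, g x <= a) -> Ex P g <= a.
Proof. by move=> bg ga; rewrite -[leRHS](Ex_cst P); apply: Ex_le => //; exact: bm_cst. Qed.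

Lemma eq_Ex P g h : g =1 h -> Ex P g = Ex P h.
Proof. by move=> /funext->. Qed.

Lemma bm_indic (A : set T) : measurable A -> bmfun (\1_A : T -> R).
Proof.
move=> mA; split; first exact: measurable_indic.
by exists 1 => x; rewrite indicE; case: (_ \in _); rewrite ?normr1 ?normr0.
Qed.

Lemma Ex_indic P (A : set T) : measurable A -> (Ex P \1_A)%:E = P A.
Proof.
move=> mA; rewrite -ExE; last exact: bm_indic.
by have := integral_indic P measurableT mA; rewrite setIT => <-.
Qed.

Lemma Ex_ext P Q g : (forall A, measurable A -> P A = Q A) -> Ex P g = Ex Q g.
Proof.
by move=> PQ; rewrite /Ex (eq_measure_integral Q)// => A mA _; exact: PQ.
Qed.

(** Carries over to bounded functions the theorems on integrals of nonnegative
    functions, such as those of Tonelli. *)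
Lemma bm_shift g : bmfun g -> exists M : R, bmfun (fun x => g x + M) /\ forall x, 0 <= g x + M.
Proof.
move=> bg; have [_ [M gM]] := bg; exists M; split.
  by apply: bmD => //; exact: bm_cst.
by move=> x; rewrite -lerBlDr sub0r; have := gM x; rewrite ler_norml => /andP[].
Qed.

End expectation.

Section transport.
Context d1 d2 (X : measurableType d1) (Y : measurableType d2) (R : realType).

Lemma bm_comp (f : X -> Y) (g : Y -> R) : measurable_fun setT f -> bmfun g ->
  bmfun (fun x => g (f x)).
Proof.
by move=> mf [mg [M gM]]; split; [exact: measurableT_comp|exists M].
Qed.

Definition image_law (f : X -> Y) (mf : measurable_fun setT f) (P : probability X R) :
  probability Y R :=
  distribution P (HB.pack_for {mfun X >-> Y} f (isMeasurableFun.Build _ _ _ _ f mf)).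

Lemma image_lawE (f : X -> Y) (mf : measurable_fun setT f) (P : probability X R) A :
  image_law mf P A = P (f @^-1` A).
Proof. by []. Qed.

Lemma Ex_distribution (f : {mfun X >-> Y}) (P : probability X R) g :
  bmfun g -> Ex (distribution P f) g = Ex P (fun x => g (f x)).
Proof.
move=> bg; rewrite /Ex integral_distribution//; first exact/measurable_EFinP/bg.1.
by apply: bm_integrable; exact: bm_comp.
Qed.

Lemma Ex_image_law (f : X -> Y) (mf : measurable_fun setT f) (P : probability X R) g :
  bmfun g -> Ex (image_law mf P) g = Ex P (fun x => g (f x)).
Proof. exact: Ex_distribution. Qed.

End transport.

Section bind_product.
Context d1 d2 (X : measurableType d1) (Y : measurableType d2) (R : realType).

Section bind.
Variables (P : probability X R) (k : X -> probability Y R).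
Hypothesis mk : forall A, measurable A -> measurable_fun setT (fun x => k x A).

Let bind_setT : mixture_measure P mk setT = 1%E.
Proof.
rewrite /mixture_measure /mixture/=.
transitivity (\int[P]_x 1)%E.
  by apply: eq_integral => x _; exact: probability_setT.
rewrite integral_cst// [X in (_ * X)%E](_ : _ = 1%E) ?mule1//; exact: probability_setT.
Qed.

Definition bind_law : probability Y R := probability_of bind_setT.

Lemma bm_Ex_bind g : bmfun g -> bmfun (fun x => Ex (k x) g).
Proof.
move=> bg; have [M [bgM gM0]] := bm_shift bg.
have bM : bmfun (fun _ : Y => M) by exact: bm_cst.
have -> : (fun x => Ex (k x) g) = fun x => Ex (k x) (fun y => g y + M) - M.
  by apply/funext => x; rewrite ExD// Ex_cst addrK.
apply: bmB; last exact: bm_cst.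
have [_ [M' hM']] := bgM.
apply: (@bm_between _ _ _ 0 M').
  apply: measurableT_comp => //.
  apply: (measurable_integral_mixture mk).
    by apply/measurable_EFinP; exact: bgM.1.
  by move=> y; rewrite lee_fin.
move=> x; rewrite Ex_ge0//=; apply: Ex_le_cst => // y.
by rewrite (le_trans _ (hM' y))// ler_norm.
Qed.

Lemma Ex_bind g : bmfun g -> Ex bind_law g = Ex P (fun x => Ex (k x) g).
Proof.
move=> bg; have [M [bgM gM0]] := bm_shift bg.
have bM : bmfun (fun _ : Y => M) by exact: bm_cst.
have E Q : Ex Q g = Ex Q (fun y => g y + M) - M by rewrite ExD// Ex_cst addrK.
rewrite E; under [in RHS]eq_Ex do rewrite E.
rewrite ExB; [|exact: bm_Ex_bind|exact: bm_cst].
rewrite Ex_cst; congr (_ - _); apply: EFin_inj.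
rewrite -!ExE//; last exact: bm_Ex_bind.
rewrite [LHS](ge0_integral_mixture P mk).
- by apply: eq_integral => x _; rewrite ExE.
- by apply/measurable_EFinP; exact: bgM.1.
- by move=> y; rewrite lee_fin.
Qed.

End bind.

Section product.
Variables (P : probability X R) (Q : probability Y R).

Lemma bm_Ex_prod (g : X * Y -> R) : bmfun g -> bmfun (fun x => Ex Q (fun y => g (x, y))).
Proof.
move=> bg; have [M [bgM gM0]] := bm_shift bg.
have bM : bmfun (fun _ : Y => M) by exact: bm_cst.
have bgx x : bmfun (fun y => g (x, y)) by apply: bm_comp.
have -> : (fun x => Ex Q (fun y => g (x, y))) = fun x => Ex Q (fun y => g (x, y) + M) - M.
  by apply/funext => x; rewrite ExD// Ex_cst addrK.
apply: bmB; last exact: bm_cst.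
have [_ [M' hM']] := bgM.
apply: (@bm_between _ _ _ 0 M').
  apply: measurableT_comp => //.
  apply: (@measurable_fun_fubini_tonelli_F _ _ _ _ _ Q (fun z => (g z + M)%:E)).
    apply/measurable_EFinP; exact: bgM.1.
  by move=> z; rewrite lee_fin.
move=> x; rewrite Ex_ge0//=; apply: Ex_le_cst => [|y].
  by apply: (bm_comp _ bgM).
by rewrite (le_trans _ (hM' (x, y)))// ler_norm.
Qed.

Lemma Ex_prod (g : X * Y -> R) : bmfun g ->
  Ex (prod_probability P Q) g = Ex P (fun x => Ex Q (fun y => g (x, y))).
Proof.
move=> bg; have [M [bgM gM0]] := bm_shift bg.
have bM d (T : measurableType d) : bmfun (fun _ : T => M) by exact: bm_cst.
have bgx x : bmfun (fun y => g (x, y)) by apply: bm_comp.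
have bgMx x : bmfun (fun y => g (x, y) + M) by exact: bmD.
have -> : Ex (prod_probability P Q) g = Ex (prod_probability P Q) (fun z => g z + M) - M.
  by rewrite ExD// Ex_cst addrK.
have E x : Ex Q (fun y => g (x, y)) = Ex Q (fun y => g (x, y) + M) - M.
  by rewrite ExD// Ex_cst addrK.
under [in RHS]eq_Ex do rewrite E.
rewrite ExB//; last by have := bm_Ex_prod bgM.
rewrite Ex_cst; congr (_ - _); apply: EFin_inj.
rewrite -!ExE//; last by have := bm_Ex_prod bgM.
rewrite [LHS](@fubini_tonelli1 _ _ _ _ _ P Q (fun z => (g z + M)%:E)).
- by apply: eq_integral => x _; rewrite /fubini_F ExE.
- by apply/measurable_EFinP; exact: bgM.1.
- by move=> y; rewrite lee_fin.
Qed.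

End product.
End bind_product.

Section swap.
Context d1 d2 (X : measurableType d1) (Y : measurableType d2) (R : realType).

Lemma bm_Ex_prod2 (Q : probability X R) (g : X * Y -> R) : bmfun g ->
  bmfun (fun y => Ex Q (fun x => g (x, y))).
Proof.
move=> bg.
have bs : bmfun (fun z : Y * X => g (z.2, z.1)).
  by apply: (bm_comp (f := fun z : Y * X => (z.2, z.1)) _ bg); exact: measurable_fun_pair.
exact: (bm_Ex_prod Q bs).
Qed.

Lemma Ex_swap (P : probability X R) (Q : probability Y R) (g : X * Y -> R) : bmfun g ->
  Ex P (fun x => Ex Q (fun y => g (x, y))) = Ex Q (fun y => Ex P (fun x => g (x, y))).
Proof.
move=> bg; have [M [bgM gM0]] := bm_shift bg.
have bM d (T : measurableType d) : bmfun (fun _ : T => M) by exact: bm_cst.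
have bgx x : bmfun (fun y => g (x, y)) by apply: bm_comp.
have bgy y : bmfun (fun x => g (x, y)) by apply: bm_comp.
have bgMx x : bmfun (fun y => g (x, y) + M) by exact: bmD.
have bgMy y : bmfun (fun x => g (x, y) + M) by exact: bmD.
have Ex1 x : Ex Q (fun y => g (x, y)) = Ex Q (fun y => g (x, y) + M) - M.
  by rewrite ExD// Ex_cst addrK.
have Ey1 y : Ex P (fun x => g (x, y)) = Ex P (fun x => g (x, y) + M) - M.
  by rewrite ExD// Ex_cst addrK.
under eq_Ex do rewrite Ex1.
under [in RHS]eq_Ex do rewrite Ey1.
have b1 := bm_Ex_prod Q bgM; have b2 := bm_Ex_prod2 P bgM.
rewrite !ExB// !Ex_cst; congr (_ - _); apply: EFin_inj.
rewrite -!ExE//.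
have := @fubini_tonelli _ _ _ _ _ P Q (fun z => (g z + M)%:E).
under eq_integral do rewrite ExE//.
under [in X in _ -> _ -> _ = X]eq_integral do rewrite ExE//.
apply; first by apply/measurable_EFinP; exact: bgM.1.
by move=> z; rewrite lee_fin.
Qed.

End swap.

Section density.
Context d (X : measurableType d) (R : realType).
Variables (P : probability X R) (h : X -> R).
Hypotheses (bh : bmfun h) (h0 : forall x, 0 <= h x) (h1 : Ex P h = 1).

Let k (x : X) : {measure set X -> \bar R} := mscale (NngNum (h0 x)) \d_x.

Let kE x A : k x A = ((h x)%:E * \d_x A)%E. Proof. by []. Qed.

Let mk A : measurable A -> measurable_fun setT (fun x => k x A).
Proof.
move=> mA; rewrite (_ : (fun x => _) = fun x => ((h x) * \1_A x)%:E).
  apply/measurable_EFinP; apply: measurable_funM; first exact: bh.1.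
  exact: measurable_indic.
by apply/funext => x; rewrite kE diracE indicE EFinM.
Qed.

Let dens_setT : mixture_measure P mk setT = 1%E.
Proof.
rewrite /mixture_measure /mixture/= -h1 -ExE//.
by apply: eq_integral => x _; rewrite kE diracT mule1.
Qed.

(** The law of density [h] is a mixture of weighted Dirac masses, so that its
    integrals are given by [ge0_integral_mixture]. *)
Definition density_law : probability X R := probability_of dens_setT.

Lemma Ex_density_law g : bmfun g -> Ex density_law g = Ex P (fun x => h x * g x).
Proof.
move=> bg; have [M [bgM gM0]] := bm_shift bg.
have bM : bmfun (fun _ : X => M) by exact: bm_cst.
have -> : Ex density_law g = Ex density_law (fun z => g z + M) - M.
  by rewrite ExD// Ex_cst addrK.
have -> : Ex P (fun x => h x * g x) = Ex P (fun x => h x * (g x + M)) - M.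
  under [in RHS]eq_Ex do rewrite mulrDr.
  rewrite ExD; [|exact: bmM|exact: bmM].
  under [X in _ = _ + X - _]eq_Ex do rewrite mulrC.
  by rewrite ExZ// h1 mulr1 addrK.
congr (_ - _); apply: EFin_inj; rewrite -!ExE//; last exact: bmM.
rewrite [LHS](ge0_integral_mixture P mk).
- apply: eq_integral => x _ /=.
  rewrite ge0_integral_mscale//=; last first.
    + by move=> y _; rewrite lee_fin.
    + by apply/measurable_EFinP; exact: bgM.1.
  rewrite integral_dirac//=; last by apply/measurable_EFinP; exact: bgM.1.
  by rewrite diracT mul1e EFinM.
- by apply/measurable_EFinP; exact: bgM.1.
- by move=> y; rewrite lee_fin.
Qed.

End density.

(** * Laws of tuples *)

Section tuples.
Context dT (T : measurableType dT) (R : realType).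

Definition select j N (s : 'I_j -> 'I_N) (X : N.-tuple T) : j.-tuple T :=
  [tuple tnth X (s i) | i < j].

Lemma measurable_select j N (s : 'I_j -> 'I_N) : measurable_fun setT (select s).
Proof.
apply/measurable_fun_tnthP => i.
rewrite (_ : _ \o _ = fun X => tnth X (s i)); first exact: measurable_tnth.
by apply/funext => X /=; rewrite tnth_mktuple.
Qed.

Definition box n (A : 'I_n -> set T) : set (n.-tuple T) :=
  [set X | forall i, A i (tnth X i)].

Lemma measurable_box n (A : 'I_n -> set T) :
  (forall i, measurable (A i)) -> measurable (box A).
Proof.
move=> mA; rewrite (_ : box A = \big[setI/setT]_(i < n) ((fun X => tnth X i) @^-1` A i)).
  apply: bigsetI_measurable => i _; rewrite -[X in measurable X]setTI.
  exact: measurable_tnth.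
rewrite -bigcap_seq; apply/seteqP; split => X /=.
  by move=> AX i _; exact: AX.
by move=> AX i; apply: (AX i); rewrite /= mem_index_enum.
Qed.

(** Boxes are stable under intersection and generate the product sigma-algebra. *)
Lemma laws_eq_on_boxes n (P Q : probability (n.-tuple T) R) :
  (forall A, (forall i, measurable (A i)) -> P (box A) = Q (box A)) ->
  forall B, measurable B -> P B = Q B.
Proof.
move=> PQ B mB.
pose G : set (set (n.-tuple T)) := [set B | exists A, (forall i, measurable (A i)) /\ B = box A].
apply: (measure_unique G (fun _ => setT)) => //.
- apply/seteqP; split.
    apply: smallest_sub; first exact: smallest_sigma_algebra.
    rewrite -bigcup_seq => C [i _ [A mA <-]]; apply: sub_sigma_algebra.
    exists (fun j => if j == i then A else setT); split.
      by move=> j; case: ifP.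
    rewrite setTI; apply/seteqP; split => X /=.
      by move=> AX j; case: eqP => // ->.
    by move=> /(_ i); rewrite eqxx.
  apply: smallest_sub; first exact: sigma_algebra_measurable.
  by move=> _ [A [mA ->]]; exact: measurable_box.
- move=> _ _ [A [mA ->]] [A' [mA' ->]]; exists (fun i => A i `&` A' i); split.
    by move=> i; exact: measurableI.
  apply/seteqP; split => X /=; first by move=> [AX AX'] i; split; [exact: AX|exact: AX'].
  by move=> AX; split => i; have [] := AX i.
- by move=> _; exists (fun _ => setT); split => //; apply/seteqP; split.
- by rewrite bigcup_const//; exists 0%N.
- by move=> _ [A [mA ->]]; exact: PQ.
- by move=> _; exact: (le_lt_trans (probability_le1 P measurableT) (ltry 1)).
Qed.

Lemma tensor_power_box (f : probability T R) n (A : 'I_n -> set T) :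
  (forall i, measurable (A i)) ->
  (tensor_power f n (box A) = \prod_(i < n) f (A i))%E.
Proof.
elim: n A => [|n IH] A mA.
  by rewrite big_ord0 /= diracE mem_set// => -[].
rewrite big_ord_recl -IH//=.
rewrite /distribution /pushforward -product_measure1E//; last exact: measurable_box.
congr ((_ \x _)%E _); apply/seteqP; split => -[x X] /=.
  move=> AX; split; first by have := AX ord0.
  by move=> i; have := AX (lift ord0 i); rewrite tnthS.
by move=> [Ax AX] i; case: (unliftP ord0 i) => [j ->|-> //]; rewrite tnthS; exact: AX.
Qed.

Lemma Ex_tensor0 (f : probability T R) g : bmfun g -> Ex (tensor_power f 0) g = g [tuple].
Proof.
move=> bg; apply: EFin_inj; rewrite -ExE// integral_dirac//=.
  by rewrite diracT mul1e.
by apply/measurable_EFinP; exact: bg.1.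
Qed.

Lemma Ex_tensorS (f : probability T R) n g : bmfun g ->
  Ex (tensor_power f n.+1) g =
  Ex f (fun x => Ex (tensor_power f n) (fun X => g [tuple of x :: X])).
Proof.
move=> bg; rewrite [LHS]Ex_distribution// Ex_prod//.
exact: (bm_comp _ bg).
Qed.

(** The preimage of a box is a box: the selected coordinates get its sides, which
    injectivity keeps apart, and the other coordinates are free. *)
Lemma select_tensor_power (f : probability T R) j N (s : 'I_j -> 'I_N) : injective s ->
  forall A, measurable A ->
  image_law (measurable_select s) (tensor_power f N) A = tensor_power f j A.
Proof.
move=> sI; apply: laws_eq_on_boxes => A mA; rewrite image_lawE tensor_power_box//.
pose A' i := \big[setI/setT]_(m < j | s m == i) A m.
have A's m : A' (s m) = A m.
  by rewrite /A' (big_pred1 m)// => m' /=; rewrite (inj_eq sI).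
have -> : select s @^-1` box A = box A'.
  apply/seteqP; split => X /= AX.
    move=> i; rewrite /A'; elim/big_ind : _ => //.
    by move=> m /eqP <-; have := AX m; rewrite tnth_mktuple.
  by move=> m; rewrite tnth_mktuple -A's; exact: AX.
rewrite tensor_power_box; last by move=> i; apply: bigsetI_measurable.
under [in RHS]eq_bigr do rewrite -A's.
rewrite (bigID (fun i => i \in codom s))/= muleC big1_seq ?mul1e; last first.
  move=> i /andP[iNs _]; rewrite /A' big_pred0 ?probability_setT//.
  by move=> m; apply/negbTE; apply: contra iNs => /eqP <-; exact: codom_f.
rewrite (eq_bigl (fun i => i \in [set s m | m in 'I_j]%SET)); last first.
  move=> i; apply/codomP/imsetP => [[m ->]|[m _ ->]]; first by exists m.
  by exists m.
by rewrite big_imset//; exact: in2W.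
Qed.

Lemma injection_extends_to_perm j N (hj : (j <= N)%N) (s : 'I_j -> 'I_N) :
  injective s -> exists sg : 'S_N, forall i, sg (widen_ord hj i) = s i.
Proof.
move=> sI.
case: N hj s sI => [|N] hj s sI.
  by exists 1%g => i; have := ltn_ord (s i); rewrite ltn0.
(* The permutation enumerates the values of [s], then the other indices. *)
pose l := codom s ++ [seq x <- enum 'I_N.+1 | x \notin codom s].
have ul : uniq l.
  rewrite cat_uniq filter_uniq ?enum_uniq// andbT map_inj_uniq ?enum_uniq//=.
  by apply/hasPn => x; rewrite mem_filter => /andP[].
have sl : size l = N.+1.
  rewrite -[RHS]card_ord -(card_uniqP ul); apply: eq_card => x.
  by rewrite mem_cat mem_filter mem_enum andbT; case: (x \in codom s).
have nI : injective (fun i : 'I_N.+1 => nth ord0 l i).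
  by move=> a b /eqP; rewrite nth_uniq ?sl// => /eqP/val_inj.
exists (perm nI) => i; rewrite permE nth_cat size_codom card_ord /= ltn_ord.
by rewrite (nth_map i) ?size_enum_ord//= nth_ord_enum.
Qed.

(** An injective choice of coordinates is the restriction of a permutation. *)
Lemma select_symmetric N (G : probability (N.-tuple T) R) j (hj : (j <= N)%N)
    (s : 'I_j -> 'I_N) : symmetric_law G -> injective s ->
  forall A, measurable A -> image_law (measurable_select s) G A = marginal hj G A.
Proof.
move=> Gsym sI A mA; have [sg sgE] := injection_extends_to_perm hj sI.
rewrite image_lawE.
have -> : select s @^-1` A = permute sg @^-1` (first_coords hj @^-1` A).
  apply/seteqP; split => X /=; (rewrite (_ : first_coords hj (permute sg X) = select s X)//;
    by apply: eq_from_tnth => i; rewrite !tnth_mktuple sgE).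
have := Gsym sg (first_coords hj @^-1` A); apply.
by rewrite -[X in measurable X]setTI; exact: (measurable_funP (first_coords hj)).
Qed.

Lemma widen_ord_injective j N (hj : (j <= N)%N) : injective (widen_ord hj).
Proof. by move=> a b /(congr1 val)/= ab; apply/val_inj. Qed.

Lemma tensor_power_symmetric (f : probability T R) N : symmetric_law (tensor_power f N).
Proof. by move=> sg A mA; exact: (select_tensor_power f (@perm_inj _ sg) mA). Qed.

Lemma marginal_tensor_power (f : probability T R) j N (hj : (j <= N)%N) A : measurable A ->
  marginal hj (tensor_power f N) A = tensor_power f j A.
Proof. by move=> mA; exact: (select_tensor_power f (@widen_ord_injective _ _ hj) mA). Qed.

Lemma Ex_coord (f : probability T R) N (i : 'I_N) g : bmfun g ->
  Ex (tensor_power f N) (fun X => g (tnth X i)) = Ex f g.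
Proof.
move=> bg; have sI : injective (fun _ : 'I_1 => i) by move=> a b _; rewrite !ord1.
have := Ex_ext (fun X => g (tnth X ord0)) (select_tensor_power f sI).
have bg1 n (m : 'I_n) : bmfun (fun X : n.-tuple T => g (tnth X m)).
  by apply: (bm_comp (measurable_tnth m) bg).
rewrite Ex_image_law; last exact: bg1.
rewrite Ex_tensorS; last exact: bg1.
under eq_Ex do rewrite tnth_mktuple; move=> ->.
by apply: eq_Ex => x; rewrite Ex_tensor0//; exact: (@bm_cst _ (0.-tuple T) R (g x)).
Qed.

Lemma Ex_coord2 (f : probability T R) N (i i' : 'I_N) (g : T * T -> R) : i != i' -> bmfun g ->
  Ex (tensor_power f N) (fun X => g (tnth X i, tnth X i')) =
  Ex f (fun x => Ex f (fun y => g (x, y))).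
Proof.
move=> ii' bg; have sI : injective (fun m : 'I_2 => if m == ord0 then i else i').
  move=> a b; case: (unliftP ord0 a) => [a'|] ->; case: (unliftP ord0 b) => [b'|] -> //=.
  - by rewrite !ord1.
  - by move=> e; rewrite e eqxx in ii'.
  - by move=> e; rewrite e eqxx in ii'.
have bg2 n (m m' : 'I_n) : bmfun (fun X : n.-tuple T => g (tnth X m, tnth X m')).
  apply: (bm_comp (f := fun X : n.-tuple T => (tnth X m, tnth X m'))) => //.
  by apply: measurable_fun_pair; exact: measurable_tnth.
have := Ex_ext (fun X => g (tnth X ord0, tnth X (lift ord0 ord0))) (select_tensor_power f sI).
rewrite Ex_image_law; last exact: bg2.
rewrite Ex_tensorS; last exact: bg2.
under eq_Ex do rewrite !tnth_mktuple; move=> ->.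
apply: eq_Ex => x.
have bx : bmfun (fun X : 1.-tuple T => g (x, tnth X ord0)).
  apply: (bm_comp (f := fun X : 1.-tuple T => (x, tnth X ord0))) => //.
  by apply: measurable_fun_pair => //; exact: measurable_tnth.
transitivity (Ex (tensor_power f 1) (fun X => g (x, tnth X ord0))).
  by apply: eq_Ex => X; rewrite tnthS.
rewrite (Ex_tensorS _ bx).
by apply: eq_Ex => y; rewrite Ex_tensor0//; exact: (@bm_cst _ (0.-tuple T) R (g (x, y))).
Qed.

End tuples.

Section tuple_map.
Context d1 d2 (T : measurableType d1) (U : measurableType d2) (R : realType).
Variables (h : T -> U) (mh : measurable_fun setT h).

Definition map_coords n (X : n.-tuple T) : n.-tuple U := [tuple h (tnth X i) | i < n].

Lemma measurable_map_coords n : measurable_fun setT (@map_coords n).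
Proof.
apply/measurable_fun_tnthP => i.
rewrite (_ : _ \o _ = fun X => h (tnth X i)).
  by apply: measurableT_comp => //; exact: measurable_tnth.
by apply/funext => X /=; rewrite tnth_mktuple.
Qed.

Lemma map_coords_tensor_power (f : probability T R) (g : probability U R) n :
  (forall A, measurable A -> image_law mh f A = g A) -> forall A, measurable A ->
  image_law (@measurable_map_coords n) (tensor_power f n) A = tensor_power g n A.
Proof.
move=> fg; apply: laws_eq_on_boxes => A mA; rewrite image_lawE tensor_power_box//.
have -> : @map_coords n @^-1` box A = box (fun i => h @^-1` A i).
  by apply/seteqP; split => X /= AX i; have := AX i; rewrite tnth_mktuple.
rewrite tensor_power_box; last by move=> i; rewrite -[X in measurable X]setTI; exact: mh.
by apply: eq_bigr => i _; rewrite -fg.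
Qed.

End tuple_map.

(** * Wasserstein distance and index plans *)

Section w1.
Context d (U : measurableType d) (R : realType) (c : U -> U -> R).
Hypothesis cM : measurable_fun setT (fun z : U * U => c z.1 z.2).
Hypothesis c01 : forall x y, 0 <= c x y <= 1.

Let cc (z : U * U) := c z.1 z.2.

Lemma bm_cost : bmfun cc.
Proof. by apply: (@bm_between _ _ _ 0 1) => // z; exact: c01. Qed.

Variables (mu nu : {measure set U -> \bar R}).
Hypotheses (mu1 : mu setT = 1%E) (nu1 : nu setT = 1%E).

Lemma wasserstein1_le p : couplings mu nu p -> (wasserstein1 c mu nu <= (Ex p cc)%:E)%E.
Proof. by move=> pc; apply: ereal_inf_lbound; exists p => //; rewrite -ExE//; exact: bm_cost. Qed.

Lemma wasserstein1_ge (a : \bar R) :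
  (forall p, couplings mu nu p -> (a <= (Ex p cc)%:E)%E) -> (a <= wasserstein1 c mu nu)%E.
Proof.
move=> h; apply: le_ereal_inf_tmp => _ [p pc <-].
by rewrite -/(cc _) ExE; [exact: h|exact: bm_cost].
Qed.

Lemma coupling_exists : couplings mu nu !=set0.
Proof.
exists (prod_probability (probability_of mu1) (probability_of nu1)) => A mA; split.
  rewrite /pushforward (_ : fst @^-1` A = A `*` setT); last first.
    by apply/seteqP; split => -[x y] //= [].
  transitivity (mu A * nu setT)%E; last by rewrite nu1 mule1.
  exact: product_measure1E.
rewrite /pushforward (_ : snd @^-1` A = setT `*` A); last first.
  by apply/seteqP; split => -[x y] //= [].
transitivity (mu setT * nu A)%E; last by rewrite mu1 mul1e.
exact: product_measure1E.
Qed.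

Definition w1 : R := fine (wasserstein1 c mu nu).

Lemma wasserstein1E : wasserstein1 c mu nu = w1%:E.
Proof.
have [p pc] := coupling_exists.
rewrite /w1 fineK// ge0_fin_numE.
  by rewrite (le_lt_trans (wasserstein1_le pc))// ltry.
apply: wasserstein1_ge => q _; rewrite lee_fin Ex_ge0// => z.
by have /andP[] := c01 z.1 z.2.
Qed.

Lemma w1_le p : couplings mu nu p -> w1 <= Ex p cc.
Proof. by move=> pc; rewrite -lee_fin -wasserstein1E; exact: wasserstein1_le. Qed.

Lemma w1_ge (a : R) : (forall p, couplings mu nu p -> a <= Ex p cc) -> a <= w1.
Proof.
by move=> h; rewrite -lee_fin -wasserstein1E; apply: wasserstein1_ge => p pc; rewrite lee_fin h.
Qed.

Lemma w1_01 : 0 <= w1 <= 1.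
Proof.
have [p pc] := coupling_exists; apply/andP; split.
  by apply: w1_ge => q _; rewrite Ex_ge0// => z; have /andP[] := c01 z.1 z.2.
apply: (le_trans (w1_le pc)); apply: Ex_le_cst; first exact: bm_cost.
by move=> z; have /andP[] := c01 z.1 z.2.
Qed.

Lemma w1_approx (e : R) : 0 < e -> exists2 p, couplings mu nu p & Ex p cc <= w1 + e.
Proof.
move=> e0; apply: contrapT => h.
suff : w1 + e <= w1 by rewrite gerDl leNgt e0.
apply: w1_ge => p pc; rewrite leNgt; apply/negP => lt.
by apply: h; exists p => //; exact: ltW.
Qed.

End w1.

Section natprod.
Context d1 d2 (T : measurableType d1) (U : measurableType d2) (R : realType).

Lemma measurable_nat_prod (f : nat * T -> U) :
  (forall i, measurable_fun setT (fun y => f (i, y))) -> measurable_fun setT f.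
Proof.
move=> mf _ A mA; rewrite setTI.
rewrite (_ : f @^-1` A = \bigcup_i ([set i] `*` ((fun y => f (i, y)) @^-1` A))).
  apply: bigcup_measurable => i _; apply: measurableX => //.
  by rewrite -[X in measurable X]setTI; exact: mf.
apply/seteqP; split => -[i y] /=; first by move=> Afy; exists i.
by move=> [j _ [/= ->]].
Qed.

Lemma measurable_prod_nat (f : T * nat -> U) :
  (forall i, measurable_fun setT (fun y => f (y, i))) -> measurable_fun setT f.
Proof.
move=> mf; rewrite (_ : f = (fun z => f (z.2, z.1)) \o (fun z => (z.2, z.1))); last first.
  by apply/funext => -[].
by apply: measurableT_comp; [exact: measurable_nat_prod|exact: measurable_fun_pair].
Qed.

Variables (N : nat) (N0 : (0 < N)%N).

Let unif_measure : {measure set nat -> \bar R} :=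
  mscale ((N%:R^-1)%:nng)%R (msum (fun i => \d_i) N).

Let unif1 : unif_measure setT = 1%E.
Proof.
rewrite /unif_measure /= /mscale/= /msum/=.
under eq_bigr do rewrite diracT.
rewrite sumEFin -EFinM big_const_ord iter_addr addr0 mulVf//.
by rewrite pnatr_eq0 -lt0n.
Qed.

(** Indices live in [nat] rather than in an ordinal type: every set of naturals is
    measurable, and [nth] reads off the corresponding particle. *)
Definition uniform_index : probability nat R := probability_of unif1.

Lemma Ex_uniform_index g : bmfun g -> Ex uniform_index g = N%:R^-1 * \sum_(i < N) g i.
Proof.
move=> bg; have [M [bgM gM0]] := bm_shift bg.
have bM : bmfun (fun _ : nat => M) by exact: bm_cst.
have -> : Ex uniform_index g = Ex uniform_index (fun z => g z + M) - M.
  by rewrite ExD// Ex_cst addrK.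
apply/eqP; rewrite subr_eq; apply/eqP; apply: EFin_inj; rewrite -ExE//.
have mg : measurable_fun setT (fun x => (g x + M)%:E).
  by apply/measurable_EFinP; exact: bgM.1.
have g0 y : setT y -> (0 <= (g y + M)%:E)%E by move=> _; rewrite lee_fin.
rewrite [LHS]ge0_integral_mscale//=.
rewrite ge0_integral_measure_sum//.
rewrite (eq_bigr (fun i : 'I_N => (g i + M)%:E)); last first.
  move=> i _; transitivity ((\d_(i : nat) setT) * (g i + M)%:E)%E.
    exact: integral_dirac.
  by rewrite diracT mul1e.
rewrite sumEFin -EFinM; congr EFin.
rewrite big_split/= mulrDr; congr (_ + _).
rewrite sumr_const card_ord -(mulr_natl M) mulrA mulVf ?mul1r//.
by rewrite pnatr_eq0 -lt0n.
Qed.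

End natprod.

(** The last condition is separability in the form in which it is used: the space
    splits into countably many measurable cells of arbitrarily small diameter. *)
Record bounded_metric d (T : measurableType d) (R : realType) (c : T -> T -> R) : Prop := {
  bounded_metric_measurable : measurable_fun setT (fun z : T * T => c z.1 z.2);
  bounded_metric01 : forall x y, 0 <= c x y <= 1;
  bounded_metricxx : forall x, c x x = 0;
  bounded_metricC : forall x y, c x y = c y x;
  bounded_metric_triangle : forall y x z, c x z <= c x y + c y z;
  bounded_metric_cells : forall e : R, 0 < e -> exists2 l : T -> nat,
    measurable_fun setT l & forall x y, l x = l y -> c x y <= e
}.

Section plans.
Context d (T : measurableType d) (R : realType) (c : T -> T -> R).
Hypothesis cP : bounded_metric c.
Variables (N : nat) (N0 : (0 < N)%N) (f : probability T R).

Let cM := bounded_metric_measurable cP.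
Let c01 := bounded_metric01 cP.
Let ctri := bounded_metric_triangle cP.

(** Transport plans that speak of the indices of the particles instead of their
    positions, and thus make sense for all configurations at once. *)
Definition index_plan : set (probability (nat * T)%type R) :=
  [set th | (forall A, image_law measurable_fst th A = uniform_index R N0 A) /\
            (forall B, measurable B -> image_law measurable_snd th B = f B)].

Definition plan_cost (X : N.-tuple T) (th : probability (nat * T)%type R) : R :=
  Ex th (fun z => c (nth point X z.1) z.2).

Lemma bm_nth (X : N.-tuple T) g : bmfun g -> bmfun (fun i => g (nth point X i) : R).
Proof. by move=> [_ [M gM]]; split => //; exists M. Qed.

Lemma bm_cost_comp d' (S : measurableType d') (F G : S -> T) :
  measurable_fun setT F -> measurable_fun setT G -> bmfun (fun z => c (F z) (G z)).
Proof.
move=> mF mG; apply: (bm_comp (f := fun z => (F z, G z)) _ (bm_cost cM c01)).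
exact: measurable_fun_pair.
Qed.

Lemma measurable_nth_fst (X : N.-tuple T) :
  measurable_fun setT (fun z : nat * T => nth point X z.1).
Proof. exact: measurable_nat_prod. Qed.

Lemma bm_plan_cost (X : N.-tuple T) : bmfun (fun z : nat * T => c (nth point X z.1) z.2).
Proof. by apply: bm_cost_comp => //; exact: measurable_nth_fst. Qed.

Lemma plan_fst th g : index_plan th -> bmfun g ->
  Ex th (fun z => g z.1) = N%:R^-1 * \sum_(i < N) g i.
Proof.
move=> [th1 _] bg; rewrite -(Ex_uniform_index N0 bg) -(Ex_image_law measurable_fst)//.
by apply: Ex_ext => A _; exact: th1.
Qed.

Lemma plan_snd th g : index_plan th -> bmfun g -> Ex th (fun z => g z.2) = Ex f g.
Proof. by move=> [_ th2] bg; rewrite -(Ex_image_law measurable_snd)//; exact: Ex_ext. Qed.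

Lemma empirical_unif (X : N.-tuple T) A :
  empirical R X A = uniform_index R N0 ((fun i => nth point X i) @^-1` A).
Proof. by []. Qed.

Lemma empirical1 (X : N.-tuple T) : empirical R X setT = 1%E.
Proof. by rewrite empirical_unif preimage_setT; exact: probability_setT. Qed.

Lemma coupling_fst_empirical (X : N.-tuple T) p (g : T -> R) :
  couplings (empirical R X) f p -> bmfun g ->
  Ex p (fun z => g z.1) = N%:R^-1 * \sum_(i < N) g (tnth X i).
Proof.
move=> pc bg.
have mn : measurable_fun setT (fun i => nth point X i) by [].
rewrite -(Ex_image_law measurable_fst)// (_ : Ex _ _ = Ex (image_law mn (uniform_index R N0)) g).
  rewrite Ex_image_law// Ex_uniform_index; last exact: bm_nth.
  by congr (_ * _); apply: eq_bigr => i _; rewrite (tnth_nth point).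
by apply: Ex_ext => A mA; have [] := pc A mA.
Qed.

Lemma coupling_snd (mu : {measure set T -> \bar R}) p (g : T -> R) :
  couplings mu f p -> bmfun g -> Ex p (fun z => g z.2) = Ex f g.
Proof.
move=> pc bg; rewrite -(Ex_image_law measurable_snd)//.
by apply: Ex_ext => A mA; have [] := pc A mA.
Qed.

Lemma plan_coupling (X : N.-tuple T) th : index_plan th ->
  exists2 p, couplings (empirical R X) f p & Ex p (fun z => c z.1 z.2) = plan_cost X th.
Proof.
move=> [th1 th2].
have mF : measurable_fun setT (fun z : nat * T => (nth point X z.1, z.2)).
  by apply: measurable_fun_pair => //; exact: measurable_nth_fst.
exists (image_law mF th); last first.
  by rewrite Ex_image_law//; exact: bm_cost.
move=> A mA; split; last exact: th2.
exact: (th1 ((fun i => nth point X i) @^-1` A)).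
Qed.

Lemma bm_cell (l : T -> nat) i : measurable_fun setT l -> bmfun (fun u : T => (l u == i)%:R : R).
Proof.
move=> ml; apply: bm_bool; rewrite (_ : [set x | _] = l @^-1` [set i]).
  by rewrite -[X in measurable X]setTI; exact: ml.
by apply/seteqP; split => x /= /eqP.
Qed.

(** Several particles may sit at the same place, so the index cannot be read off a
    coupling. Instead, given the first coordinate of the coupling, the index is
    uniform among the particles of [X] in the same small cell, which displaces the
    particle by at most [e]. *)
Lemma coupling_plan (X : N.-tuple T) p (e : R) : 0 < e -> couplings (empirical R X) f p ->
  exists2 th, index_plan th & plan_cost X th <= Ex p (fun z => c z.1 z.2) + e.
Proof.
move=> e0 pc; have [l ml lc] := bounded_metric_cells cP e0.
(* [m u] is the proportion of the particles in the cell of [u], and [s i u] is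
   [N] times the probability of the index [i] given [u]. *)
pose m (u : T) : R := N%:R^-1 * \sum_(j < N) (l (nth point X j) == l u)%:R.
pose s i (u : T) : R := (l (nth point X i) == l u)%:R / m u.
have N1 : (0 : R) < N%:R^-1 by rewrite invr_gt0 ltr0n.
have m0 u : 0 <= m u by apply: mulr_ge0; [exact: ltW|exact: sumr_ge0].
have mE i u : l (nth point X i) = l u -> m u = m (nth point X i) by rewrite /m => ->.
have mX (i : 'I_N) : 0 < m (nth point X i).
  rewrite mulr_gt0// (bigD1 i)//= eqxx.
  by apply: ltr_pwDl; [exact: ltr01|exact: sumr_ge0].
have s0 i u : 0 <= s i u by rewrite divr_ge0.
have sE i u : s i u = (m (nth point X i))^-1 * (l u == l (nth point X i))%:R.
  rewrite /s [RHS]mulrC [in RHS]eq_sym.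
  by case: eqP => [/mE->|_]; rewrite ?mul0r.
have bs i : bmfun (s i).
  rewrite (_ : s i = fun u => (m (nth point X i))^-1 * (l u == l (nth point X i))%:R).
    by apply: bmZ; exact: bm_cell.
  by apply/funext => u.
have sN i u : s i u <= N%:R.
  rewrite /s /m -natr_sum; set k := (\sum_(j < N) _)%N.
  case: (posnP k) => [->|k0]; first by rewrite mulr0 invr0 mulr0.
  rewrite ler_pdivrMr ?mulr_gt0 ?ltr0n// mulrA divff ?mul1r ?pnatr_eq0 -?lt0n//.
  by rewrite (@le_trans _ _ 1)// ?lern1 ?ler1n// leq_b1.
(* [H u] is 1 if the cell of [u] contains a particle, which holds almost surely
   under [p], and 0 otherwise. *)
pose H u := N%:R^-1 * \sum_(i < N) s i u.
have HE u : H u = m u / m u by rewrite /H /s -mulr_suml mulrA.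
have H01 u : 0 <= H u <= 1.
  rewrite HE; have [->|mn0] := eqVneq (m u) 0; first by rewrite mul0r lexx ler01.
  by rewrite divff// ler01 lexx.
have bH : bmfun H by apply: bmZ; apply: bm_sum => i; exact: bs.
have Es (i : 'I_N) : Ex p (fun z => s i z.1) = 1.
  rewrite (coupling_fst_empirical pc (bs i)).
  under eq_bigr => k _ do rewrite sE (tnth_nth point).
  rewrite -mulr_sumr mulrCA (_ : N%:R^-1 * _ = m (nth point X i)).
    by rewrite mulVf// gt_eqF.
  by [].
have bs1 i : bmfun (fun z : T * T => s i z.1) by exact: (bm_comp measurable_fst (bs i)).
pose h (w : (T * T) * nat) := s w.2 w.1.1.
have bh : bmfun h.
  apply: (@bm_between _ _ _ 0 N%:R); last by move=> w; rewrite s0 sN.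
  by apply: measurable_prod_nat => i; exact: (bs1 i).1.
have h0 w : 0 <= h w by exact: s0.
have bu (g : nat -> R) : (exists M, forall i, `|g i| <= M) -> bmfun g by split.
have Eprod (g : nat * T -> R) : bmfun g ->
    Ex (prod_probability p (uniform_index R N0)) (fun w => h w * g (w.2, w.1.2)) =
    Ex p (fun z => N%:R^-1 * \sum_(i < N) s i z.1 * g (i : nat, z.2)).
  move=> bg.
  have bg' : bmfun (fun w : (T * T) * nat => g (w.2, w.1.2)).
    apply: (bm_comp (f := fun w : (T * T) * nat => (w.2, w.1.2)) _ bg).
    by apply: measurable_fun_pair => //; exact: measurableT_comp.
  rewrite Ex_prod; last exact: bmM.
  apply: eq_Ex => z; rewrite Ex_uniform_index//.
  have [_ [M gM]] := bmM bh bg'.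
  by apply: bu; exists M => i; exact: (gM (z, i)).
have h1 : Ex (prod_probability p (uniform_index R N0)) h = 1.
  have := Eprod (fun _ => 1) (bm_cst _ 1).
  under eq_Ex do rewrite mulr1; move=> ->.
  under eq_Ex do (under eq_bigr do rewrite mulr1).
  rewrite ExZ; last by apply: bm_sum => i; exact: bs1.
  rewrite Ex_sum; last by move=> i; exact: bs1.
  under eq_bigr do rewrite Es.
  by rewrite sumr_const card_ord mulVf// pnatr_eq0 -lt0n.
have mG : measurable_fun setT (fun w : (T * T) * nat => (w.2, w.1.2)).
  by apply: measurable_fun_pair => //; exact: measurableT_comp.
pose th := image_law mG (density_law bh h0 h1).
have thE g : bmfun g -> Ex th g = Ex p (fun z => N%:R^-1 * \sum_(i < N) s i z.1 * g (i : nat, z.2)).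
  move=> bg; rewrite -Eprod// Ex_image_law// Ex_density_law//.
  exact: (bm_comp mG bg).
exists th; last first.
  rewrite /plan_cost thE; last exact: bm_plan_cost.
  have -> : Ex p (fun z => c z.1 z.2) + e = Ex p (fun z => c z.1 z.2 + e).
    by rewrite ExD ?Ex_cst//; [exact: bm_cost|exact: bm_cst].
  apply: Ex_le.
  - apply: bmZ; apply: bm_sum => i; apply: bmM => //=.
    by apply: (@bm_cost_comp _ (T * T)%type (fun _ => nth point X i) snd).
  - by apply: bmD; [exact: bm_cost|exact: bm_cst].
  - move=> [u y] /=.
    have ce0 : 0 <= c u y + e by apply: addr_ge0; [have /andP[] := c01 u y|exact: ltW].
    apply: (@le_trans _ _ (H u * (c u y + e))); last first.
      by rewrite ler_piMl//; have /andP[] := H01 u.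
    rewrite /H -mulrA; apply: ler_wpM2l; first exact: ltW.
    rewrite mulr_suml; apply: ler_sum => i _.
    rewrite /s; case: eqP => [li|_]; last by rewrite !mul0r.
    rewrite ler_wpM2l ?divr_ge0//.
    by rewrite (le_trans (ctri u _ _))// addrC lerD2l lc.
split.
- move=> A; have mA : measurable A by [].
  rewrite -!Ex_indic//; congr EFin.
  rewrite Ex_image_law; last exact: bm_indic.
  rewrite thE; last by apply: (bm_comp measurable_fst); exact: bm_indic.
  rewrite Ex_uniform_index; last exact: bm_indic.
  rewrite ExZ; last by apply: bm_sum => i; apply: bmM => //; exact: (@bm_cst _ (T * T)%type R (\1_A (i : nat))).
  congr (_ * _); rewrite Ex_sum; last by move=> i; apply: bmM => //; exact: (@bm_cst _ (T * T)%type R (\1_A (i : nat))).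
  apply: eq_bigr => i _.
  transitivity (Ex p (fun z => \1_A (i : nat) * s i z.1)).
    by apply: eq_Ex => z; rewrite mulrC.
  by rewrite ExZ// Es mulr1.
- move=> B mB; rewrite -!Ex_indic//; congr EFin.
  rewrite Ex_image_law; last exact: bm_indic.
  rewrite thE; last by apply: (bm_comp measurable_snd); exact: bm_indic.
  rewrite -(coupling_snd pc (bm_indic R mB)).
  have bB : bmfun (fun z : T * T => \1_B z.2 : R).
    by apply: (bm_comp measurable_snd); exact: bm_indic.
  have bH1 : bmfun (fun z : T * T => H z.1) by exact: (bm_comp measurable_fst bH).
  have EH : Ex p (fun z => H z.1) = 1.
    rewrite /H ExZ; last by apply: bm_sum => i; exact: bs1.
    rewrite Ex_sum; last by move=> i; exact: bs1.
    under eq_bigr do rewrite Es.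
    by rewrite sumr_const card_ord mulVf// pnatr_eq0 -lt0n.
  rewrite (_ : Ex p _ = Ex p (fun z => H z.1 * \1_B z.2)); last first.
    by apply: eq_Ex => z; rewrite /H -mulrA mulr_suml.
  have bB01 z : 0 <= (\1_B z : R) <= 1.
    by rewrite indicE; case: (_ \in _); rewrite /= ?lexx ?ler01.
  apply/eqP; rewrite eq_le; apply/andP; split.
    apply: Ex_le => //; first exact: bmM.
    move=> z; have /andP[B0 _] := bB01 z.2.
    by rewrite ler_piMl//; have /andP[] := H01 z.1.
  rewrite -subr_le0 -ExB//; last exact: bmM.
  rewrite -(subrr (1 : R)) -{2}EH -[X in _ <= X - _](Ex_cst p) -ExB//; last exact: bm_cst.
  apply: Ex_le; [by apply: bmB => //; exact: bmM|by apply: bmB => //; exact: bm_cst|].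
  move=> z; rewrite -{1}[\1_B _]mul1r -mulrBl.
  have /andP[B0 B1] := bB01 z.2.
  by rewrite ler_piMr// subr_ge0; have /andP[] := H01 z.1.
Qed.

End plans.

(** * Distance of the empirical measure from a law *)

Section tuple_cost.
Context d (T : measurableType d) (R : realType) (c : T -> T -> R).
Hypothesis cM : measurable_fun setT (fun z : T * T => c z.1 z.2).
Hypothesis c01 : forall x y, 0 <= c x y <= 1.

Lemma measurable_tuple_dist j :
  measurable_fun setT (fun z : j.-tuple T * j.-tuple T => tuple_dist c z.1 z.2).
Proof.
suff [] : bmfun (fun z : j.-tuple T * j.-tuple T => tuple_dist c z.1 z.2) by [].
apply: bmZ; apply: bm_sum => i.
apply: (bm_comp (f := fun z : j.-tuple T * j.-tuple T => (tnth z.1 i, tnth z.2 i)) _ (bm_cost cM c01)).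
by apply: measurable_fun_pair; apply: (measurableT_comp (measurable_tnth i)).
Qed.

Lemma tuple_dist01 j (X Y : j.-tuple T) : 0 <= tuple_dist c X Y <= 1.
Proof.
apply/andP; split.
  by apply: mulr_ge0 => //; apply: sumr_ge0 => i _; have /andP[] := c01 (tnth X i) (tnth Y i).
have [j00|j0] := posnP j.
  by rewrite /tuple_dist [X in X%:R^-1]j00 invr0 mul0r ler01.
rewrite /tuple_dist mulrC ler_pdivrMr ?ltr0n// mul1r.
have -> : j%:R = \sum_(i < j) (1 : R) by rewrite sumr_const card_ord.
by apply: ler_sum => i _; have /andP[] := c01 (tnth X i) (tnth Y i).
Qed.

End tuple_cost.

Section cells.
Context d (T : measurableType d) (R : realType) (c : T -> T -> R).
Hypothesis cP : bounded_metric c.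

Lemma tuple_nat_measurable N (A : set (N.-tuple nat)) : measurable A.
Proof.
rewrite (_ : A = \bigcup_n (fun Y : N.-tuple nat => A Y /\ pickle (val Y) = n)); last first.
  by apply/seteqP; split => Y /=; [exists (pickle (val Y))|move=> [n _ []]].
apply: bigcup_measurable => n _.
have [[Y AY Yn]|h] := pselect (exists2 Y : N.-tuple nat, A Y & pickle (val Y) = n).
  rewrite (_ : (fun _ => _) = box (fun i => [set tnth Y i])).
    by apply: measurable_box.
  apply/seteqP; split => Z /=.
    move=> [AZ Zn] i; congr tnth; apply/val_inj.
    by apply: (pcan_inj (@pickleK _)); rewrite Zn.
  by move=> ZY; have -> : Z = Y by exact: eq_from_tnth.
rewrite (_ : (fun _ => _) = set0)//; apply/seteqP; split => // Z [AZ Zn].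
by apply: h; exists Z.
Qed.

Lemma tuple_cells N (e : R) : 0 < e -> exists2 H : N.-tuple T -> nat,
  measurable_fun setT H & forall X Y, H X = H Y -> tuple_dist c X Y <= e.
Proof.
move=> e0; have [l ml lc] := bounded_metric_cells cP e0.
exists (fun X => pickle (val (map_coords l X))).
  move=> _ A _; rewrite setTI.
  have := @measurable_map_coords _ _ _ _ l ml N measurableT
    ((fun Y : N.-tuple nat => pickle (val Y)) @^-1` A) (tuple_nat_measurable _).
  by rewrite setTI.
move=> X Y /(pcan_inj (@pickleK _))/val_inj XY.
have [N0|N0] := posnP N; first by rewrite /tuple_dist [X in X%:R^-1]N0 invr0 mul0r ltW.
rewrite /tuple_dist mulrC ler_pdivrMr ?ltr0n//.
have -> : e * N%:R = \sum_(i < N) e by rewrite sumr_const card_ord mulr_natr.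
by apply: ler_sum => i _; apply: lc; have := congr1 (fun Z => tnth Z i) XY; rewrite !tnth_mktuple.
Qed.

End cells.

Section empirical_distance.
Context d (T : measurableType d) (R : realType) (c : T -> T -> R).
Hypothesis cP : bounded_metric c.
Variables (N : nat) (N0 : (0 < N)%N) (f : probability T R).

Let cM := bounded_metric_measurable cP.
Let c01 := bounded_metric01 cP.
Let ctri := bounded_metric_triangle cP.

Definition w1_empirical (X : N.-tuple T) : R := w1 c (empirical R X) f.
Local Notation W := w1_empirical.
Local Notation plan := (index_plan N0 f).

Lemma wasserstein1_empirical X : wasserstein1 c (empirical R X) f = (W X)%:E.
Proof. exact: (@wasserstein1E _ _ _ _ cM c01 (empirical R X) f (empirical1 R N0 X) (probability_setT f)). Qed.

Lemma w1_empirical01 X : 0 <= W X <= 1.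
Proof. exact: (@w1_01 _ _ _ _ cM c01 (empirical R X) f (empirical1 R N0 X) (probability_setT f)). Qed.

Lemma w1_empirical_le X th : plan th -> W X <= plan_cost c X th.
Proof.
move=> /(plan_coupling cP X)[p pc <-].
exact: (@w1_le _ _ _ _ cM c01 (empirical R X) f (empirical1 R N0 X) (probability_setT f) _ pc).
Qed.

Lemma w1_empirical_plan X (e : R) : 0 < e -> exists2 th, plan th & plan_cost c X th <= W X + e.
Proof.
move=> e0; have e2 : 0 < e / 2 by rewrite divr_gt0.
have [p pc pe] := @w1_approx _ _ _ _ cM c01 (empirical R X) f (empirical1 R N0 X) (probability_setT f) _ e2.
have [th thP thc] := coupling_plan cP N0 e2 pc.
exists th => //; rewrite (le_trans thc)// [e in leRHS]splitr addrA lerD2r//.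
Qed.

Lemma plan_cost_lip (X Y : N.-tuple T) th : plan th ->
  plan_cost c X th <= plan_cost c Y th + tuple_dist c X Y.
Proof.
move=> thP.
have bXY : bmfun (fun i : nat => c (nth point X i) (nth point Y i)).
  by split => //; exists 1 => i; have /andP[a b] := c01 (nth point X i) (nth point Y i); rewrite ger0_norm.
have -> : tuple_dist c X Y = Ex th (fun z => c (nth point X z.1) (nth point Y z.1)).
  rewrite (plan_fst thP bXY); congr (_ * _).
  by apply: eq_bigr => i _; rewrite !(tnth_nth point).
rewrite addrC -ExD; last exact: bm_plan_cost.
- apply: Ex_le; first exact: bm_plan_cost.
    apply: bmD; last exact: bm_plan_cost.
    exact: (bm_comp measurable_fst bXY).
  by move=> z; exact: ctri.
- exact: (bm_comp measurable_fst bXY).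
Qed.

Lemma tuple_distC (X Y : N.-tuple T) : tuple_dist c X Y = tuple_dist c Y X.
Proof. by congr (_ * _); apply: eq_bigr => i _; exact: bounded_metricC. Qed.

(** A plan near optimal for [Y] serves for [X] too. *)
Lemma w1_empirical_lip (X Y : N.-tuple T) : W X <= W Y + tuple_dist c X Y.
Proof.
apply/ler_addgt0Pr => e e0; have [th thP thc] := w1_empirical_plan Y e0.
rewrite (le_trans (w1_empirical_le X thP))// (le_trans (plan_cost_lip X Y thP))//.
by rewrite addrAC lerD2r.
Qed.

Lemma w1_empirical_dist (X Y : N.-tuple T) : `|W X - W Y| <= tuple_dist c X Y.
Proof.
rewrite ler_distl lerBlDr w1_empirical_lip andbT.
by have := w1_empirical_lip Y X; rewrite tuple_distC.
Qed.

(** The whole configuration space is approximated by countably many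
    configurations, chosen in a measurable way. *)
Lemma cell_rep (e : R) : 0 < e -> exists H : N.-tuple T -> nat, exists rep : nat -> N.-tuple T,
  measurable_fun setT H /\ forall X, tuple_dist c X (rep (H X)) <= e.
Proof.
move=> e0; have [H mH He] := tuple_cells cP N e0.
exists H; exists (fun n => if pselect (exists X, H X = n) is left h then projT1 (cid h) else [tuple point | i < N]).
split => // X; apply: He; case: pselect => [h|[]]; last by exists X.
by case: cid.
Qed.

(** [W] is a uniform limit of functions with countably many values. *)
Lemma measurable_w1_empirical : measurable_fun setT W.
Proof.
have eps n : 0 < n.+1%:R^-1 :> R by rewrite invr_gt0.
have /choice[Hr HrP] n : exists Hr : (N.-tuple T -> nat) * (nat -> N.-tuple T),
    measurable_fun setT Hr.1 /\ forall X, tuple_dist c X (Hr.2 (Hr.1 X)) <= n.+1%:R^-1.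
  by have [H [r Hr]] := cell_rep (eps n); exists (H, r).
apply: (measurable_fun_cvg (h := fun n X => W ((Hr n).2 ((Hr n).1 X)))).
  move=> n; have [mH _] := HrP n.
  by apply: (measurableT_comp (f := fun m => W ((Hr n).2 m))).
move=> X _; apply/cvgrPdist_le => e e0.
near=> n; have [_ h] := HrP n.
rewrite (le_trans (w1_empirical_dist _ _))// (le_trans (h X))//.
rewrite invf_ple ?posrE//; apply: ltW; apply: (@lt_le_trans _ _ n%:R); last by rewrite ler_nat.
near: n; exact: nbhs_infty_gtr.
Unshelve. all: by end_near. Qed.

Lemma bm_w1_empirical : bmfun W.
Proof.
by apply: (@bm_between _ _ _ 0 1); [exact: measurable_w1_empirical|exact: w1_empirical01].
Qed.

(** A plan near optimal for the representative of a cell is near optimal on the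
    whole cell, so that countable choice replaces a measurable selection. *)
Lemma plan_selection (e : R) : 0 < e -> exists H : N.-tuple T -> nat,
  exists th : nat -> probability (nat * T)%type R,
  [/\ measurable_fun setT H, forall n, plan (th n) &
      forall X, plan_cost c X (th (H X)) <= W X + e].
Proof.
move=> e0; have e3 : 0 < e / 3 by rewrite divr_gt0.
have [H [rep [mH Hrep]]] := cell_rep e3.
have /choice[th thP] n : exists th, plan th /\ plan_cost c (rep n) th <= W (rep n) + e / 3.
  by have [th ? ?] := w1_empirical_plan (rep n) e3; exists th.
exists H, th; split => // [n|X]; first by have [] := thP n.
have [p1 p2] := thP (H X).
have p3 := plan_cost_lip X (rep (H X)) p1.
have := w1_empirical_lip (rep (H X)) X; rewrite tuple_distC => p4.
have := Hrep X; lra.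
Qed.

End empirical_distance.

(** * Monotonicity in the number of particles *)

Section marginals.
Context d (T : measurableType d) (R : realType) (c : T -> T -> R).
Hypothesis cM : measurable_fun setT (fun z : T * T => c z.1 z.2).
Hypothesis c01 : forall x y, 0 <= c x y <= 1.
Variables (N : nat) (G : probability (N.-tuple T) R) (f : probability T R).
Hypothesis Gsym : symmetric_law G.

Definition omega j (hj : (j <= N)%N) : R :=
  w1 (@tuple_dist _ T R c j) (marginal hj G) (tensor_power f j).

Let tM := measurable_tuple_dist cM c01.
Let t01 := tuple_dist01 c01.

Lemma omegaE j (hj : (j <= N)%N) :
  wasserstein1 (@tuple_dist _ T R c j) (marginal hj G) (tensor_power f j) = (omega hj)%:E.
Proof.
exact: (@wasserstein1E _ _ _ _ (@tM j) (@t01 j) (marginal hj G) (tensor_power f j)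
  (probability_setT (marginal hj G)) (probability_setT (tensor_power f j))).
Qed.

Lemma omega_le j (hj : (j <= N)%N) p : couplings (marginal hj G) (tensor_power f j) p ->
  omega hj <= Ex p (fun z => tuple_dist c z.1 z.2).
Proof.
exact: (@w1_le _ _ _ _ (@tM j) (@t01 j) (marginal hj G) (tensor_power f j)
  (probability_setT (marginal hj G)) (probability_setT (tensor_power f j))).
Qed.

Lemma omega_approx j (hj : (j <= N)%N) (e : R) : 0 < e ->
  exists2 p, couplings (marginal hj G) (tensor_power f j) p &
    Ex p (fun z => tuple_dist c z.1 z.2) <= omega hj + e.
Proof.
exact: (@w1_approx _ _ _ _ (@tM j) (@t01 j) (marginal hj G) (tensor_power f j)
  (probability_setT (marginal hj G)) (probability_setT (tensor_power f j))).
Qed.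

Lemma omega01 j (hj : (j <= N)%N) : 0 <= omega hj <= 1.
Proof.
exact: (@w1_01 _ _ _ _ (@tM j) (@t01 j) (marginal hj G) (tensor_power f j)
  (probability_setT (marginal hj G)) (probability_setT (tensor_power f j))).
Qed.

Lemma bm_coord_cost n (i : 'I_n) :
  bmfun (fun z : n.-tuple T * n.-tuple T => c (tnth z.1 i) (tnth z.2 i)).
Proof.
apply: (bm_comp (f := fun z : n.-tuple T * n.-tuple T => (tnth z.1 i, tnth z.2 i)) _ (bm_cost cM c01)).
by apply: measurable_fun_pair; apply: (measurableT_comp (measurable_tnth i)).
Qed.

Lemma Ex_tuple_dist n (p : probability (n.-tuple T * n.-tuple T)%type R) :
  Ex p (fun z => tuple_dist c z.1 z.2) =
  n%:R^-1 * \sum_(i < n) Ex p (fun z => c (tnth z.1 i) (tnth z.2 i)).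
Proof.
rewrite ExZ; last by apply: bm_sum => i; exact: bm_coord_cost.
by rewrite Ex_sum// => i; exact: bm_coord_cost.
Qed.

Lemma omega_select j l (jN : (j <= N)%N) (lN : (l <= N)%N) (s : 'I_j -> 'I_l) p :
  injective s -> couplings (marginal lN G) (tensor_power f l) p ->
  omega jN <= j%:R^-1 * \sum_(i < j) Ex p (fun z => c (tnth z.1 (s i)) (tnth z.2 (s i))).
Proof.
move=> sI pc.
have mS : measurable_fun setT (fun z : l.-tuple T * l.-tuple T => (select s z.1, select s z.2)).
  by apply: measurable_fun_pair; apply: (measurableT_comp (measurable_select s)).
have ms A : measurable A -> measurable (select (T := T) s @^-1` A).
  by move=> mA; rewrite -[X in measurable X]setTI; exact: measurable_select.
have qc : couplings (marginal jN G) (tensor_power f j) (image_law mS p).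
  move=> A mA; have [p1 p2] := pc _ (ms A mA); split.
    have wsI : injective (widen_ord lN \o s) by apply: inj_comp => //; exact: widen_ord_injective.
    apply: (etrans _ (select_symmetric jN Gsym wsI mA)).
    transitivity (marginal lN G (select s @^-1` A)); first exact: p1.
    rewrite image_lawE /marginal /distribution /pushforward; congr (G _).
    apply/seteqP; split => X /=; (rewrite (_ : select s (first_coords lN X) = select (widen_ord lN \o s) X)//;
      by apply: eq_from_tnth => i; rewrite !tnth_mktuple).
  transitivity (tensor_power f l (select s @^-1` A)); first exact: p2.
  exact: (select_tensor_power f sI mA).
rewrite (le_trans (omega_le qc))// Ex_tuple_dist le_eqVlt; apply/orP; left; apply/eqP.
congr (_ * _); apply: eq_bigr => i _; rewrite Ex_image_law; last exact: bm_coord_cost.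
by apply: eq_Ex => z /=; rewrite !tnth_mktuple.
Qed.

(** Averaging the cost over the [l] cyclic shifts of a block of length [j] gives
    every coordinate the same weight, so that nothing is lost when [j] does not
    divide [l]. *)
Lemma omega_monotone j l (j0 : (0 < j)%N) (jl : (j <= l)%N) (jN : (j <= N)%N) (lN : (l <= N)%N) :
  omega jN <= omega lN.
Proof.
apply/ler_addgt0Pr => e e0; have [p pc pe] := omega_approx lN e0.
apply: le_trans pe; rewrite Ex_tuple_dist.
case: l => [|l] in jl lN p pc *; first by rewrite leqNgt j0 in jl.
pose a m := Ex p (fun z => c (tnth z.1 m) (tnth z.2 m)).
rewrite -[X in _ <= _ * X]/(\sum_(i < l.+1) a i).
have h r : omega jN <= j%:R^-1 * \sum_(i < j) a (widen_ord jl i + r).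
  apply: (omega_select jN (s := fun i => widen_ord jl i + r) _ pc).
  by move=> x y /addIr/widen_ord_injective.
rewrite mulrC ler_pdivlMr ?ltr0n//.
have -> : omega jN * l.+1%:R = \sum_(r < l.+1) omega jN by rewrite sumr_const card_ord mulr_natr.
rewrite (le_trans (ler_sum _ (fun r _ => h r)))// -mulr_sumr exchange_big/=.
have E (i : 'I_j) : \sum_(r < l.+1) a (widen_ord jl i + r) = \sum_(m < l.+1) a m.
  by rewrite [RHS](reindex_inj (addrI (widen_ord jl i))).
under eq_bigr do rewrite E.
rewrite sumr_const card_ord -(mulr_natl (\sum_(_ < _) _)) mulrA mulVf ?mul1r//.
by rewrite pnatr_eq0 -lt0n.
Qed.

End marginals.

(** * Sampling from the empirical measure *)

Section countable_kernel.
Context d1 d2 (X : measurableType d1) (Y : measurableType d2) (R : realType).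
Variables (G : probability X R) (H : X -> nat) (q : nat -> probability Y R).
Hypothesis mH : measurable_fun setT H.

Let mp (x : X) : measurable_fun setT (fun y : Y => (x, y)).
Proof. exact: pair1_measurable. Qed.

Let k (x : X) : probability (X * Y)%type R := image_law (mp x) (q (H x)).

Let mk A : measurable A -> measurable_fun setT (fun x => k x A).
Proof.
move=> mA.
rewrite (_ : (fun x => k x A) = (fun z => q z.2 (xsection A z.1)) \o (fun x => (x, H x))); last first.
  apply/funext => x /=; rewrite image_lawE /xsection; congr (q _ _).
  by apply/seteqP; split => y /=; rewrite inE.
apply: measurableT_comp; last exact: measurable_fun_pair.
by apply: measurable_prod_nat => n; exact: (measurable_fun_xsection (q n) mA).
Qed.

(** The second coordinate has law [q (H x)] given the first. The kernel is
    measurable because it only takes countably many values. *)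
Definition joint_law : probability (X * Y)%type R := bind_law G mk.

Lemma Ex_joint_law g : bmfun g -> Ex joint_law g = Ex G (fun x => Ex (q (H x)) (fun y => g (x, y))).
Proof.
move=> bg; rewrite Ex_bind//; apply: eq_Ex => x.
by rewrite Ex_image_law.
Qed.

Lemma bm_Ex_joint_law g : bmfun g -> bmfun (fun x => Ex (q (H x)) (fun y => g (x, y))).
Proof.
move=> bg; have := bm_Ex_bind mk bg; congr bmfun; apply/funext => x.
by rewrite Ex_image_law.
Qed.

End countable_kernel.

Section sampling.
Context d (T : measurableType d) (R : realType) (c : T -> T -> R).
Hypothesis cP : bounded_metric c.
Variables (N : nat) (N0 : (0 < N)%N) (G : probability (N.-tuple T) R) (f : probability T R).
Hypothesis Gsym : symmetric_law G.
Variables (j : nat) (j0 : (0 < j)%N) (jN : (j <= N)%N).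

Let cM := bounded_metric_measurable cP.
Let c01 := bounded_metric01 cP.

Let good (I : j.-tuple nat) : bool := uniq I && all (fun i => i < N)%N I.

(* When the indices collide the first coordinates are taken instead: for every
   fixed [I] the result has exactly the law of the marginal. *)
Let pick (X : N.-tuple T) (I : j.-tuple nat) : j.-tuple T :=
  if good I then [tuple nth point X (tnth I m) | m < j] else first_coords jN X.

Let bm_good : bmfun (fun I : j.-tuple nat => (~~ good I)%:R : R).
Proof. by apply: bm_bool; exact: tuple_nat_measurable. Qed.

Let collision_le (I : j.-tuple nat) : (~~ good I)%:R <=
  \sum_(m < j) (\sum_(m' < j | m' != m) (tnth I m == tnth I m')%:R + (N <= tnth I m)%N%:R) :> R.
Proof.
rewrite /good; case: (boolP (uniq I && _)) => [_|]; first by rewrite sumr_ge0// => m _; rewrite addr_ge0// sumr_ge0.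
rewrite negb_and => /orP[nu|/allPn[i iI iN]].
  have [m [m' [mm' e]]] : exists m m' : 'I_j, m' != m /\ tnth I m = tnth I m'.
    apply: contrapT => h; move/negP : nu; apply.
    apply/(uniqP 0%N) => x y; rewrite !inE size_tuple => xj yj e.
    apply: contrapT => xy; apply: h; exists (Ordinal xj), (Ordinal yj); split.
      by apply/eqP => -[] /esym.
    by rewrite !(tnth_nth 0%N).
  rewrite (bigD1 m)//= (bigD1 m')//= e eqxx -!addrA /=.
  rewrite lerDl !addr_ge0 ?sumr_ge0// => i _; rewrite ?addr_ge0 ?sumr_ge0//.
have /tnthP[m im] := iI.
rewrite (bigD1 m)//= -im leqNgt iN [_ + true%:R]addrC -addrA lerDl.
by rewrite addr_ge0// sumr_ge0// => m' _; rewrite addr_ge0// sumr_ge0.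
Qed.

Let collision_prob : Ex (tensor_power (uniform_index R N0) j) (fun I => (~~ good I)%:R) <= j%:R ^+ 2 / N%:R.
Proof.
have bmI (g : j.-tuple nat -> R) : (exists M, forall I, `|g I| <= M) -> bmfun g.
  by split => //; move=> _ A _; exact: tuple_nat_measurable.
have bmb (b : j.-tuple nat -> bool) : bmfun (fun I => (b I)%:R : R).
  by apply: bm_bool; exact: tuple_nat_measurable.
have bS (m : 'I_j) : bmfun (fun I : j.-tuple nat => \sum_(m' < j | m' != m) (tnth I m == tnth I m')%:R + (N <= tnth I m)%N%:R : R).
  by apply: bmD => //; exact: bm_sum.
apply: (le_trans (Ex_le _ bm_good _ collision_le)); first exact: bm_sum.
rewrite Ex_sum//.
have -> : j%:R ^+ 2 / N%:R = \sum_(m < j) j%:R / N%:R :> R.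
  by rewrite sumr_const card_ord -[RHS]mulr_natl expr2 mulrA.
apply: ler_sum => m _; rewrite ExD//; last exact: bm_sum.
have bN : bmfun (fun i => (N <= i)%N%:R : R) by apply: bm_bool.
rewrite (Ex_coord (uniform_index R N0) m bN) Ex_uniform_index// [X in _ * X]big1 ?mulr0 ?addr0; last first.
  by move=> i _; rewrite leqNgt ltn_ord.
rewrite Ex_sum//.
have E (m' : 'I_j) : m' != m ->
    Ex (tensor_power (uniform_index R N0) j) (fun I => (tnth I m == tnth I m')%:R) = N%:R^-1.
  move=> mm'.
  have bE : bmfun (fun z : nat * nat => (z.1 == z.2)%:R : R).
    apply: bm_bool; rewrite (_ : mkset _ = \bigcup_i ([set i] `*` [set i])).
      by apply: bigcup_measurable => i _; exact: measurableX.
    apply/seteqP; split => -[a b] /=; first by move=> /eqP /= ab; exists b => //=; split.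
    by move=> [i _ []] /= -> ->.
  rewrite eq_sym in mm'; rewrite (Ex_coord2 (uniform_index R N0) mm' bE).
  have bE1 a : bmfun (fun b : nat => (a == b)%:R : R) by apply: bm_bool.
  have -> : (fun x => Ex (uniform_index R N0) (fun y => (x == y)%:R)) =
      fun x => N%:R^-1 * \sum_(i < N) (x == i)%:R.
    by apply/funext => x; rewrite Ex_uniform_index.
  rewrite Ex_uniform_index; last by apply: bmZ; apply: bm_sum => i; apply: bm_bool.
  rewrite -mulr_sumr.
  have -> : \sum_(i < N) \sum_(i0 < N) (i == i0 :> nat)%:R = N%:R :> R.
    transitivity (\sum_(i < N) (1 : R)); last by rewrite sumr_const card_ord.
    apply: eq_bigr => i _; rewrite (bigD1 i)//= eqxx big1 ?addr0// => i' i'i.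
    by rewrite eq_sym (inj_eq val_inj) (negbTE i'i).
  by rewrite mulVf ?mulr1// pnatr_eq0 -lt0n.
rewrite (eq_bigr (fun _ => N%:R^-1)); last by move=> m' /E.
rewrite sumr_const -[leLHS]mulr_natl ler_pM2r ?invr_gt0 ?ltr0n// ler_nat.
by rewrite (leq_trans (max_card _))// card_ord.
Qed.

Let Idx (Z : j.-tuple (nat * T)) : j.-tuple nat := map_coords fst Z.
Let Pts (Z : j.-tuple (nat * T)) : j.-tuple T := map_coords snd Z.

Let measurable_nth N' : measurable_fun setT (fun z : N'.-tuple T * nat => nth point z.1 z.2).
Proof.
apply: measurable_prod_nat => i /=; have [iN|iN] := ltnP i N'.
  rewrite (_ : (fun _ => _) = fun X : N'.-tuple T => tnth X (Ordinal iN)).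
    exact: measurable_tnth.
  by apply/funext => X; rewrite (tnth_nth point).
rewrite (_ : (fun _ => _) = fun X : N'.-tuple T => point) //.
by apply/funext => X; rewrite nth_default// size_tuple.
Qed.

Let measurable_pick : measurable_fun setT (fun z : N.-tuple T * j.-tuple nat => pick z.1 z.2).
Proof.
rewrite (_ : (fun _ => _) = fun z : N.-tuple T * j.-tuple nat => if good z.2 then [tuple nth point z.1 (tnth z.2 m) | m < j]
   else first_coords jN z.1)//.
apply: measurable_fun_ifT.
- apply: (measurableT_comp (f := good)) => //.
  by move=> _ A _; exact: tuple_nat_measurable.
- apply/measurable_fun_tnthP => m.
  rewrite (_ : _ \o _ = fun z : N.-tuple T * j.-tuple nat => nth point z.1 (tnth z.2 m)); last first.
    by apply/funext => z /=; rewrite tnth_mktuple.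
  apply: (measurableT_comp (f := fun z : N.-tuple T * nat => nth point z.1 z.2)
    (g := fun z : N.-tuple T * j.-tuple nat => (z.1, tnth z.2 m))); first exact: measurable_nth.
  apply: measurable_fun_pair => //.
  by apply: (measurableT_comp (measurable_tnth m)).
- by apply: (measurableT_comp (f := first_coords jN)).
Qed.

Let pick_law I A : measurable A -> Ex G (fun X => \1_A (pick X I)) = Ex (marginal jN G) \1_A.
Proof.
move=> mA; have bA := bm_indic R mA.
have [gI|/negbTE gI] := boolP (good I); rewrite /pick gI; last by rewrite Ex_distribution.
move: gI => /andP[uI /allP IN].
have h m : (tnth I m < N)%N by apply: IN; exact: mem_tnth.
pose s m := Ordinal (h m).
have sI : injective s.
  move=> a b [] /eqP; rewrite !(tnth_nth 0%N) nth_uniq ?size_tuple// => /eqP ab.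
  exact: val_inj.
rewrite -(Ex_ext _ (select_symmetric jN Gsym sI)) Ex_image_law//.
apply: eq_Ex => X; congr (\1_A _); apply: eq_from_tnth => m.
by rewrite !tnth_mktuple [tnth X _](tnth_nth point).
Qed.

Let pick_cost X Z : tuple_dist c (pick X (Idx Z)) (Pts Z) <=
  j%:R^-1 * \sum_(m < j) c (nth point X (tnth Z m).1) (tnth Z m).2 + (~~ good (Idx Z))%:R.
Proof.
rewrite /pick; case: ifPn => gZ /=.
  rewrite addr0 ler_wpM2l//; apply: ler_sum => m _.
  by rewrite !tnth_mktuple.
have /andP[_ h] := tuple_dist01 c01 (first_coords jN X) (Pts Z).
rewrite (le_trans h)// lerDr mulr_ge0// sumr_ge0// => m _.
by have /andP[] := c01 (nth point X (tnth Z m).1) (tnth Z m).2.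
Qed.

(** Draw [j] independent pairs (index, point of law [f]) from a near optimal plan
    between the empirical measure of [X] and [f]; the indices are distinct up to
    an event of probability at most [j ^ 2 / N]. *)
Lemma omega_le_w1_empirical : omega c G f jN <= Ex G (w1_empirical c f) + j%:R ^+ 2 / N%:R.
Proof.
apply/ler_addgt0Pr => e e0.
have [H [th [mH thP thc]]] := plan_selection cP N0 f e0.
pose q n := tensor_power (th n) j.
pose M := joint_law G q mH.
pose F (w : N.-tuple T * j.-tuple (nat * T)) := (pick w.1 (Idx w.2), Pts w.2).
have mI : measurable_fun setT Idx by exact: measurable_map_coords.
have mPt : measurable_fun setT Pts by exact: measurable_map_coords.
have mF1 : measurable_fun setT (fun w : N.-tuple T * j.-tuple (nat * T) => pick w.1 (Idx w.2)).
  apply: (measurableT_comp (f := fun z : N.-tuple T * j.-tuple nat => pick z.1 z.2)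
    (g := fun w : N.-tuple T * j.-tuple (nat * T) => (w.1, Idx w.2))) => //.
  by apply: measurable_fun_pair => //; apply: (measurableT_comp mI).
have mF2 : measurable_fun setT (fun w : N.-tuple T * j.-tuple (nat * T) => Pts w.2).
  by apply: (measurableT_comp mPt).
have mF : measurable_fun setT F by exact: measurable_fun_pair.
have thI n A : measurable A ->
    image_law mI (q n) A = tensor_power (uniform_index R N0) j A.
  by apply: (map_coords_tensor_power (mh := measurable_fst)) => B _; have [+ _] := thP n; apply.
have thT n A : measurable A -> image_law mPt (q n) A = tensor_power f j A.
  by apply: (map_coords_tensor_power (mh := measurable_snd)) => B mB; have [_ +] := thP n; apply.
have pc : couplings (marginal jN G) (tensor_power f j) (image_law mF M).
  move=> A mA; have bA := bm_indic R mA; split.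
    apply: (etrans (esym (Ex_indic (image_law mF1 M) mA))).
    apply: (etrans _ (Ex_indic (marginal jN G) mA)); congr EFin; rewrite Ex_image_law//.
    rewrite Ex_joint_law; last exact: (bm_comp mF1 bA).
    transitivity (Ex G (fun X => Ex (tensor_power (uniform_index R N0) j) (fun I => \1_A (pick X I)))).
      apply: eq_Ex => X; rewrite -(Ex_ext _ (thI (H X))) Ex_image_law//.
      apply: (bm_comp _ bA).
      by move=> _ B _; exact: tuple_nat_measurable.
    rewrite (@Ex_swap _ _ _ _ _ _ _ (fun z => \1_A (pick z.1 z.2))); last exact: (bm_comp measurable_pick bA).
    under eq_Ex do rewrite (pick_law _ mA).
    by rewrite Ex_cst.
  apply: (etrans (esym (Ex_indic (image_law mF2 M) mA))).
  apply: (etrans _ (Ex_indic (tensor_power f j) mA)); congr EFin; rewrite Ex_image_law//.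
  rewrite Ex_joint_law; last exact: (bm_comp mF2 bA).
  transitivity (Ex G (fun X => Ex (tensor_power f j) \1_A)).
    by apply: eq_Ex => X; rewrite -(Ex_ext _ (thT (H X))) Ex_image_law.
  by rewrite Ex_cst.
apply: (le_trans (omega_le cM c01 pc)).
have btd : bmfun (fun z : j.-tuple T * j.-tuple T => tuple_dist c z.1 z.2).
  exact: (bm_cost (@measurable_tuple_dist _ _ _ _ cM c01 j) (@tuple_dist01 _ _ _ _ c01 j)).
rewrite Ex_image_law// Ex_joint_law; last exact: (bm_comp mF btd).
have bJ := bm_Ex_joint_law q mH (bm_comp mF btd).
have bW := bm_w1_empirical cP N0 f.
have -> : Ex G (w1_empirical c f) + j%:R ^+ 2 / N%:R + e =
    Ex G (fun X => w1_empirical c f X + (j%:R ^+ 2 / N%:R + e)).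
  by rewrite ExD ?Ex_cst ?addrA//; exact: bm_cst.
apply: Ex_le => //; first by apply: bmD => //; exact: bm_cst.
move=> X.
have bc m : bmfun (fun Z : j.-tuple (nat * T) => c (nth point X (tnth Z m).1) (tnth Z m).2).
  exact: (bm_comp (measurable_tnth m) (bm_plan_cost cP X)).
have bgI : bmfun (fun Z : j.-tuple (nat * T) => (~~ good (Idx Z))%:R : R) by exact: (bm_comp mI bm_good).
have bs : bmfun (fun Z : j.-tuple (nat * T) => j%:R^-1 * \sum_(m < j) c (nth point X (tnth Z m).1) (tnth Z m).2).
  by apply: bmZ; exact: bm_sum.
apply: (@le_trans _ _ (Ex (q (H X)) (fun Z =>
   j%:R^-1 * \sum_(m < j) c (nth point X (tnth Z m).1) (tnth Z m).2 + (~~ good (Idx Z))%:R))).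
  apply: Ex_le; [|exact: bmD|by move=> Z; exact: pick_cost].
  apply: (bm_comp _ btd); apply: measurable_fun_pair => //.
  by apply: (measurableT_comp mF1); exact: pair1_measurable.
rewrite ExD// ExZ ?Ex_sum//; last exact: bm_sum.
rewrite (eq_bigr (fun _ => plan_cost c X (th (H X)))); last first.
  by move=> m _; rewrite (Ex_coord _ m (bm_plan_cost cP X)).
rewrite sumr_const card_ord -(mulr_natl (plan_cost _ _ _)) mulrA mulVf ?mul1r ?pnatr_eq0 -?lt0n//.
rewrite addrA addrAC lerD//.
rewrite -[leLHS](Ex_image_law mI (q (H X)) bm_good) (Ex_ext _ (thI (H X))).
exact: collision_prob.
Qed.

End sampling.

(** * Duality for the assignment problem *)

Section potentials.
Context (R : realType) (V : finType) (w : V -> V -> R).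
Hypothesis w0 : forall x, w x x = 0.
Hypothesis w_perm : forall s : {perm V}, 0 <= \sum_x w (s x) x.

(** [x :: l] lists a path backwards: its last vertex is [x]. *)
Definition path_weight x (l : seq V) : R :=
  \sum_(k < size l) w (nth x l k) (nth x (x :: l) k).

Lemma path_weight_cons x y l : path_weight x (y :: l) = w y x + path_weight y l.
Proof.
rewrite /path_weight /= big_ord_recl/=; congr (_ + _).
apply: eq_bigr => k _; congr w.
  by rewrite add0n; exact: set_nth_default.
by rewrite add0n; apply: set_nth_default; rewrite /= ltnS ltnW.
Qed.

Lemma path_weight_cat x l1 y l2 :
  path_weight x (l1 ++ y :: l2) = path_weight x (rcons l1 y) + path_weight y l2.
Proof.
elim: l1 x => [|z l1 IH] x /=; last by rewrite !path_weight_cons IH addrA.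
by rewrite !path_weight_cons [path_weight y [::]]/path_weight big_ord0 addr0.
Qed.

(** A simple cycle is a permutation that fixes the other vertices, where [w]
    vanishes. *)
Lemma cycle_weight_ge0 x l : uniq (x :: l) -> 0 <= path_weight x l + w x (last x l).
Proof.
move=> ul; pose C := x :: l.
have nI : injective (next C) := can_inj (prev_next ul).
have := w_perm (perm nI); rewrite (bigID (fun y => y \in C))/= [X in _ + X]big1 ?addr0; last first.
  by move=> y yC; rewrite permE next_nth (negbTE yC).
rewrite (eq_bigr (fun y => w (next C y) y)); last by move=> y _; rewrite permE.
rewrite -big_uniq//; suff -> : \sum_(y <- C) w (next C y) y = path_weight x l + w x (last x l) by [].
have nextE k : (k < size C)%N -> next C (nth x C k) = nth x l k.
  move=> kC; rewrite next_nth mem_nth//.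
  by rewrite -[LHS]/(nth x l (index (nth x C k) C)) index_uniq.
rewrite (big_nth x) big_mkord (_ : size C = (size l).+1)// big_ord_recr.
congr (_ + _).
  by apply: eq_bigr => k _; rewrite nextE// ltnS ltnW.
by rewrite nextE// nth_default// -[X in nth x C X]/((size C).-1) nth_last.
Qed.

(** Shortest path weights, from all the vertices at once. *)
Definition potential (j : V) : R := inf [set path_weight j l | l in [set l | uniq (j :: l)]].

Let lower : R := - ((\sum_x \sum_y `|w x y|) *+ #|V|).

Let has_lower j : has_lbound [set path_weight j l | l in [set l | uniq (j :: l)]].
Proof.
exists lower => _ [l /= ul <-]; rewrite lerNl.
rewrite (le_trans (ler_norm _))// normrN (le_trans (ler_norm_sum _ _ _))//.
have B x y : `|w x y| <= \sum_x \sum_y `|w x y|.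
  rewrite (bigD1 x)//= (bigD1 y)//= -addrA lerDl addr_ge0// sumr_ge0// => i _.
  exact: sumr_ge0.
apply: (@le_trans _ _ (\sum_(k < size l) \sum_x \sum_y `|w x y|)).
  by apply: ler_sum => k _; exact: B.
rewrite sumr_const card_ord; apply: ler_wpMn2l.
  by apply: sumr_ge0 => x _; exact: sumr_ge0.
by move: ul => /andP[_ /card_uniqP <-]; exact: max_card.
Qed.

(** A simple path to [i] extended by the edge to [j] is either simple or closes a
    cycle of nonnegative weight that can be cut off. *)
Lemma potentialP i j : potential j <= potential i + w i j.
Proof.
rewrite -lerBlDr; apply: lb_le_inf; first by exists (path_weight i [::]); exists [::].
move=> _ [l /= /andP[il ul] <-]; rewrite lerBlDr.
suff [l' ul' l'E] : exists2 l', uniq (j :: l') & path_weight j l' <= path_weight i l + w i j.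
  by apply: (le_trans _ l'E); apply: ge_inf => //; exists l'.
have [jl|jl] := boolP (j \in i :: l); last first.
  exists (i :: l); first by apply/and3P; split.
  by rewrite path_weight_cons addrC.
move: jl; rewrite in_cons => /predU1P[->|jl].
  by exists l; rewrite ?w0 ?addr0//= il ul.
move: jl il ul; case/splitPr => l1 l2 il ul.
exists l2; first by move: ul; rewrite cat_uniq => /and3P[].
rewrite path_weight_cat addrAC lerDr.
have := @cycle_weight_ge0 i (rcons l1 j); rewrite last_rcons; apply.
move: il ul; rewrite mem_cat negb_or in_cons negb_or => /and3P[il1 ij il2].
rewrite cat_uniq /= => /and4P[ul1 hl1 _ _].
rewrite mem_rcons in_cons negb_or ij il1 rcons_uniq ul1 andbT /=.
by move: hl1; rewrite negb_or andbT => /andP[].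
Qed.

End potentials.

(** Exchanging partners along a cycle cannot improve an optimal assignment [s]: the
    reduced costs [c i (s k) - c i (s i)] have no negative cycle, and their shortest
    path weights are the dual variables. *)
Lemma assignment_duality (R : realType) n (c : 'I_n -> 'I_n -> R) :
  exists (s : 'S_n) (u v : 'I_n -> R),
    (forall i j, u i + v j <= c i j) /\ (forall i, u i + v (s i) = c i (s i)).
Proof.
pose tot (s : 'S_n) := \sum_i c i (s i).
have [s sP] : exists s, forall t, tot s <= tot t.
  exists [arg min_(s < 1%g) tot s]%O => t.
  by case: Order.TotalTheory.arg_minP => // s _ h; exact: h.
pose w i k := c i (s k) - c i (s i).
have w0 x : w x x = 0 by rewrite /w subrr.
have wp (t : 'S_n) : 0 <= \sum_x w (t x) x.
  rewrite /w sumrB subr_ge0.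
  have -> : \sum_x c (t x) (s (t x)) = tot s.
    by rewrite [RHS](reindex_inj (@perm_inj _ t)).
  have -> : \sum_x c (t x) (s x) = tot (t^-1 * s)%g.
    rewrite /tot [RHS](reindex_inj (@perm_inj _ t)).
    by apply: eq_bigr => x _; rewrite permM permK.
  exact: sP.
pose p := potential w.
exists s, (fun i => c i (s i) - p i), (fun j => p (s^-1%g j)); split.
  move=> i j; have := potentialP w0 wp i (s^-1%g j).
  rewrite -/p /w permKV => h; lra.
by move=> i; rewrite permK subrK.
Qed.

(** * Comparison at full size *)

Section matching.
Context d (T : measurableType d) (R : realType) (c : T -> T -> R).
Hypothesis cP : bounded_metric c.
Variables (N : nat) (N0 : (0 < N)%N) (f : probability T R).

Let ctri := bounded_metric_triangle cP.
Local Notation W := (w1_empirical (N := N) c f).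

(** The potentials of an optimal matching extend to a 1-Lipschitz function, which
    can be tested against plans from each of the two samples to [f]. *)
Lemma matching_le (X Y : N.-tuple T) : exists s : 'S_N,
  tuple_dist c X (select s Y) <= W X + W Y.
Proof.
have [s [u [v [uv uvs]]]] := assignment_duality (fun i k => c (tnth X i) (tnth Y k)).
exists s; apply/ler_addgt0Pr => e e0; have e2 : 0 < e / 2 by rewrite divr_gt0.
have [th thP thc] := w1_empirical_plan cP N0 f X e2.
have [th' thP' thc'] := w1_empirical_plan cP N0 f Y e2.
pose i0 : 'I_N := Ordinal N0.
(* The c-transform of [v]: its sum over the particles of [X] is at least that of
   [u], and over those of [Y] at most that of [- v]. *)
pose F z k := c z (tnth Y k) - v k.
pose phi z := \big[Num.min/F z i0]_k F z k.
have phi_le z k : phi z <= F z k by exact: Order.TotalTheory.bigmin_le.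
have phi_ge z a : (forall k, a <= F z k) -> a <= phi z.
  by move=> h; apply: le_bigmin.
have bF k : bmfun (fun z => F z k).
  apply: bmB; last exact: bm_cst.
  by apply: (bm_cost_comp cP (F := fun z => z) (G := fun _ => tnth Y k)).
have bphi : bmfun phi.
  rewrite /phi; elim: (index_enum _) => [|k r IH].
    by under eq_fun do rewrite big_nil.
  by under eq_fun do rewrite big_cons; exact: bm_min.
have phi_lip y z : phi y <= phi z + c y z.
  rewrite -lerBlDr; apply: phi_ge => k; rewrite lerBlDr.
  rewrite (le_trans (phi_le y k))// /F.
  have := ctri z y (tnth Y k); lra.
have bn (Z : N.-tuple T) : bmfun (fun i => phi (nth point Z i)) by exact: bm_nth.
have nE (Z : N.-tuple T) : \sum_(i < N) phi (nth point Z i) = \sum_(i < N) phi (tnth Z i).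
  by apply: eq_bigr => i _; rewrite (tnth_nth point).
have HX : N%:R^-1 * \sum_i phi (tnth X i) <= Ex f phi + plan_cost c X th.
  rewrite -nE -(plan_fst thP (bn X)) -(plan_snd thP bphi) -ExD.
  - apply: Ex_le; [exact: (bm_comp measurable_fst (bn X))| |by move=> z; exact: phi_lip].
    apply: bmD; [exact: (bm_comp measurable_snd bphi)|exact: bm_plan_cost].
  - exact: (bm_comp measurable_snd bphi).
  - exact: bm_plan_cost.
have HY : Ex f phi <= N%:R^-1 * \sum_i phi (tnth Y i) + plan_cost c Y th'.
  rewrite -nE -(plan_fst thP' (bn Y)) -(plan_snd thP' bphi) -ExD.
  - apply: Ex_le; [exact: (bm_comp measurable_snd bphi)| |].
      apply: bmD; [exact: (bm_comp measurable_fst (bn Y))|exact: bm_plan_cost].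
    by move=> z; rewrite (bounded_metricC cP); exact: phi_lip.
  - exact: (bm_comp measurable_fst (bn Y)).
  - exact: bm_plan_cost.
have dE : tuple_dist c X (select s Y) = N%:R^-1 * (\sum_i u i + \sum_k v k).
  congr (_ * _); rewrite [X in _ = _ + X](reindex_inj (@perm_inj _ s)) -big_split/=.
  by apply: eq_bigr => i _; rewrite tnth_mktuple uvs.
have su : \sum_i u i <= \sum_i phi (tnth X i).
  by apply: ler_sum => i _; apply: phi_ge => k; rewrite lerBrDr.
have sv : \sum_k v k <= - \sum_i phi (tnth Y i).
  rewrite -sumrN; apply: ler_sum => k _; rewrite lerNr.
  by rewrite (le_trans (phi_le _ k))// /F (bounded_metricxx cP) sub0r.
have : N%:R^-1 * (\sum_i u i + \sum_k v k) <=
    N%:R^-1 * (\sum_i phi (tnth X i) - \sum_i phi (tnth Y i)).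
  by rewrite ler_wpM2l// lerD.
rewrite dE mulrBr; lra.
Qed.

End matching.

Section measurable_find.
Context d (Z : measurableType d).

Lemma measurable_find (A : Type) (b : A -> Z -> bool) (l : seq A) :
  (forall a, measurable_fun setT (b a)) ->
  measurable_fun setT (fun z => find (fun a => b a z) l).
Proof.
move=> mb; elim: l => [|a l IH] //=.
apply: measurable_fun_ifT => //.
by apply: (measurableT_comp (f := S)).
Qed.

End measurable_find.

Section comparison.
Context d (T : measurableType d) (R : realType) (c : T -> T -> R).
Hypothesis cP : bounded_metric c.
Variables (N : nat) (N0 : (0 < N)%N) (G : probability (N.-tuple T) R) (f : probability T R).
Hypothesis Gsym : symmetric_law G.

Let cM := bounded_metric_measurable cP.
Let c01 := bounded_metric01 cP.
Local Notation W := (w1_empirical (N := N) c f).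
Local Notation fN := (tensor_power f N).

Let btd : bmfun (fun z : N.-tuple T * N.-tuple T => tuple_dist c z.1 z.2).
Proof. exact: (bm_cost (@measurable_tuple_dist _ _ _ _ cM c01 N) (@tuple_dist01 _ _ _ _ c01 N)). Qed.

Let first_coordsE (X : N.-tuple T) : first_coords (leqnn N) X = X.
Proof. by apply: eq_from_tnth => i; rewrite tnth_mktuple; congr tnth; exact: val_inj. Qed.

(** Integrate the Lipschitz property of [W] against a coupling of [G] with the
    product law. *)
Lemma w1_empirical_le_omega : Ex G W <= omega c G f (leqnn N) + Ex fN W.
Proof.
apply/ler_addgt0Pr => e e0; have [p pc pe] := omega_approx cM c01 G f (leqnn N) e0.
have bW := bm_w1_empirical cP N0 f.
have b1 : bmfun (fun z : N.-tuple T * N.-tuple T => W z.1) by exact: (bm_comp measurable_fst bW).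
have b2 : bmfun (fun z : N.-tuple T * N.-tuple T => W z.2) by exact: (bm_comp measurable_snd bW).
have -> : Ex G W = Ex p (fun z => W z.1).
  rewrite -(Ex_image_law measurable_fst)//; transitivity (Ex (marginal (leqnn N) G) W).
    rewrite [RHS](Ex_distribution (first_coords (leqnn N)) G bW).
    by apply: eq_Ex => X; exact: (congr1 W (esym (first_coordsE X))).
  by apply: Ex_ext => A mA; have [p1 _] := pc A mA; exact/esym.
have -> : Ex fN W = Ex p (fun z => W z.2).
  rewrite -(Ex_image_law measurable_snd)//.
  by apply: Ex_ext => A mA; have [_ p2] := pc A mA; exact/esym.
rewrite addrAC; apply: (@le_trans _ _ (Ex p (fun z => tuple_dist c z.1 z.2) + Ex p (fun z => W z.2))).
  rewrite -ExD//; apply: Ex_le => //; first exact: bmD.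
  by move=> z; rewrite addrC; exact: w1_empirical_lip.
by rewrite lerD2r.
Qed.

Let perms := enum {perm 'I_N}.
Let tau (t : nat) : {perm 'I_N} := nth 1%g perms t.

Let perms0 : (0 < size perms)%N.
Proof. by rewrite /perms -cardT; apply/card_gt0P; exists 1%g. Qed.

Let Ex_perms (g : {perm 'I_N} -> R) :
  Ex (uniform_index R perms0) (fun t => g (tau t)) = (size perms)%:R^-1 * \sum_s g s.
Proof.
rewrite Ex_uniform_index; last first.
  split => //; exists (\sum_s `|g s|) => t.
  by rewrite (bigD1 (tau t))//= lerDl sumr_ge0.
congr (_ * _); rewrite -[in RHS]big_enum [in RHS](big_nth 1%g) big_mkord.
by [].
Qed.

Let mselect j N' (s : 'I_j -> 'I_N') := @measurable_select _ T j N' s.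

Let select_comp (s t : {perm 'I_N}) (Y : N.-tuple T) :
  select t (select s Y) = select (t * s)%g Y.
Proof. by apply: eq_from_tnth => i; rewrite !tnth_mktuple permM. Qed.

(** Match independent samples of [G] and of the product law optimally; permuting
    both by the same uniform permutation makes the second marginal exact, without
    a change of the cost. *)
Lemma omega_le_w1_empirical_iid : omega c G f (leqnn N) <= Ex G W + Ex fN W.
Proof.
have bW := bm_w1_empirical cP N0 f.
pose P := prod_probability G fN.
pose b (s : {perm 'I_N}) (z : N.-tuple T * N.-tuple T) :=
  tuple_dist c z.1 (select s z.2) <= W z.1 + W z.2.
(* The first permutation in the enumeration that does as well as [matching_le]
   claims; as a function of the pair it is measurable. *)
pose sg z := tau (find (fun s => b s z) perms).
have sgP z : tuple_dist c z.1 (select (sg z) z.2) <= W z.1 + W z.2.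
  apply: (@nth_find _ 1%g (fun s => b s z)); apply/hasP.
  have [s sP] := matching_le cP N0 f z.1 z.2.
  by exists s => //; rewrite mem_enum.
have b1 : bmfun (fun z : N.-tuple T * N.-tuple T => W z.1) by exact: (bm_comp measurable_fst bW).
have b2 : bmfun (fun z : N.-tuple T * N.-tuple T => W z.2) by exact: (bm_comp measurable_snd bW).
have m12 (s : {perm 'I_N}) : measurable_fun setT (fun z : N.-tuple T * N.-tuple T => (z.1, select s z.2)).
  by apply: measurable_fun_pair => //; apply: (measurableT_comp (mselect s)).
have mfind : measurable_fun setT (fun z => find (fun s => b s z) perms).
  apply: measurable_find => s.
  exact: (measurable_fun_ler (bm_comp (m12 s) btd).1 (bmD b1 b2).1).
have msel : measurable_fun setT (fun z => select (sg z) z.2).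
  apply: (measurableT_comp (f := fun w : N.-tuple T * nat => select (tau w.2) w.1)
    (g := fun z : N.-tuple T * N.-tuple T => (z.2, find (fun s => b s z) perms))).
    by apply: measurable_prod_nat => n; exact: (mselect (tau n)).
  exact: measurable_fun_pair.
pose F (w : nat * (N.-tuple T * N.-tuple T)) :=
  (select (tau w.1) w.2.1, select (tau w.1) (select (sg w.2) w.2.2)).
have mF1 t : measurable_fun setT (fun z : N.-tuple T * N.-tuple T => select (tau t) z.1).
  by apply: (measurableT_comp (mselect (tau t))).
have mF2 t : measurable_fun setT (fun z : N.-tuple T * N.-tuple T => select (tau t) (select (sg z) z.2)).
  exact: (measurableT_comp (mselect (tau t)) msel).
have mF : measurable_fun setT F.
  by apply: measurable_nat_prod => t; apply: measurable_fun_pair; [exact: mF1|exact: mF2].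
have mG1 : measurable_fun setT (fun w : nat * (N.-tuple T * N.-tuple T) => select (tau w.1) w.2.1).
  by apply: measurable_nat_prod => t; exact: mF1.
have mG2 : measurable_fun setT (fun w : nat * (N.-tuple T * N.-tuple T) => select (tau w.1) (select (sg w.2) w.2.2)).
  by apply: measurable_nat_prod => t; exact: mF2.
pose M := prod_probability (uniform_index R perms0) P.
have pc : couplings (marginal (leqnn N) G) fN (image_law mF M).
  move=> A mA; have bA := bm_indic R mA; split.
    apply: (etrans (esym (Ex_indic (image_law mG1 M) mA))).
    apply: (etrans _ (Ex_indic (marginal (leqnn N) G) mA)); congr EFin.
    rewrite Ex_image_law// Ex_prod; last exact: (bm_comp mG1 bA).
    transitivity (Ex (uniform_index R perms0) (fun _ => Ex (marginal (leqnn N) G) \1_A)); last by rewrite Ex_cst.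
    apply: eq_Ex => t /=.
    rewrite Ex_prod; last exact: (bm_comp (mF1 t) bA).
    under eq_Ex do rewrite /= Ex_cst.
    rewrite -(Ex_ext _ (select_symmetric (leqnn N) Gsym (@perm_inj _ (tau t)))).
    by rewrite Ex_image_law.
  apply: (etrans (esym (Ex_indic (image_law mG2 M) mA))).
  apply: (etrans _ (Ex_indic fN mA)); congr EFin.
  rewrite Ex_image_law// Ex_prod; last exact: (bm_comp mG2 bA).
  have bs (s : {perm 'I_N}) : bmfun (fun Y : N.-tuple T => \1_A (select s Y) : R) by exact: (bm_comp (mselect s) bA).
  have bs2 (s : {perm 'I_N}) : bmfun (fun z : N.-tuple T * N.-tuple T => \1_A (select s z.2) : R).
    exact: (bm_comp measurable_snd (bs s)).
  rewrite (@Ex_swap _ _ _ _ _ _ _ (fun w => \1_A (select (tau w.1) (select (sg w.2) w.2.2)))); last exact: (bm_comp mG2 bA).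
  transitivity (Ex P (fun z => (size perms)%:R^-1 * \sum_(s : {perm 'I_N}) \1_A (select s z.2))).
    apply: eq_Ex => z /=.
    rewrite (Ex_perms (fun t => \1_A (select t (select (sg z) z.2)))); congr (_ * _).
    rewrite [RHS](reindex_inj (mulIg (sg z))).
    by apply: eq_bigr => t _; rewrite select_comp.
  rewrite ExZ ?Ex_sum//; last by apply: bm_sum => s; exact: bs2.
  rewrite (eq_bigr (fun _ => Ex fN \1_A)); last first.
    move=> s _; rewrite Ex_prod//=.
    rewrite (_ : (fun _ => _) = fun _ => Ex fN \1_A) ?Ex_cst//; apply/funext => x.
    by rewrite -[RHS](Ex_ext _ (select_tensor_power f (@perm_inj _ s))) Ex_image_law.
  rewrite sumr_const -(mulr_natl (Ex fN \1_A)) mulrA cardT mulVf ?mul1r//.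
  by rewrite pnatr_eq0 -lt0n; exact: perms0.
apply: (le_trans (omega_le cM c01 pc)).
rewrite Ex_image_law// Ex_prod; last exact: (bm_comp mF btd).
have -> : Ex G W + Ex fN W = Ex P (fun z => W z.1 + W z.2).
  rewrite ExD// !Ex_prod//=; under [in RHS]eq_Ex do rewrite Ex_cst.
  by rewrite Ex_cst.
apply: Ex_le_cst => [|t]; first exact: (bm_Ex_prod P (bm_comp mF btd)).
apply: Ex_le; [|exact: bmD|].
  by apply: (bm_comp _ btd); apply: measurable_fun_pair; [exact: mF1|exact: mF2].
move=> z; apply: le_trans (sgP z); rewrite le_eqVlt; apply/orP; left; apply/eqP.
congr (_ * _) => /=; rewrite [RHS](reindex_inj (@perm_inj _ (tau t))).
by apply: eq_bigr => i _; rewrite !tnth_mktuple.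
Qed.

End comparison.

(** * Hierarchical matching *)

Section greedy.
Context (R : realType) (I K : finType) (q : I -> K).
Variables (a b : I -> R).
Hypotheses (a0 : forall i, 0 <= a i) (b0 : forall i, 0 <= b i).

Let A k := \sum_(i | q i == k) a i.
Let B k := \sum_(i | q i == k) b i.
Let m k := Num.max (A k) (B k).

Let A0 k : 0 <= A k. Proof. exact: sumr_ge0. Qed.
Let B0 k : 0 <= B k. Proof. exact: sumr_ge0. Qed.

(** Inside a cell with total masses [A] and [B] this is the product coupling
    rescaled so as to move the mass [min A B], the most that is possible. *)
Definition greedy i i' := if q i == q i' then a i * b i' / m (q i) else 0.

Lemma greedy_ge0 i i' : 0 <= greedy i i'.
Proof.
by rewrite /greedy; case: ifP => // _; rewrite divr_ge0 ?mulr_ge0// le_max A0.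
Qed.

Lemma greedy_supp i i' : q i != q i' -> greedy i i' = 0.
Proof. by rewrite /greedy => /negbTE ->. Qed.

Lemma greedy_row i : \sum_i' greedy i i' = a i * (B (q i) / m (q i)).
Proof.
rewrite /greedy -big_mkcond/= [RHS]mulrA mulr_sumr mulr_suml.
by apply: eq_bigl => i'; rewrite eq_sym.
Qed.

Lemma greedy_col i' : \sum_i greedy i i' = b i' * (A (q i') / m (q i')).
Proof.
rewrite /greedy -big_mkcond/= [RHS]mulrA mulr_sumr mulr_suml.
by apply: eq_bigr => i /eqP ->; rewrite [b i' * _]mulrC.
Qed.

Let ratio_le1 (x y : R) : 0 <= x -> 0 <= y -> x / Num.max y x <= 1.
Proof.
move=> x0 y0; have [->|n0] := eqVneq (Num.max y x) 0; first by rewrite invr0 mulr0.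
rewrite ler_pdivrMr ?mul1r ?le_max ?lexx ?orbT//.
by rewrite lt_neqAle eq_sym n0 le_max y0.
Qed.

Lemma greedy_row_le i : \sum_i' greedy i i' <= a i.
Proof. by rewrite greedy_row ler_piMr// ratio_le1. Qed.

Lemma greedy_col_le i' : \sum_i greedy i i' <= b i'.
Proof. by rewrite greedy_col ler_piMr// /m maxC ratio_le1. Qed.

Let excess (x y : R) : 0 <= x -> 0 <= y -> x - x * (y / Num.max x y) = Num.max 0 (x - y).
Proof.
move=> x0 y0; have [xy|yx] := leP x y.
  rewrite max_l ?subr_le0//; have [y00|yn0] := eqVneq y 0.
    by rewrite y00 in xy *; rewrite (@le_anti _ _ x 0) ?xy ?x0// mul0r subr0.
  by rewrite divff// mulr1 subrr.
rewrite max_r ?subr_ge0 ?ltW//.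
by rewrite mulrCA divff ?mulr1// gt_eqF// (le_lt_trans y0).
Qed.

Lemma greedy_row_excess k :
  \sum_(i | q i == k) (a i - \sum_i' greedy i i') = Num.max 0 (A k - B k).
Proof.
rewrite sumrB -(excess (A0 k) (B0 k)); congr (_ - _).
by rewrite mulr_suml; apply: eq_bigr => i /eqP <-; exact: greedy_row.
Qed.

End greedy.

Section tree.
Context (R : realType) (I : finType) (J : nat -> finType) (q : forall l, I -> J l).
Variables (D : nat -> R) (kappa : I -> I -> R).

Definition imbalance l (a b : I -> R) : R :=
  \sum_(j : J l) Num.max 0 (\sum_(i | q l i == j) a i - \sum_(i | q l i == j) b i).

Hypothesis q0 : forall i i', q 0 i = q 0 i'.

(** Match as much mass as possible inside the cells of the finest level; what is
    left has mass [imbalance L] and is handled at the coarser levels, whose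
    imbalances have not changed. *)
Lemma tree_matching L (a b : I -> R) :
  (forall l i i', (l < L)%N -> q l.+1 i = q l.+1 i' -> q l i = q l i') ->
  (forall l i i', (l <= L)%N -> q l i = q l i' -> kappa i i' <= D l) ->
  (forall i, 0 <= a i) -> (forall i, 0 <= b i) -> \sum_i a i = \sum_i b i ->
  exists g : I -> I -> R, [/\ forall i i', 0 <= g i i', forall i, \sum_i' g i i' = a i,
    forall i', \sum_i g i i' = b i' &
    \sum_i \sum_i' g i i' * kappa i i' <=
      D L * \sum_i a i + \sum_(l < L) (D l - D l.+1) * imbalance l.+1 a b].
Proof.
elim: L a b => [|L IH] a b qS kD a0 b0 ab.
  pose g := greedy (q 0) a b.
  have cls i : (fun i' => q 0 i' == q 0 i) =1 xpredT by move=> i'; apply/eqP; exact: q0.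
  have row i : \sum_i' g i i' = a i.
    apply/eqP; rewrite eq_le greedy_row_le//= -subr_le0.
    have e : \sum_i' (a i' - \sum_k g i' k) = 0.
      have := greedy_row_excess (q 0) a0 b0 (q 0 i).
      by rewrite !(eq_bigl _ _ (cls i)) ab subrr maxxx.
    rewrite -[leRHS]e [leRHS](bigD1 i)//= lerDl sumr_ge0// => i' _.
    by rewrite subr_ge0 greedy_row_le.
  have col i : \sum_i' g i' i = b i.
    apply/eqP; rewrite eq_le greedy_col_le//= -subr_le0.
    have e : \sum_i' (b i' - \sum_k g k i') = 0.
      by rewrite sumrB exchange_big/= (eq_bigr _ (fun i _ => row i)) ab subrr.
    rewrite -[leRHS]e [leRHS](bigD1 i)//= lerDl sumr_ge0// => i' _.
    by rewrite subr_ge0 greedy_col_le.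
  exists g; split => //; first by move=> i i'; exact: greedy_ge0.
  rewrite big_ord0 addr0 mulr_sumr; apply: ler_sum => i _.
  rewrite -row mulr_sumr; apply: ler_sum => i' _; rewrite mulrC.
  by apply: ler_wpM2r; [exact: greedy_ge0|exact: kD].
pose g := greedy (q L.+1) a b.
have g0 i i' : 0 <= g i i' by exact: greedy_ge0.
pose a' i := a i - \sum_i' g i i'.
pose b' i' := b i' - \sum_i g i i'.
have a'0 i : 0 <= a' i by rewrite subr_ge0 greedy_row_le.
have b'0 i : 0 <= b' i by rewrite subr_ge0 greedy_col_le.
have ab' : \sum_i a' i = \sum_i b' i by rewrite !sumrB ab exchange_big.
have qle n l : (l + n = L.+1)%N -> forall i i', q L.+1 i = q L.+1 i' -> q l i = q l i'.
  elim: n l => [|n IHn] l e i i' qq; first by move: e; rewrite addn0 => ->.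
  by apply: qS; [rewrite -e addnS ltnS leq_addr|apply: IHn; rewrite // addSn -addnS].
have U' l : (l <= L.+1)%N -> imbalance l a' b' = imbalance l a b.
  move=> lL; apply: eq_bigr => j _; congr (Num.max 0 _).
  rewrite !sumrB.
  suff -> : \sum_(i | q l i == j) \sum_i' g i i' = \sum_(i | q l i == j) \sum_k g k i by ring.
  rewrite big_mkcond [RHS]big_mkcond/=.
  transitivity (\sum_i \sum_k (if q l i == j then g i k else 0)).
    by apply: eq_bigr => i _; case: ifP => // _; rewrite big1.
  transitivity (\sum_i \sum_k (if q l i == j then g k i else 0)); last first.
    by apply: eq_bigr => i _; case: ifP => // _; rewrite big1.
  rewrite [RHS]exchange_big; apply: eq_bigr => i _; apply: eq_bigr => k _.
  have [qq|qq] := eqVneq (q L.+1 i) (q L.+1 k).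
    by rewrite (qle _ _ (subnKC lL) _ _ qq).
  by rewrite /g greedy_supp// !if_same.
have sa' : \sum_i a' i = imbalance L.+1 a b.
  rewrite (partition_big (q L.+1) xpredT)//=; apply: eq_bigr => j _.
  exact: greedy_row_excess.
have [g' [g'0 row' col' cost']] := IH a' b'
  (fun l i i' lL => qS l i i' (ltnW lL)) (fun l i i' lL => kD l i i' (leqW lL)) a'0 b'0 ab'.
exists (fun i i' => g i i' + g' i i'); split.
- by move=> i i'; rewrite addr_ge0.
- by move=> i; rewrite big_split/= row' addrC subrK.
- by move=> i; rewrite big_split/= col' addrC subrK.
rewrite (eq_bigr (fun i => \sum_i' g i i' * kappa i i' + \sum_i' g' i i' * kappa i i')); last first.
  by move=> i _; rewrite -big_split/=; apply: eq_bigr => i' _; rewrite mulrDl.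
rewrite big_split/=.
have cg : \sum_i \sum_i' g i i' * kappa i i' <= D L.+1 * (\sum_i a i - \sum_i a' i).
  have -> : \sum_i a i - \sum_i a' i = \sum_i \sum_i' g i i'.
    by rewrite sumrB opprB addrC subrK.
  rewrite mulr_sumr; apply: ler_sum => i _; rewrite mulr_sumr; apply: ler_sum => i' _.
  rewrite [leRHS]mulrC; have [qq|qq] := eqVneq (q L.+1 i) (q L.+1 i').
    by rewrite ler_wpM2l// kD.
  by rewrite /g greedy_supp// !mul0r.
apply: (le_trans (lerD cg cost')).
rewrite big_ord_recr/= sa'.
have -> : \sum_(l < L) (D l - D l.+1) * imbalance l.+1 a' b' =
    \sum_(l < L) (D l - D l.+1) * imbalance l.+1 a b.
  by apply: eq_bigr => l _; rewrite U'// ltnS ltnW.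
lra.
Qed.

End tree.

(** Complements turn the inequality around. *)
Lemma le_laws_eq d (T : measurableType d) (R : realType) (P Q : probability T R) :
  (forall B, measurable B -> Ex P \1_B <= Ex Q \1_B) ->
  forall B, measurable B -> P B = Q B.
Proof.
move=> PQ B mB; rewrite -!Ex_indic//; congr EFin; apply/eqP.
rewrite eq_le PQ//=; have := PQ (~` B) (measurableC mB).
have E S : Ex S \1_(~` B) = 1 - Ex S (\1_B : T -> R).
  rewrite -[X in X - _](Ex_cst S) -ExB//; [|exact: bm_cst|exact: bm_indic].
  by apply: eq_Ex => x; rewrite !indicE in_setC; case: (_ \in _); rewrite ?subrr ?subr0.
by rewrite !E lerD2l lerN2.
Qed.

Section finite_labels.
Context d (T : measurableType d) (R : realType) (I : finType) (Q : T -> I).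
Hypothesis mQ : forall i, measurable [set x | Q x == i].
Implicit Types (f : probability T R).

Definition mass f i : R := Ex f (fun y => (Q y == i)%:R).

Lemma mass_ge0 f i : 0 <= mass f i.
Proof. exact: Ex_ge0. Qed.

Lemma bm_label_eq i : bmfun (fun y => (Q y == i)%:R : R).
Proof. exact: bm_bool. Qed.

Lemma labelE (g : I -> R) y : g (Q y) = \sum_i g i * (Q y == i)%:R.
Proof.
rewrite (bigD1 (Q y))//= eqxx mulr1 big1 ?addr0// => i iQ.
by rewrite eq_sym (negbTE iQ) mulr0.
Qed.

Lemma bm_label (g : I -> R) : bmfun (fun y => g (Q y)).
Proof.
under eq_fun do rewrite labelE.
by apply: bm_sum => i; apply: bmZ; exact: bm_label_eq.
Qed.

Lemma Ex_label f (g : I -> R) : Ex f (fun y => g (Q y)) = \sum_i g i * mass f i.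
Proof.
under eq_Ex do rewrite labelE.
rewrite Ex_sum; last by move=> i; apply: bmZ; exact: bm_label_eq.
by apply: eq_bigr => i _; rewrite ExZ//; exact: bm_label_eq.
Qed.

Lemma sum_mass f : \sum_i mass f i = 1.
Proof.
have := Ex_label f (fun _ => 1); rewrite Ex_cst => ->.
by apply: eq_bigr => i _; rewrite mul1r.
Qed.

Variables (N : nat) (N0 : (0 < N)%N).

Definition freq (X : N.-tuple T) i : R := N%:R^-1 * \sum_(m < N) (Q (tnth X m) == i)%:R.

Lemma freq_ge0 X i : 0 <= freq X i.
Proof. by apply: mulr_ge0 => //; apply: sumr_ge0. Qed.

Lemma freq_gt0 X m : 0 < freq X (Q (tnth X m)).
Proof.
apply: mulr_gt0; first by rewrite invr_gt0 ltr0n.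
by rewrite (bigD1 m)//= eqxx; apply: ltr_pwDl; [exact: ltr01|exact: sumr_ge0].
Qed.

Lemma sum_freq X (g : I -> R) :
  \sum_i g i * freq X i = N%:R^-1 * \sum_(m < N) g (Q (tnth X m)).
Proof.
under [in RHS]eq_bigr do rewrite labelE.
rewrite [in RHS]exchange_big mulr_sumr; apply: eq_bigr => i _.
by rewrite -mulr_sumr mulrCA.
Qed.

Lemma sum_freq1 X : \sum_i freq X i = 1.
Proof.
have := sum_freq X (fun _ => 1); under eq_bigr do rewrite mul1r; move=> ->.
by rewrite sumr_const card_ord mulVf// pnatr_eq0 -lt0n.
Qed.

(** A matrix with the right margins is realised by spreading each entry uniformly
    over the product of the corresponding cells. *)
Lemma matrix_plan (f : probability T R) (X : N.-tuple T) (g : I -> I -> R) :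
  (forall i i', 0 <= g i i') -> (forall i, \sum_i' g i i' = freq X i) ->
  (forall i', \sum_i g i i' = mass f i') ->
  exists2 th, index_plan N0 f th & forall k : I -> I -> R,
    Ex th (fun z => k (Q (nth point X z.1)) (Q z.2)) = \sum_i \sum_i' g i i' * k i i'.
Proof.
move=> g0 row col.
pose r i i' := g i i' / (freq X i * mass f i').
have r0 i i' : 0 <= r i i' by rewrite divr_ge0// mulr_ge0 ?freq_ge0 ?mass_ge0.
have gr i i' : g i i' = r i i' * freq X i * mass f i'.
  have [z|nz] := eqVneq (freq X i * mass f i') 0; last by rewrite /r -mulrA divfK.
  rewrite -mulrA z mulr0; apply/eqP; rewrite eq_le g0 andbT.
  move/eqP: z; rewrite mulf_eq0 => /orP[/eqP z|/eqP z].
    by rewrite -[leRHS]z -row (bigD1 i')//= lerDl sumr_ge0.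
  by rewrite -[leRHS]z -col (bigD1 i)//= lerDl sumr_ge0.
pose q m := Q (nth point X m).
pose h (w : nat * T) := r (q w.1) (Q w.2).
have bl (k : I -> I -> R) : bmfun (fun w : nat * T => k (q w.1) (Q w.2)).
  split; first by apply: measurable_nat_prod => m; exact: (bm_label (k (q m))).1.
  exists (\sum_i \sum_i' `|k i i'|) => w.
  rewrite (bigD1 (q w.1))//= (bigD1 (Q w.2))//= -addrA lerDl addr_ge0// sumr_ge0// => i _.
  exact: sumr_ge0.
have bnat (k : nat -> R) : (forall m, (N <= m)%N -> k m = k N) -> bmfun k.
  move=> kN; split => //; exists (\sum_(m < N.+1) `|k m|) => m.
  have [mN|mN] := ltnP m N.
    by rewrite (bigD1 (Ordinal (leqW mN)))//= lerDl sumr_ge0.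
  by rewrite kN// (bigD1 ord_max)//= lerDl sumr_ge0.
have qN m : (N <= m)%N -> q m = q N.
  by move=> mN; rewrite /q !nth_default// size_tuple.
pose P := prod_probability (uniform_index R N0) f.
have qE (m : 'I_N) : q m = Q (tnth X m) by rewrite /q (tnth_nth point).
have EP (k : I -> I -> R) : Ex P (fun w => r (q w.1) (Q w.2) * k (q w.1) (Q w.2)) =
    \sum_i \sum_i' g i i' * k i i'.
  rewrite Ex_prod; last exact: (bl (fun i i' => r i i' * k i i')).
  under eq_Ex => m do rewrite (Ex_label f (fun i' => r (q m) i' * k (q m) i')).
  rewrite Ex_uniform_index; last by apply: bnat => m /qN ->.
  under eq_bigr do rewrite qE.
  rewrite -(sum_freq X (fun i => \sum_i' r i i' * k i i' * mass f i')).
  apply: eq_bigr => i _; rewrite mulr_suml; apply: eq_bigr => i' _.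
  by rewrite gr; ring.
have h1 : Ex P h = 1.
  have := EP (fun _ _ => 1); under eq_Ex do rewrite mulr1; move=> ->.
  under eq_bigr do (under eq_bigr do rewrite mulr1).
  by under eq_bigr do rewrite row; rewrite sum_freq1.
pose th := density_law (bl r) (fun w => r0 _ _) h1.
exists th; last first.
  by move=> k; rewrite Ex_density_law ?EP//; exact: bl.
split.
  move=> A; apply: le_laws_eq => [B mB|//]; have bB := bm_indic R mB.
  rewrite Ex_image_law// Ex_density_law; last exact: (bm_comp measurable_fst bB).
  have bB1 : bmfun (fun w : nat * T => \1_B w.1 : R) by exact: (bm_comp measurable_fst bB).
  rewrite Ex_prod; last exact: (bmM (bl r) bB1).
  rewrite (_ : (fun m : nat => _) = fun m => \1_B m * \sum_i' r (q m) i' * mass f i'); last first.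
    apply/funext => m /=; rewrite -(Ex_label f (r (q m))) -ExZ; last exact: bm_label.
    by apply: eq_Ex => y; rewrite mulrC.
  rewrite !Ex_uniform_index//; last first.
    by apply: bmM => //; apply: bnat => m /qN ->.
  rewrite ler_wpM2l//; apply: ler_sum => m _; rewrite ler_piMr//.
  have f0 := freq_gt0 X m.
  rewrite -(ler_pM2r f0) mul1r mulr_suml qE -[leRHS]row ler_sum// => i' _.
  by rewrite [leRHS]gr mulrAC.
apply: le_laws_eq => B mB; have bB := bm_indic R mB.
rewrite Ex_image_law// Ex_density_law; last exact: (bm_comp measurable_snd bB).
have bB2 : bmfun (fun w : nat * T => \1_B w.2 : R) by exact: (bm_comp measurable_snd bB).
rewrite Ex_prod; last exact: (bmM (bl r) bB2).
rewrite (Ex_swap _ f (g := fun w => r (q w.1) (Q w.2) * \1_B w.2)); last exact: (bmM (bl r) bB2).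
apply: Ex_le => //; first exact: (bm_Ex_prod2 (uniform_index R N0) (bmM (bl r) bB2)).
move=> y /=.
have -> : Ex (uniform_index R N0) (fun m => r (q m) (Q y) * \1_B y) = \1_B y * \sum_i r i (Q y) * freq X i.
  rewrite Ex_uniform_index; last by apply: bnat => m /qN ->.
  rewrite (sum_freq X (fun i => r i (Q y))) -mulr_suml.
  by under eq_bigr do rewrite qE; ring.
rewrite ler_piMr//.
have [z|nz] := eqVneq (mass f (Q y)) 0.
  by rewrite big1 ?ler01// => i _; rewrite /r z mulr0 invr0 mulr0 mul0r.
have mp : 0 < mass f (Q y) by rewrite lt_neqAle eq_sym nz mass_ge0.
rewrite -(ler_pM2r mp) mul1r mulr_suml -[leRHS]col ler_sum// => i _.
by rewrite [leRHS]gr.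
Qed.

End finite_labels.

Section tree_bound.
Context d (T : measurableType d) (R : realType) (c : T -> T -> R).
Hypothesis cP : bounded_metric c.
Variables (N : nat) (N0 : (0 < N)%N) (f : probability T R).
Variables (J : nat -> finType) (Q : forall l, T -> J l) (L : nat) (O : T -> bool) (D : nat -> R).
Hypothesis mQ : forall l j, measurable [set x | Q l x == j].
Hypothesis mO : measurable [set x | O x].
Hypothesis Q0 : forall x y, Q 0 x = Q 0 y.
Hypothesis QS : forall l x y, (l < L)%N -> Q l.+1 x = Q l.+1 y -> Q l x = Q l y.
Hypothesis QD : forall l x y, (l <= L)%N -> Q l x = Q l y -> ~~ O y -> c x y <= D l.
Hypothesis D0 : forall l, 0 <= D l.

Let c01 := bounded_metric01 cP.

(** The outside points of [f] cost at most 1. The others are dealt with by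
    [tree_matching], applied to the frequencies and the masses of the finest labels,
    where the cost of two labels is the least [D l] over the levels at which they
    agree. *)
Lemma tree_bound (X : N.-tuple T) : w1_empirical c f X <=
  Ex f (fun y => (O y)%:R) + D L +
  \sum_(l < L) (D l - D l.+1) *
    \sum_(j : J l.+1) Num.max 0 (freq R (Q l.+1) X j - mass (Q l.+1) f j).
Proof.
(* The coarser labels are functions of the finest one, read off at any point that
   carries it; labels that no point carries have frequency and mass zero. *)
pose rep (i : J L) := if pselect (exists x, Q L x = i) is left h then projT1 (cid h) else point.
have repQ x : Q L (rep (Q L x)) = Q L x.
  by rewrite /rep; case: pselect => [h|[]]; [case: cid|exists x].
have Qle n l : (l + n = L)%N -> forall x y, Q L x = Q L y -> Q l x = Q l y.
  elim: n l => [|n IHn] l e x y qq; first by move: e; rewrite addn0 => ->.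
  by apply: QS; [rewrite -e addnS ltnS leq_addr|apply: IHn; rewrite // addSn -addnS].
pose q l (i : J L) := Q l (rep i).
have qQ l x : (l <= L)%N -> q l (Q L x) = Q l x.
  by move=> lL; apply: (Qle (L - l)%N); rewrite ?subnKC.
(* All the labels agree at level 0, so [D 0] is a bound in any case. *)
pose kappa (i i' : J L) := \big[Num.min/D 0]_(l < L.+1 | q l i == q l i') D l.
have kD l i i' : (l <= L)%N -> q l i = q l i' -> kappa i i' <= D l.
  move=> lL /eqP qq; rewrite /kappa -ltnS in lL *.
  exact: (Order.TotalTheory.bigmin_le_cond (D 0) (fun l : 'I_L.+1 => D l) (j := Ordinal lL)).
have kge i i' a : a <= D 0 -> (forall l, (l <= L)%N -> q l i = q l i' -> a <= D l) -> a <= kappa i i'.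
  by move=> a0 h; apply: le_bigmin => // l /eqP; apply: h; rewrite -ltnS.
have fr0 i : 0 <= freq R (Q L) X i by exact: freq_ge0.
have ma0 i : 0 <= mass (Q L) f i by exact: mass_ge0.
have frma : \sum_i freq R (Q L) X i = \sum_i mass (Q L) f i.
  by rewrite sum_freq1// sum_mass.
have [g [g0 row col cost]] := tree_matching (fun i i' => Q0 _ _)
  (fun l i i' lL => @QS l (rep i) (rep i') lL) kD fr0 ma0 frma.
have [th thP thk] := matrix_plan (@mQ L) N0 g0 row col.
apply: (le_trans (w1_empirical_le cP X thP)).
have bO : bmfun (fun y => (O y)%:R : R) by exact: bm_bool.
have bO2 : bmfun (fun z : nat * T => (O z.2)%:R : R) by exact: (bm_comp measurable_snd bO).
have bk : bmfun (fun z : nat * T => kappa (Q L (nth point X z.1)) (Q L z.2)).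
  split; first by apply: measurable_nat_prod => m; exact: (bm_label (@mQ L) (kappa (Q L (nth point X m)))).1.
  exists (\sum_i \sum_i' `|kappa i i'|) => w.
  rewrite (bigD1 (Q L (nth point X w.1)))//= (bigD1 (Q L w.2))//= -addrA lerDl addr_ge0// sumr_ge0// => i _.
  exact: sumr_ge0.
apply: (@le_trans _ _ (Ex th (fun z => (O z.2)%:R + kappa (Q L (nth point X z.1)) (Q L z.2)))).
  apply: Ex_le; [exact: bm_plan_cost|exact: bmD|move=> [m y] /=].
  have /andP[c0 c1] := c01 (nth point X m) y.
  have [Oy|nOy] := boolP (O y).
    by rewrite (le_trans c1)// lerDl kge.
  rewrite add0r; apply: kge => [|l lL]; first by apply: QD => //.
  by rewrite !qQ// => /QD; apply.
rewrite ExD// (plan_snd thP bO) thk -addrA lerD2l.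
apply: (le_trans cost); rewrite sum_freq1// mulr1 lerD2l.
apply: ler_sum => l _; rewrite le_eqVlt; apply/orP; left; apply/eqP; congr (_ * _).
have lL : (l.+1 <= L)%N by [].
apply: eq_bigr => j _; congr (Num.max 0 (_ - _)).
  transitivity (\sum_i (q l.+1 i == j)%:R * freq R (Q L) X i).
    by rewrite big_mkcond; apply: eq_bigr => i _; case: eqP; rewrite ?mul1r ?mul0r.
  by rewrite sum_freq; under eq_bigr do rewrite qQ//.
transitivity (\sum_i (q l.+1 i == j)%:R * mass (Q L) f i).
  by rewrite big_mkcond; apply: eq_bigr => i _; case: eqP; rewrite ?mul1r ?mul0r.
rewrite -(Ex_label (@mQ L) f (fun i => (q l.+1 i == j)%:R)).
by apply: eq_Ex => y; rewrite qQ.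
Qed.

End tree_bound.

(** * Second moments of the discrepancy *)

Section label_pairs.
Context d (T : measurableType d) (R : realType) (I : finType) (Q : T -> I).
Hypothesis mQ : forall i, measurable [set x | Q x == i].

Lemma measurable_same_label : measurable [set z : T * T | Q z.1 == Q z.2].
Proof.
rewrite (_ : mkset _ = \big[setU/set0]_i ([set x | Q x == i] `*` [set x | Q x == i])).
  by apply: bigsetU_measurable => i _; exact: measurableX.
rewrite -bigcup_seq; apply/seteqP; split => -[x y] /=.
  by move=> /eqP e; exists (Q x); rewrite /= ?mem_index_enum// e; split.
by move=> [i _ [/= /eqP -> /eqP ->]].
Qed.

Lemma bm_same_label : bmfun (fun z : T * T => (Q z.1 == Q z.2)%:R : R).
Proof. by apply: bm_bool; exact: measurable_same_label. Qed.

Lemma bm_separated n (i : 'I_n) :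
  bmfun (fun z : n.-tuple T * n.-tuple T => (Q (tnth z.1 i) != Q (tnth z.2 i))%:R : R).
Proof.
have bs : bmfun (fun z : T * T => (Q z.1 != Q z.2)%:R : R).
  apply: bm_bool; rewrite (_ : mkset _ = ~` [set z : T * T | Q z.1 == Q z.2]).
    by apply: measurableC; exact: measurable_same_label.
  by apply/seteqP; split => z /= /negP.
apply: (bm_comp (f := fun z : n.-tuple T * n.-tuple T => (tnth z.1 i, tnth z.2 i)) _ bs).
by apply: measurable_fun_pair; apply: (measurableT_comp (measurable_tnth i)).
Qed.

End label_pairs.

Section variance.
Context d (T : measurableType d) (R : realType) (I : finType) (Q : T -> I).
Hypothesis mQ : forall i, measurable [set x | Q x == i].
Variables (N : nat) (N2 : (2 <= N)%N) (G : probability (N.-tuple T) R) (f : probability T R).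
Hypothesis Gsym : symmetric_law G.

Let N0 : (0 < N)%N := ltnW N2.

Definition discrepancy (X : N.-tuple T) : R := \sum_i (freq R Q X i - mass Q f i) ^+ 2.

Lemma bm_freq i : bmfun (fun X : N.-tuple T => freq R Q X i).
Proof.
apply: bmZ; apply: bm_sum => m.
exact: (bm_comp (measurable_tnth m) (bm_label_eq R mQ i)).
Qed.

Lemma bm_discrepancy : bmfun discrepancy.
Proof.
apply: bm_sum => i; under eq_fun do rewrite expr2.
by apply: bmM; apply: bmB; [exact: bm_freq|exact: bm_cst|exact: bm_freq|exact: bm_cst].
Qed.

Let discrepancyE X : discrepancy X =
  N%:R^-1 * \sum_(m < N) (N%:R^-1 * \sum_(n < N) (Q (tnth X n) == Q (tnth X m))%:R)
  - 2 * (N%:R^-1 * \sum_(m < N) mass Q f (Q (tnth X m))) + \sum_i mass Q f i ^+ 2.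
Proof.
rewrite -[X in X - _](sum_freq Q X (freq R Q X)) -(sum_freq Q X (mass Q f)) mulr_sumr.
rewrite -sumrB -big_split/=; apply: eq_bigr => i _; ring.
Qed.

Variable p : probability (2.-tuple T * 2.-tuple T)%type R.
Hypothesis pc : couplings (marginal N2 G) (tensor_power f 2) p.

Let o1 : 'I_2 := lift ord0 ord0.
Let k2 (Z : 2.-tuple T) : R := (Q (tnth Z ord0) == Q (tnth Z o1))%:R.
Let sep (x y : T) : R := (Q x != Q y)%:R.

Let bm_k2 : bmfun k2.
Proof.
apply: (bm_comp (f := fun Z : 2.-tuple T => (tnth Z ord0, tnth Z o1)) _ (bm_same_label R mQ)).
by apply: measurable_fun_pair; exact: measurable_tnth.
Qed.

Let bm_sep (i : 'I_2) : bmfun (fun z : 2.-tuple T * 2.-tuple T => sep (tnth z.1 i) (tnth z.2 i)).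
Proof. exact: bm_separated. Qed.

Let Ex_pair (m n : 'I_N) (g : 2.-tuple T -> R) : m != n -> bmfun g ->
  Ex G (fun X => g (select (fun a : 'I_2 => if a == ord0 then m else n) X)) = Ex p (fun z => g z.1).
Proof.
move=> mn bg; have sI : injective (fun a : 'I_2 => if a == ord0 then m else n).
  move=> a b; case: (unliftP ord0 a) => [a'|] ->; case: (unliftP ord0 b) => [b'|] -> //=.
  - by rewrite !ord1.
  - by move=> e; rewrite e eqxx in mn.
  - by move=> e; rewrite e eqxx in mn.
rewrite -(Ex_image_law (measurable_select _))// (Ex_ext _ (select_symmetric N2 Gsym sI)).
rewrite -(Ex_image_law measurable_fst)//; apply: Ex_ext => A mA.
by have [h _] := pc mA; exact/esym.
Qed.

Let Ex_same (m n : 'I_N) : m != n ->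
  Ex G (fun X => (Q (tnth X n) == Q (tnth X m))%:R) = Ex p (fun z => k2 z.1).
Proof.
move=> mn; rewrite -(Ex_pair mn bm_k2); apply: eq_Ex => X.
by rewrite /k2 !tnth_mktuple/= eq_sym.
Qed.

Let Ex_one (m : 'I_N) (g : T -> R) : bmfun g ->
  Ex G (fun X => g (tnth X m)) = Ex p (fun z => g (tnth z.1 ord0)).
Proof.
move=> bg; have [n mn] : exists n, m != n.
  have [->|m0] := eqVneq m (Ordinal N0); last by exists (Ordinal N0).
  by exists (Ordinal N2).
have b0 : bmfun (fun Z : 2.-tuple T => g (tnth Z ord0)) by exact: (bm_comp (measurable_tnth ord0) bg).
by rewrite -(Ex_pair mn b0); apply: eq_Ex => X; rewrite tnth_mktuple.
Qed.

Let Ex_snd (g : 2.-tuple T -> R) : bmfun g -> Ex p (fun z => g z.2) = Ex (tensor_power f 2) g.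
Proof.
move=> bg; rewrite -(Ex_image_law measurable_snd)//; apply: Ex_ext => A mA.
by have [_ h] := pc mA.
Qed.

Let S := \sum_i mass Q f i ^+ 2.

Let bm_massQ : bmfun (fun x => mass Q f (Q x)).
Proof. exact: bm_label. Qed.

Let S_mass : Ex p (fun z => mass Q f (Q (tnth z.2 ord0))) = S.
Proof.
rewrite (Ex_snd (bm_comp (measurable_tnth ord0) bm_massQ)).
rewrite (Ex_coord f ord0 bm_massQ) (Ex_label mQ f (mass Q f)).
by apply: eq_bigr => i _; rewrite expr2.
Qed.

Let S_k2 : Ex p (fun z => k2 z.2) = S.
Proof.
rewrite (Ex_snd bm_k2) (@Ex_coord2 _ _ _ f _ ord0 o1 (fun z => (Q z.1 == Q z.2)%:R))//; last exact: bm_same_label.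
transitivity (Ex f (fun x => mass Q f (Q x))).
  by apply: eq_Ex => x; apply: eq_Ex => y /=; rewrite eq_sym.
rewrite (Ex_label mQ f (mass Q f)).
by apply: eq_bigr => i _; rewrite expr2.
Qed.

(** The expanded square only involves the two-particle marginal: up to [1 / N] from
    the diagonal, it is the probability that a pair of particles has equal labels,
    minus twice the mean of [mass (Q x)], plus the sum of the squared masses. Under
    the product law these three quantities cancel. Passing to it along the coupling
    costs the mean number of separated points once for the first quantity and twice
    for the second, hence the factor 3. *)
Lemma Ex_discrepancy_le : Ex G discrepancy <= N%:R^-1 +
  3 * Ex p (fun z => sep (tnth z.1 ord0) (tnth z.2 ord0) + sep (tnth z.1 o1) (tnth z.2 o1)).
Proof.
have N1 : (0 : R) < N%:R^-1 by rewrite invr_gt0 ltr0n.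
have bX m n : bmfun (fun X : N.-tuple T => (Q (tnth X n) == Q (tnth X m))%:R : R).
  apply: (bm_comp (f := fun X : N.-tuple T => (tnth X n, tnth X m)) _ (bm_same_label R mQ)).
  by apply: measurable_fun_pair; exact: measurable_tnth.
have bM m : bmfun (fun X : N.-tuple T => mass Q f (Q (tnth X m))).
  exact: (bm_comp (measurable_tnth m) bm_massQ).
have b1 : bmfun (fun X => N%:R^-1 * \sum_(m < N) (N%:R^-1 * \sum_(n < N) (Q (tnth X n) == Q (tnth X m))%:R : R)).
  by apply: bmZ; apply: bm_sum => m; apply: bmZ; apply: bm_sum => n.
have b2 : bmfun (fun X : N.-tuple T => N%:R^-1 * \sum_(m < N) mass Q f (Q (tnth X m))).
  by apply: bmZ; exact: bm_sum.
rewrite (eq_Ex _ discrepancyE) [leLHS]ExD; [|by apply: bmB => //; exact: bmZ|exact: bm_cst].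
rewrite Ex_cst ExB//; last exact: bmZ.
rewrite !ExZ//; [|exact: bm_sum|by apply: bm_sum => m; apply: bmZ; exact: bm_sum].
rewrite !Ex_sum//; last by move=> m; apply: bmZ; exact: bm_sum.
pose E2 := Ex p (fun z => k2 z.1).
pose E1 := Ex p (fun z => mass Q f (Q (tnth z.1 ord0))).
have E20 : 0 <= E2 by exact: Ex_ge0.
rewrite [X in _ - 2 * (_ * X)](eq_bigr (fun _ => E1)); last by move=> m _; exact: (Ex_one m bm_massQ).
rewrite sumr_const card_ord -(mulr_natl E1) (mulrA N%:R^-1 N%:R E1) (_ : N%:R^-1 * N%:R = 1) ?mul1r; last first.
  by rewrite mulVf// pnatr_eq0 -lt0n.
have row m : Ex G (fun X => N%:R^-1 * \sum_(n < N) (Q (tnth X n) == Q (tnth X m))%:R) <= N%:R^-1 + E2.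
  rewrite ExZ ?Ex_sum//; last exact: bm_sum.
  rewrite (bigD1 m)//= (_ : Ex G _ = 1); last by under eq_Ex do rewrite eqxx; rewrite Ex_cst.
  rewrite (eq_bigr (fun _ => E2)); last by move=> n nm; apply: Ex_same; rewrite eq_sym.
  rewrite mulrDr mulr1 lerD2l sumr_const -(mulr_natl E2) mulrA ler_piMl//.
  rewrite mulrC ler_pdivrMr ?ltr0n// mul1r ler_nat.
  by rewrite (leq_trans (max_card _))// card_ord.
have tot : N%:R^-1 * \sum_(m < N) Ex G (fun X => N%:R^-1 * \sum_(n < N) (Q (tnth X n) == Q (tnth X m))%:R) <= N%:R^-1 + E2.
  rewrite mulrC ler_pdivrMr ?ltr0n//.
  have -> : (N%:R^-1 + E2) * N%:R = \sum_(m < N) (N%:R^-1 + E2) by rewrite sumr_const card_ord mulr_natr.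
  by apply: ler_sum => m _; exact: row.
have D2 : E2 <= S + Ex p (fun z => sep (tnth z.1 ord0) (tnth z.2 ord0) + sep (tnth z.1 o1) (tnth z.2 o1)).
  rewrite -S_k2 -ExD; [|exact: (bm_comp measurable_snd bm_k2)|exact: bmD].
  apply: Ex_le; first exact: (bm_comp measurable_fst bm_k2).
    by apply: bmD; [exact: (bm_comp measurable_snd bm_k2)|exact: bmD].
  move=> z; rewrite /k2 /sep.
  case: (eqVneq (Q (tnth z.1 ord0)) (Q (tnth z.2 ord0))) => [->|_] /=.
    case: (eqVneq (Q (tnth z.1 o1)) (Q (tnth z.2 o1))) => [->|_] /=; first by rewrite !addr0.
    by rewrite add0r (@le_trans _ _ 1)// ?lerDr// lern1 leq_b1.
  by rewrite addrCA (@le_trans _ _ 1)// ?lern1 ?leq_b1// lerDl addr_ge0.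
have D1 : S <= E1 + Ex p (fun z => sep (tnth z.1 ord0) (tnth z.2 ord0)).
  have b0 : bmfun (fun z : 2.-tuple T * 2.-tuple T => mass Q f (Q (tnth z.1 ord0))).
    exact: (bm_comp (measurableT_comp (measurable_tnth ord0) measurable_fst) bm_massQ).
  have b0' : bmfun (fun z : 2.-tuple T * 2.-tuple T => mass Q f (Q (tnth z.2 ord0))).
    exact: (bm_comp (measurableT_comp (measurable_tnth ord0) measurable_snd) bm_massQ).
  rewrite -S_mass -ExD//; apply: Ex_le => //; first exact: bmD.
  move=> z; rewrite /sep; case: eqP => [->|_] /=; first by rewrite addr0.
  have m1 i : mass Q f i <= 1 by rewrite -(sum_mass mQ f) (bigD1 i)//= lerDl sumr_ge0// => j _; exact: mass_ge0.
  by rewrite (le_trans (m1 _))// lerDr mass_ge0.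
have D3 : Ex p (fun z => sep (tnth z.1 ord0) (tnth z.2 ord0)) <=
    Ex p (fun z => sep (tnth z.1 ord0) (tnth z.2 ord0) + sep (tnth z.1 o1) (tnth z.2 o1)).
  by apply: Ex_le => //; [exact: bmD|move=> z; rewrite lerDl].
rewrite -/S; lra.
Qed.

End variance.

(** * Dyadic grids and the multiscale bound *)

Section floors.
Context (R : realType).

Lemma floor_double (y y' : R) : Num.floor (2 * y) = Num.floor (2 * y') ->
  Num.floor y = Num.floor y'.
Proof.
move=> e.
have h (z : R) : Num.floor z * 2 <= Num.floor (2 * z) < (Num.floor z + 1) * 2.
  rewrite floor_ge_int floor_lt_int !intrM !intrD.
  have /andP[] := floor_itv z; rewrite intrD => a b.
  apply/andP; split; lra.
have := h y; have := h y'; rewrite -e; lia.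
Qed.

Lemma floor_pow2 l (y y' : R) :
  Num.floor (2 ^+ l.+1 * y) = Num.floor (2 ^+ l.+1 * y') ->
  Num.floor (2 ^+ l * y) = Num.floor (2 ^+ l * y').
Proof. by rewrite exprS -!mulrA => /floor_double. Qed.

Lemma floor_pow2_coarsest l (y y' : R) :
  Num.floor (2 ^+ l * y) = Num.floor (2 ^+ l * y') -> Num.floor y = Num.floor y'.
Proof.
by elim: l => [|l IH]; [rewrite expr0 !mul1r|move=> /floor_pow2].
Qed.

Lemma floor_eq_dist (y y' : R) : Num.floor y = Num.floor y' -> `|y - y'| <= 1.
Proof.
move=> e; have /andP[a b] := floor_itv y; have /andP[a' b'] := floor_itv y'.
rewrite e in a b; rewrite intrD in b; rewrite intrD in b'.
rewrite ler_norml; apply/andP; split; lra.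
Qed.

Lemma shift_sum_telescope (F : nat -> R) j M :
  \sum_(m < M) (F (m + j)%N - F m) = \sum_(i < j) (F (M + i)%N - F i).
Proof.
have E a b : \sum_(m < a) F (m + b)%N = \sum_(i < a + b) F i - \sum_(i < b) F i.
  rewrite addnC big_split_ord/= [X in _ = X - _]addrC addrK.
  by apply: eq_bigr => m _; rewrite addnC.
rewrite !sumrB E [X in _ = X - _](_ : _ = \sum_(i < j) F (i + M)%N).
  by rewrite E addnC; ring.
by apply: eq_bigr => i _; rewrite addnC.
Qed.

(** Let [j] be the least number of steps [1 / M] that exceeds the distance. Each shift
    that separates the points makes the rounded value grow by at least one within
    the next [j] shifts. It grows by [K] over the full period, so these increments
    sum up to [j * K]. *)
Lemma shifted_grid_separation (K M : nat) (x y : R) : (0 < M)%N ->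
  \sum_(m < M) (Num.floor (K%:R * (x + m%:R / M%:R)) != Num.floor (K%:R * (y + m%:R / M%:R)))%:R
    <= K%:R * (M%:R * `|x - y| + 1).
Proof.
move=> M0; wlog xy : x y / x <= y.
  move=> H; have [xy|yx] := leP x y; first exact: H.
  by rewrite distrC (le_trans _ (H y x (ltW yx)))//; under eq_bigr do rewrite eq_sym.
have Mp : (0 : R) < M%:R by rewrite ltr0n.
pose F n : R := (Num.floor (K%:R * (x + n%:R / M%:R)))%:~R.
pose j := (Num.truncn (M%:R * (y - x))).+1.
have j1 : M%:R * (y - x) < j%:R by exact: truncnS_gt.
have j2 : j%:R <= M%:R * (y - x) + 1.
  by rewrite /j -natr1 lerD2r truncn_le mulr_ge0// subr_ge0.
apply: (@le_trans _ _ (\sum_(m < M) (F (m + j)%N - F m))).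
  apply: ler_sum => m _; rewrite /F.
  set a := Num.floor _; set b := Num.floor _; set e := Num.floor _.
  have ab : a <= b.
    by apply: le_floor; rewrite ler_wpM2l// lerD2r.
  have be : b <= e.
    apply: le_floor; rewrite ler_wpM2l//.
    have -> : (m + j)%:R / M%:R = m%:R / M%:R + j%:R / M%:R :> R by rewrite natrD mulrDl.
    have : y - x <= j%:R / M%:R by rewrite ler_pdivlMr// mulrC ltW.
    lra.
  rewrite -intrB; have [_|ab'] := eqVneq a b; rewrite /=.
    by rewrite ler0z; lia.
  by rewrite (_ : 1%:R = 1%:~R)// ler_int; move: ab ab' be; lia.
rewrite shift_sum_telescope.
rewrite (eq_bigr (fun _ => K%:R)); last first.
  move=> i _; rewrite /F natrD mulrDl divff ?gt_eqF// addrCA mulrDr mulr1.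
  by rewrite floorDzr ?natr_int// intrD floorK ?natr_int// addrK.
rewrite sumr_const card_ord -[leLHS]mulr_natr ler_wpM2l//.
by rewrite ler0_norm ?subr_le0// opprB.
Qed.

End floors.

Section enorm.
Context (R : realType) (d : nat).
Implicit Types u v : 'rV[R]_d.

Let sq_ge0 v : 0 <= \sum_(i < d) v ord0 i ^+ 2.
Proof. by apply: sumr_ge0 => i _; exact: sqr_ge0. Qed.

Lemma enorm_ge0 v : 0 <= enorm v.
Proof. exact: sqrtr_ge0. Qed.

Lemma enorm_sqr v : enorm v ^+ 2 = \sum_(i < d) v ord0 i ^+ 2.
Proof. by rewrite sqr_sqrtr. Qed.

Lemma enorm_le v (a : R) : 0 <= a -> \sum_(i < d) v ord0 i ^+ 2 <= a ^+ 2 -> enorm v <= a.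
Proof. by move=> a0 h; rewrite -ler_sqr ?nnegrE ?enorm_ge0// enorm_sqr. Qed.

Lemma coord_le_enorm v i : `|v ord0 i| <= enorm v.
Proof.
rewrite -ler_sqr ?nnegrE ?enorm_ge0// enorm_sqr real_normK ?num_real//.
by rewrite (bigD1 i)//= lerDl sumr_ge0// => k _; exact: sqr_ge0.
Qed.

Lemma enorm_le_bound v (a : R) : (forall i, `|v ord0 i| <= a) -> enorm v <= d%:R * a.
Proof.
move=> h; have [d0|dp] := posnP d.
  rewrite [X in _ <= X%:R * _]d0 mul0r; apply: enorm_le => //.
  by rewrite big1 ?sqr_ge0// => i _; have := ltn_ord i; rewrite [X in (_ < X)%N]d0.
have a0 : 0 <= a by apply: le_trans (h (Ordinal dp)).
apply: enorm_le; first by rewrite mulr_ge0.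
apply: (@le_trans _ _ (\sum_(i < d) a ^+ 2)).
  apply: ler_sum => i _; rewrite -[v ord0 i ^+ 2]real_normK ?num_real//.
  by rewrite ler_sqr ?nnegrE.
rewrite sumr_const card_ord -[leLHS]mulr_natl exprMn ler_wpM2r ?sqr_ge0//.
by rewrite expr2 ler_peMl// ler1n.
Qed.

Lemma enorm0 : enorm (0 : 'rV[R]_d) = 0.
Proof. by rewrite /enorm big1 ?sqrtr0// => i _; rewrite mxE expr0n. Qed.

Lemma enormN v : enorm (- v) = enorm v.
Proof. by rewrite /enorm; congr Num.sqrt; apply: eq_bigr => i _; rewrite mxE sqrrN. Qed.

Lemma cauchy_schwarz_row u v : \sum_(i < d) u ord0 i * v ord0 i <= enorm u * enorm v.
Proof.
have [u0|un0] := eqVneq (enorm u) 0.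
  rewrite u0 mul0r big1// => i _; have := coord_le_enorm u i.
  by rewrite u0 normr_le0 => /eqP ->; rewrite mul0r.
have [v0|vn0] := eqVneq (enorm v) 0.
  rewrite v0 mulr0 big1// => i _; have := coord_le_enorm v i.
  by rewrite v0 normr_le0 => /eqP ->; rewrite mulr0.
have up : 0 < enorm u by rewrite lt_neqAle eq_sym un0 enorm_ge0.
have vp : 0 < enorm v by rewrite lt_neqAle eq_sym vn0 enorm_ge0.
have : 0 <= \sum_(i < d) (enorm v * u ord0 i - enorm u * v ord0 i) ^+ 2.
  by apply: sumr_ge0 => i _; exact: sqr_ge0.
rewrite (eq_bigr (fun i => enorm v ^+ 2 * u ord0 i ^+ 2 + enorm u ^+ 2 * v ord0 i ^+ 2
   - (2 * enorm u * enorm v) * (u ord0 i * v ord0 i))); last by move=> i _; ring.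
rewrite sumrB big_split/= -!mulr_sumr -!enorm_sqr => h.
have uv : 0 < enorm u * enorm v by exact: mulr_gt0.
rewrite -(ler_pM2l uv); set S := \sum_(i < d) _ in h *; lra.
Qed.

Lemma enormD u v : enorm (u + v) <= enorm u + enorm v.
Proof.
apply: enorm_le; first by rewrite addr_ge0 ?enorm_ge0.
rewrite (eq_bigr (fun i => u ord0 i ^+ 2 + v ord0 i ^+ 2 + 2 * (u ord0 i * v ord0 i))); last first.
  by move=> i _; rewrite mxE; ring.
rewrite !big_split/= -mulr_sumr -!enorm_sqr.
have := cauchy_schwarz_row u v; set S := \sum_(i < d) _; lra.
Qed.

Lemma bracket_ge1 v : 1 <= bracket v.
Proof.
rewrite -ler_sqr ?nnegrE ?sqrtr_ge0// expr1n sqr_sqrtr ?lerDl ?sqr_ge0//.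
by rewrite addr_ge0// sqr_ge0.
Qed.

Lemma enorm_le_bracket v : enorm v <= bracket v.
Proof.
rewrite -ler_sqr ?nnegrE ?sqrtr_ge0 ?enorm_ge0// [leRHS]sqr_sqrtr ?lerDr//.
by rewrite addr_ge0// sqr_ge0.
Qed.

End enorm.

Lemma measurable_level_sets d (T : measurableType d) (V : countType) (h : T -> V) :
  (forall v, measurable [set x | h x = v]) -> forall S : set V, measurable (h @^-1` S).
Proof.
move=> mh S.
rewrite (_ : h @^-1` S = \bigcup_n (if unpickle n is Some v then (if pselect (S v) then [set x | h x = v] else set0) else set0)).
  apply: bigcup_measurable => n _; case: unpickle => // v; case: pselect => [Sv|nSv]; [exact: mh|exact: measurable0].
apply/seteqP; split => x /=.
  move=> Sx; exists (pickle (h x)) => //; rewrite pickleK.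
  by case: pselect => // nS; case: nS.
by move=> [n _]; case: unpickle => // v; case: pselect => // Sv /= ->.
Qed.

Section borel.
Context (R : realType) (d : nat) (E : set 'rV[R]_d) (E0 : E !=set0).
Local Notation T := (borel E0).

Definition coordinate (i : 'I_d) (x : T) : R := emb x ord0 i.

Lemma measurable_coordinate i : measurable_fun setT (coordinate i).
Proof.
apply: (measurability _ (RGenOpens.measurableE R)).
move=> _ [_ [a [b ->] <-]]; rewrite setTI.
apply: sub_sigma_algebra.
have : continuous (coordinate i : subspace_of E0 -> R).
  move=> x; apply: (@continuous_comp _ _ _ (@set_val _ E : subspace_of E0 -> 'rV[R]_d) (fun M : 'rV[R]_d => M ord0 i)).
    exact: (@initial_continuous _ _ (@set_val _ E)).
  exact: coord_continuous.
by move=> /continuousP; apply; exact: interval_open.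
Qed.

Lemma measurable_dE : measurable_fun setT (fun z : T * T => dE z.1 z.2).
Proof.
apply: measurable_minr => //.
apply: (measurableT_comp (f := @Num.sqrt R)).
  by apply: continuous_measurable_fun; exact: sqrt_continuous.
rewrite (_ : (fun _ => _) = fun z : T * T => \sum_(i < d) (coordinate i z.1 - coordinate i z.2) ^+ 2).
  apply: measurable_sum => i; apply: measurable_funX.
  by apply: measurable_funB; apply: (measurableT_comp (measurable_coordinate i)).
by apply/funext => z; apply: eq_bigr => i _; rewrite !mxE.
Qed.

Lemma dE01 (x y : T) : 0 <= dE x y <= 1.
Proof. by rewrite /dE le_min enorm_ge0 ler01 ge_min lexx orbT. Qed.

Lemma floor_measurable (a b : R) i (S : set int) :
  measurable [set x : T | S (Num.floor (a * (coordinate i x + b)))].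
Proof.
apply: (measurable_level_sets (h := fun x : T => Num.floor (a * (coordinate i x + b)))) => n.
pose g (x : T) := a * (coordinate i x + b).
have mg : measurable_fun setT g.
  by apply: measurable_funM => //; apply: measurable_funD => //; exact: measurable_coordinate.
rewrite (_ : [set x | _] = g @^-1` `[n%:~R, (n + 1)%:~R[%classic).
  by rewrite -[X in measurable X]setTI; apply: mg.
apply/seteqP; split => x /=; rewrite in_itv/=.
  by move=> <-; exact: floor_itv.
by move=> h; exact: floor_def.
Qed.

(** The cell of side [2 ^- l] that contains [x], in the grid translated by [- t]
    along the diagonal. *)
Definition cell l (t : R) (x : T) : {ffun 'I_d -> int} :=
  [ffun i => Num.floor (2 ^+ l * (coordinate i x + t))].

Lemma cell_measurable2 l t l' t' (S : set ({ffun 'I_d -> int} * {ffun 'I_d -> int})) :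
  measurable [set x : T | S (cell l t x, cell l' t' x)].
Proof.
apply: (measurable_level_sets (h := fun x : T => (cell l t x, cell l' t' x))) => -[v v'].
rewrite (_ : mkset _ = (\big[setI/setT]_(i < d) [set x | Num.floor (2 ^+ l * (coordinate i x + t)) = v i])
  `&` (\big[setI/setT]_(i < d) [set x | Num.floor (2 ^+ l' * (coordinate i x + t')) = v' i])).
  by apply: measurableI; apply: bigsetI_measurable => i _; exact: (floor_measurable _ _ _ [set _]).
rewrite -!bigcap_seq; apply/seteqP; split => x /=.
  by move=> [<- <-]; split => i _; rewrite ffunE.
move=> [h h']; congr (_, _); apply/ffunP => i; rewrite ffunE.
  by apply: h; rewrite /= mem_index_enum.
by apply: h'; rewrite /= mem_index_enum.
Qed.

Lemma cell_dE l t (x y : T) : cell l t x = cell l t y -> dE x y <= d%:R * 2 ^- l.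
Proof.
move=> e; rewrite /dE ge_min; apply/orP; left; apply: enorm_le_bound => i.
have p2 : (0 : R) < 2 ^+ l by exact: exprn_gt0.
have := congr1 (fun g : {ffun 'I_d -> int} => g i) e; rewrite !ffunE => /floor_eq_dist.
rewrite -mulrBr normrM (gtr0_norm p2) opprD addrACA subrr addr0 -/(coordinate i y) => h.
by rewrite !mxE -(ler_pM2l p2) mulfV ?gt_eqF.
Qed.

Lemma dE_bounded_metric : bounded_metric (@dE R d E E0).
Proof.
split.
- exact: measurable_dE.
- exact: dE01.
- by move=> x; rewrite /dE subrr enorm0 min_l.
- by move=> x y; rewrite /dE -enormN opprB.
- move=> y x z; have := enormD (emb x - emb y) (emb y - emb z).
  rewrite addrA subrK /dE => h.
  have := enorm_ge0 (emb x - emb y); have := enorm_ge0 (emb y - emb z).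
  by rewrite /Num.min; do 3 case: ltP => ?; lra.
- move=> e e0.
  have [l hl] : exists l, d%:R * 2 ^- l <= e.
    exists (Num.truncn (d%:R / e)).+1.
    set n := (Num.truncn _).+1.
    have h1 : d%:R / e < n%:R by exact: truncnS_gt.
    have h2 : n%:R <= 2 ^+ n :> R by rewrite -natrX ler_nat ltnW// ltn_expl.
    rewrite ler_pdivrMr ?exprn_gt0// -ler_pdivrMl// mulrC.
    by rewrite (le_trans (ltW h1)).
  exists (fun x => pickle (cell l 0 x)).
    move=> _ S _; rewrite setTI.
    exact: (@cell_measurable2 l 0 l 0 [set v | S (pickle v.1)]).
  by move=> x y /(pcan_inj (@pickleK _))/cell_dE h; rewrite (le_trans h).
Qed.

End borel.

Section grid.
Context (R : realType) (d : nat) (d_gt0 : (0 < d)%N) (E : set 'rV[R]_d) (E0 : E !=set0).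
Local Notation T := (borel E0).
Variables (b : nat).

(* One more than [b], so that a point whose coordinates are smaller than [b] in
   absolute value stays in the cube after any shift in [0, 1]. *)
Let B := b.+1.

Definition outside (t : R) (x : T) : bool :=
  ~~ [forall i, (- (B%:Z) <= cell 0 t x i) && (cell 0 t x i < B%:Z)].

Definition label_type l : finType := option {ffun 'I_d -> 'I_(2 * B * 2 ^ l).+1}.

(** Level 0 puts all the points together, as the root of the tree. At the other
    levels the outside points share one label and the cells of the cube get one
    each, with indices translated to nonnegative integers. *)
Definition label t l (x : T) : label_type l :=
  if (l == 0)%N || outside t x then None
  else Some [ffun i => inord (absz (cell l t x i + (B * 2 ^ l)%:Z)%R)].

Lemma measurable_outside t : measurable [set x | outside t x].
Proof.
refine (@cell_measurable2 R d E E0 0 t 0 t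
  [set v : {ffun 'I_d -> int} * {ffun 'I_d -> int} | ~~ [forall i, (- (B%:Z) <= v.1 i) && (v.1 i < B%:Z)]]).
Qed.

Lemma measurable_label t l j : measurable [set x | label t l x == j].
Proof.
refine (@cell_measurable2 R d E E0 0 t l t
  [set v : {ffun 'I_d -> int} * {ffun 'I_d -> int} | (if (l == 0)%N || ~~ [forall i, (- (B%:Z) <= v.1 i) && (v.1 i < B%:Z)] then None
  else Some [ffun i => inord (absz (v.2 i + (B * 2 ^ l)%:Z)%R)]) == j]).
Qed.

Lemma cell_coarsest l t (x y : T) : cell l t x = cell l t y -> cell 0 t x = cell 0 t y.
Proof.
move=> e; apply/ffunP => i; rewrite !ffunE expr0 !mul1r.
have := congr1 (fun g : {ffun 'I_d -> int} => g i) e; rewrite !ffunE.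
exact: floor_pow2_coarsest.
Qed.

Lemma cell_label l t (x y : T) : cell l t x = cell l t y -> label t l x = label t l y.
Proof. by move=> e; rewrite /label /outside (cell_coarsest e) e. Qed.

Lemma cell_range l t (x : T) i : ~~ outside t x ->
  0 <= cell l t x i + (B * 2 ^ l)%:Z < (2 * B * 2 ^ l)%:Z.
Proof.
rewrite negbK => /forallP /(_ i); rewrite !ffunE expr0 mul1r.
rewrite floor_ge_int floor_lt_int => /andP[h1 h2].
have p2 : (0 : R) < 2 ^+ l by exact: exprn_gt0.
set y := coordinate i x + t in h1 h2 *.
have e : (B * 2 ^ l)%:Z%:~R = 2 ^+ l * B%:R :> R by rewrite -pmulrn natrM natrX mulrC.
have g1 : - (B * 2 ^ l)%:Z <= Num.floor (2 ^+ l * y).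
  by rewrite floor_ge_int rmorphN/= e -mulrN ler_pM2l//; move: h1; rewrite rmorphN.
have g2 : Num.floor (2 ^+ l * y) < (B * 2 ^ l)%:Z.
  by rewrite floor_lt_int e ltr_pM2l.
apply/andP; split; first by rewrite -lerBlDr sub0r.
by rewrite -mulnA mul2n -addnn PoszD ltrD2r.
Qed.

Lemma label_cell l t (x y : T) : ~~ outside t y -> label t l.+1 x = label t l.+1 y ->
  ~~ outside t x /\ cell l.+1 t x = cell l.+1 t y.
Proof.
rewrite /label /= => nOy; rewrite (negbTE nOy).
have [//|nOx] := boolP (outside t x); move=> [] /ffunP e; split => //.
apply/ffunP => i; have := e i; rewrite !ffunE -[LHS]/(inord _) => /(congr1 val)/=.
have := cell_range l.+1 i nOx; have := cell_range l.+1 i nOy; rewrite !ffunE.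
set a := Num.floor _; set a' := Num.floor _; set K := (2 * B * _)%N; set K' := (B * _)%N.
by move=> /andP[h1 h2] /andP[h3 h4]; rewrite !inordK; lia.
Qed.

Lemma label0 t (x y : T) : label t 0 x = label t 0 y.
Proof. by []. Qed.

Lemma label_refine t l (x y : T) : label t l.+1 x = label t l.+1 y -> label t l x = label t l y.
Proof.
case: l => [//|l] e.
have [Oy|nOy] := boolP (outside t y).
  have Ox : outside t x by move: e; rewrite /label /= Oy; case: (outside t x).
  by rewrite /label Ox Oy !orbT.
have [_ c] := label_cell nOy e; apply: cell_label; apply/ffunP => i; rewrite !ffunE.
have := congr1 (fun g : {ffun 'I_d -> int} => g i) c; rewrite !ffunE.
exact: floor_pow2.
Qed.

Definition side l : R := d%:R * 2 ^- l.

Lemma side_ge0 l : 0 <= side l.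
Proof. by rewrite mulr_ge0// invr_ge0 exprn_ge0. Qed.

Lemma sideB l : side l - side l.+1 = side l.+1.
Proof.
rewrite /side exprS invfM; have := divff (_ : (2 : R) != 0) => h.
by field.
Qed.

(** Only one of the points has to be inside, since the other one then is too; at
    level 0 the bound is just [dE <= 1]. *)
Lemma label_dE t l (x y : T) : label t l x = label t l y -> ~~ outside t y -> dE x y <= side l.
Proof.
case: l => [_ _|l e nO].
  rewrite /side expr0 invr1 mulr1; have /andP[_ h] := dE01 x y.
  by rewrite (le_trans h)// ler1n.
by have [_ /cell_dE] := label_cell nO e.
Qed.

Lemma card_label l : (#|label_type l|%:R <= (4 * B%:R * 2 ^+ l) ^+ d :> R)%R.
Proof.
rewrite card_option card_ffun !card_ord -natrX -!natrM -natrX ler_nat.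
set K := (2 * B * 2 ^ l)%N.
have K2 : (2 <= K)%N by rewrite /K -mulnA leq_pmulr// muln_gt0 expn_gt0.
have -> : (4 * B * 2 ^ l = K + K)%N by rewrite /K; lia.
apply: (@leq_trans (K.+2 ^ d)%N); last by rewrite leq_exp2r//; lia.
by rewrite ltn_exp2r.
Qed.

(** Each coordinate separates the points for few of the shifts when they are at
    distance at most 1; beyond, the bound exceeds the number of shifts. *)
Lemma label_separation l M (x y : T) : (0 < M)%N ->
  \sum_(m < M) (label (m%:R / M%:R) l x != label (m%:R / M%:R) l y)%:R
  <= d%:R * 2 ^+ l * (M%:R * dE x y + 1).
Proof.
move=> M0.
have p2 : (1 : R) <= 2 ^+ l by rewrite exprn_ege1// ler1n.
have dl : 1 <= d%:R * 2 ^+ l :> R by rewrite mulr_ege1// ler1n.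
have [n1|n1] := leP (enorm (emb x - emb y)) 1; last first.
  have -> : dE x y = 1 by rewrite /dE min_r// ltW.
  apply: (@le_trans _ _ M%:R).
    rewrite -[X in _ <= X%:R]card_ord -sumr_const; apply: ler_sum => m _.
    by rewrite lern1 leq_b1.
  by rewrite mulr1 (@le_trans _ _ (M%:R + 1))// ?lerDl// ler_peMl// addr_ge0.
have -> : dE x y = enorm (emb x - emb y) by rewrite /dE min_l.
apply: (@le_trans _ _ (\sum_(m < M) \sum_(i < d)
   (Num.floor ((2 ^ l)%N%:R * (coordinate i x + m%:R / M%:R)) != Num.floor ((2 ^ l)%N%:R * (coordinate i y + m%:R / M%:R)))%:R)).
  apply: ler_sum => m _; case: eqP => [_|ne] /=; first by apply: sumr_ge0.
  have [i hi] : exists i, Num.floor ((2 ^ l)%N%:R * (coordinate i x + m%:R / M%:R)) != Num.floor ((2 ^ l)%N%:R * (coordinate i y + m%:R / M%:R)).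
    apply: contrapT => h; apply: ne; apply: cell_label; apply/ffunP => i; rewrite !ffunE.
    by apply: contrapT => hi; apply: h; exists i; rewrite natrX; exact/eqP.
  by rewrite (bigD1 i)//= hi lerDl sumr_ge0.
rewrite exchange_big/=.
have -> : d%:R * 2 ^+ l * (M%:R * enorm (emb x - emb y) + 1) =
    \sum_(i < d) (2 ^ l)%N%:R * (M%:R * enorm (emb x - emb y) + 1).
  by rewrite sumr_const card_ord -[RHS]mulr_natl mulrA natrX.
apply: ler_sum => i _; rewrite (le_trans (shifted_grid_separation _ _ _ M0))//.
rewrite ler_wpM2l// lerD2r ler_wpM2l//.
by have := coord_le_enorm (emb x - emb y) i; rewrite !mxE.
Qed.

Lemma outside_bracket t (x : T) : 0 <= t <= 1 -> outside t x -> b%:R <= bracket (emb x).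
Proof.
move=> /andP[t0 t1]; rewrite /outside negb_forall => /existsP[i].
rewrite !ffunE expr0 mul1r floor_ge_int floor_lt_int rmorphN/= => h.
apply: le_trans (enorm_le_bracket _); apply: le_trans (coord_le_enorm _ i).
rewrite -/(coordinate i x); move: h; rewrite /B -!pmulrn -natr1 negb_and -!ltNge -leNgt => /orP[h|h].
  by rewrite ler_normr; apply/orP; right; lra.
by rewrite ler_normr; apply/orP; left; lra.
Qed.

End grid.

Section core.
Context (R : realType) (d : nat) (d_gt0 : (0 < d)%N) (E : set 'rV[R]_d) (E0 : E !=set0).
Local Notation T := (borel E0).
Variables (b N M L : nat) (N2 : (2 <= N)%N) (M0 : (0 < M)%N).
Variables (G : probability (N.-tuple T) R) (f : probability T R).
Hypothesis Gsym : symmetric_law G.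
Variable p : probability (2.-tuple T * 2.-tuple T)%type R.
Hypothesis pc : couplings (marginal N2 G) (tensor_power f 2) p.

Let N0 : (0 < N)%N := ltnW N2.
Let c := @dE R d E E0.
Let cP : bounded_metric c := dE_bounded_metric E0.
Local Notation W := (w1_empirical (N := N) c f).
Let sh (m : 'I_M) : R := m%:R / M%:R.
Let Q m l : T -> label_type d b l := label b (sh m) l.

Definition separations (m : 'I_M) l (z : 2.-tuple T * 2.-tuple T) : R :=
  (Q m l (tnth z.1 ord0) != Q m l (tnth z.2 ord0))%:R +
  (Q m l (tnth z.1 (lift ord0 ord0)) != Q m l (tnth z.2 (lift ord0 ord0)))%:R.

Variables (v : nat -> R) (tl : R).
Hypothesis v0 : forall l, 0 < v l.
Hypothesis tlP : forall m, Ex f (fun y => (outside b (sh m) y)%:R) <= tl.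
Hypothesis vP : forall l, (l < L)%N ->
  \sum_(m < M) (N%:R^-1 + 3 * Ex p (separations m l.+1)) <= M%:R * v l.

Let n l : R := #|label_type d b l|%:R.

Let n_gt0 l : 0 < n l.
Proof. by rewrite ltr0n card_option. Qed.

(* Used instead of the inequality of Cauchy and Schwarz: it is linear in the
   square, and one [la] serves for all the grids and all the cells of a scale. *)
Let amgm (la z : R) : 0 < la -> Num.max 0 z <= (la * z ^+ 2 + la^-1) / 2.
Proof.
move=> la0.
have li : 0 < la^-1 by rewrite invr_gt0.
have h : la * la^-1 = 1 by rewrite mulfV// gt_eqF.
rewrite ge_max; apply/andP; split.
  by apply: divr_ge0 => //; apply: addr_ge0; [apply: mulr_ge0; [exact: ltW|exact: sqr_ge0]|exact: ltW].
rewrite ler_pdivlMr// -subr_ge0.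
have -> : la * z ^+ 2 + la^-1 - z * 2 = la * (z - la^-1) ^+ 2.
  have -> : la * (z - la^-1) ^+ 2 = la * z ^+ 2 - z * 2 * (la * la^-1) + la^-1 * (la * la^-1) by ring.
  by rewrite h; ring.
by apply: mulr_ge0; [exact: ltW|exact: sqr_ge0].
Qed.

(** For each shifted grid the tree bound and the inequality above give a bound that
    is linear in the second moments of the discrepancies. Only the mean of these
    over the shifts is under control, so the average over the shifts has to be
    taken before the parameter [la] of each scale is eliminated. *)
Lemma w1_empirical_multiscale : Ex G W <= tl + side R d L +
  \sum_(l < L) side R d l.+1 * Num.sqrt (n l.+1 * v l).
Proof.
(* The value for which the two terms of the mean are equal. *)
pose la l := Num.sqrt (n l.+1 / v l).
have la0 l : 0 < la l by rewrite sqrtr_gt0 divr_gt0.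
pose V m l := discrepancy (Q m l) f (N := N).
have bV m l : bmfun (V m l) by apply: bm_discrepancy => j; exact: measurable_label.
have one m : Ex G W <= tl + side R d L + \sum_(l < L) side R d l.+1 *
    ((la l * (N%:R^-1 + 3 * Ex p (separations m l.+1)) + (la l)^-1 * n l.+1) / 2).
  have bR : bmfun (fun X : N.-tuple T => \sum_(l < L) side R d l.+1 *
     ((la l * V m l.+1 X + (la l)^-1 * n l.+1) / 2)).
    apply: bm_sum => l; apply: bmZ; apply: bmM; last exact: bm_cst.
    by apply: bmD; [exact: bmZ|exact: bm_cst].
  apply: (@le_trans _ _ (Ex G (fun X => (tl + side R d L) + \sum_(l < L) side R d l.+1 *
     ((la l * V m l.+1 X + (la l)^-1 * n l.+1) / 2)))).
    apply: Ex_le; [exact: (bm_w1_empirical cP N0 f)|by apply: bmD => //; exact: bm_cst|move=> X].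
    have mQ l j : measurable [set x | Q m l x == j] by exact: measurable_label.
    have mO : measurable [set x : T | outside b (sh m) x] by exact: measurable_outside.
    have Q0 x y : Q m 0 x = Q m 0 y by exact: label0.
    have QS l x y : (l < L)%N -> Q m l.+1 x = Q m l.+1 y -> Q m l x = Q m l y.
      by move=> _; exact: label_refine.
    have QD l x y : (l <= L)%N -> Q m l x = Q m l y -> ~~ outside b (sh m) y -> c x y <= side R d l.
      by move=> _; exact: label_dE.
    have := tree_bound cP N0 f mQ mO Q0 QS QD (side_ge0 R d) X.
    move=> /le_trans; apply; apply: lerD; first by rewrite lerD2r.
    apply: ler_sum => l _; rewrite sideB ler_wpM2l ?side_ge0//.
    apply: (@le_trans _ _ (\sum_(j : label_type d b l.+1)
      (la l * (freq R (Q m l.+1) X j - mass (Q m l.+1) f j) ^+ 2 + (la l)^-1) / 2)).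
      by apply: ler_sum => j _; exact: amgm.
    rewrite -mulr_suml big_split/= -mulr_sumr sumr_const -[X in _ + X]mulr_natr.
    by rewrite cardT -cardE.
  rewrite ExD; [|exact: bm_cst|by []].
  rewrite Ex_cst lerD2l Ex_sum; last first.
    move=> l; apply: bmZ; apply: bmM; last exact: bm_cst.
    by apply: bmD; [exact: bmZ|exact: bm_cst].
  apply: ler_sum => l _; rewrite ExZ; last first.
    by apply: bmM; [apply: bmD; [exact: bmZ|exact: bm_cst]|exact: bm_cst].
  rewrite ler_wpM2l ?side_ge0//.
  have bx : bmfun (fun X : N.-tuple T => la l * V m l.+1 X + (la l)^-1 * n l.+1).
    by apply: bmD; [exact: bmZ|exact: bm_cst].
  have -> : Ex G (fun X => (la l * V m l.+1 X + (la l)^-1 * n l.+1) / 2) =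
      (la l * Ex G (V m l.+1) + (la l)^-1 * n l.+1) / 2.
    transitivity (Ex G (fun X => 2^-1 * (la l * V m l.+1 X + (la l)^-1 * n l.+1))).
      by apply: eq_Ex => X; rewrite mulrC.
    rewrite ExZ// mulrC; congr (_ * _).
    by rewrite ExD; [rewrite ExZ// Ex_cst|exact: bmZ|exact: bm_cst].
  rewrite ler_wpM2r// lerD2r; apply: ler_wpM2l; first exact: ltW.
  have mQ j : measurable [set x | Q m l.+1 x == j] by exact: measurable_label.
  exact: (Ex_discrepancy_le mQ Gsym pc).
have Mp : (0 : R) < M%:R by rewrite ltr0n.
rewrite -(ler_pM2l Mp).
have -> : M%:R * Ex G W = \sum_(m < M) Ex G W by rewrite sumr_const card_ord mulr_natl.
apply: (le_trans (ler_sum _ (fun m _ => one m))).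
rewrite big_split/= sumr_const card_ord [leRHS]mulrDr -[X in X + _]mulr_natl lerD2l.
rewrite exchange_big mulr_sumr; apply: ler_sum => l _.
rewrite -mulr_sumr mulrCA ler_wpM2l ?side_ge0//.
rewrite -mulr_suml ler_pdivrMr// big_split/= -mulr_sumr sumr_const card_ord -[X in _ + X]mulr_natl.
apply: (@le_trans _ _ (la l * (M%:R * v l) + M%:R * ((la l)^-1 * n l.+1))).
  by rewrite lerD2r ler_wpM2l ?vP// ltW.
have sqE : (la l) ^+ 2 = n l.+1 / v l by rewrite sqr_sqrtr// divr_ge0// ltW.
have vn : v l != 0 by rewrite gt_eqF.
have E1 : la l * v l = Num.sqrt (n l.+1 * v l).
  rewrite -[LHS]gtr0_norm ?mulr_gt0// -sqrtr_sqr; congr Num.sqrt.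
  by rewrite exprMn sqE; field.
have E2 : (la l)^-1 * n l.+1 = Num.sqrt (n l.+1 * v l).
  rewrite -E1; have ln : la l != 0 by rewrite gt_eqF.
  have -> : n l.+1 = la l ^+ 2 * v l by rewrite sqE divfK.
  by field.
rewrite mulrCA E1 E2; lra.
Qed.

End core.

(** * Choice of the scales *)

Section rate.
Context (R : realType).

Lemma pow2_bracket (a : R) : 1 < a -> exists L : nat, a <= 2 ^+ L < 2 * a.
Proof.
move=> a1; have a0 : 0 < a by exact: lt_trans a1.
have ex : exists L : nat, a <= 2 ^+ L.
  exists (Num.truncn a).+1; rewrite (le_trans (ltW (truncnS_gt a)))//.
  by rewrite -natrX ler_nat ltnW// ltn_expl.
have [[|L] aL minL] := ex_minnP ex.
  by rewrite expr0 leNgt a1 in aL.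
exists L.+1; rewrite aL/= exprS ltr_pM2l// ltNge; apply/negP => h.
by have := minL _ h; rewrite ltnn.
Qed.

Lemma nat_bracket (x : R) : 1 <= x -> exists2 B : nat, (0 < B)%N & x <= B%:R <= 2 * x.
Proof.
move=> x1; exists (Num.truncn x).+1 => //; rewrite (ltW (truncnS_gt x))/=.
rewrite -natr1; have : (Num.truncn x)%:R <= x by rewrite truncn_le; apply: le_trans x1.
lra.
Qed.

(** A small power of the finest scale pays for the number of scales. *)
Lemma pow2_absorbs_linear (eta : R) L : 0 < eta -> L%:R * (eta * ln 2) <= (2 ^+ L) `^ eta.
Proof.
move=> eta0.
have -> : (2 ^+ L : R) `^ eta = expR (L%:R * (eta * ln 2)).
  rewrite /powR gt_eqF ?exprn_gt0// lnXn// -[ln 2 *+ L]mulr_natl; congr expR; ring.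
by apply: le_trans (expR_ge1Dx _); rewrite lerDr.
Qed.

Variables (k gamma : R) (p q : nat) (K : R).
Hypotheses (k0 : 0 < k) (gamma0 : 0 < gamma) (q2 : (2 <= q)%N) (pq : (p <= q)%N) (K0 : 0 <= K).

Let s : R := q%:R + p%:R / k.
Hypothesis gammas : gamma < s^-1.

Let s0 : 0 < s.
Proof. by rewrite ltr_pwDl// ?ltr0n ?(leq_trans _ q2)// divr_ge0// ltW. Qed.

Let gs1 : gamma * s < 1.
Proof. by rewrite -ltr_pdivlMr// div1r. Qed.

(* The power of [beta `^ gamma] that is left over. *)
Let eta : R := (1 - gamma * s) / (2 * gamma).

Let eta0 : 0 < eta.
Proof. by rewrite divr_gt0 ?subr_gt0// mulr_gt0. Qed.

Let c1 : R := 2 ^+ p * 2 ^+ (q - 2).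

(** Here [B] gives the size of the cube and [L] the number of scales; [(p, q)] is
    [(d, d + 1)] for a general law and [(d', d')], with [d' := max (d, 2)], for
    independent samples. With [A := m * beta `^ gamma] the choices
    [2 ^- L ~ A] and [B ~ m * A `^ (-1/k)] make the first two terms of order [A]; the
    strict bound on [gamma] leaves a power of [beta] that absorbs the factor [L] in
    the third. *)
Lemma rate_optimization : exists2 C : R, 0 < C & forall m beta w : R,
  1 <= m -> 0 < beta -> w <= 1 ->
  (forall B L : nat, (0 < B)%N -> w <= m `^ k / B%:R `^ k + K * 2 ^- L +
     K * (L%:R * Num.sqrt (B%:R ^+ p * 2 ^+ (L * (q - 2)) * beta))) ->
  w <= C * m * beta `^ gamma.
Proof.
have ln20 : 0 < ln (2 : R) by apply: ln_gt0; rewrite ltr1n.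
have el0 : 0 < eta * ln 2 by exact: mulr_gt0.
pose K3 := Num.sqrt c1 * (2 `^ eta) / (eta * ln 2).
have K30 : 0 <= K3 by apply: divr_ge0; [apply: mulr_ge0; [exact: sqrtr_ge0|exact: powR_ge0]|exact: ltW].
exists (1 + K + K * K3); first by rewrite -addrA ltr_pwDl// addr_ge0// mulr_ge0.
move=> m beta w m1 beta0 w1 h.
have m0 : 0 < m by exact: lt_le_trans m1.
have bg0 : 0 < beta `^ gamma by exact: powR_gt0.
pose A := m * beta `^ gamma.
have A0 : 0 < A by exact: mulr_gt0.
rewrite -mulrA -/A.
have C1 : 1 <= 1 + K + K * K3 by rewrite -addrA lerDl addr_ge0// mulr_ge0.
have [A1|A1] := leP 1 A.
  rewrite (le_trans w1)// (le_trans A1)// ler_peMl// ltW//.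
have Ai : 1 < A^-1 by rewrite invf_gt1.
have [L /andP[L1 L2]] := pow2_bracket Ai.
have p2 : (0 : R) < 2 ^+ L by exact: exprn_gt0.
pose y := A^-1 `^ k^-1.
have y1 : 1 <= y.
  have := @ler_powR R A^-1 (ltW Ai) 0 k^-1; rewrite powRr0; apply.
  by rewrite invr_ge0 ltW.
have y0 : 0 < y by exact: lt_le_trans y1.
have x1 : 1 <= m * y by rewrite mulr_ege1.
have x0 : 0 < m * y by exact: lt_le_trans x1.
have [B B0 /andP[B1 B2]] := nat_bracket x1.
have Bp : (0 : R) < B%:R by rewrite ltr0n.
have T1 : m `^ k / B%:R `^ k <= A.
  rewrite ler_pdivrMr ?powR_gt0//.
  apply: (@le_trans _ _ (A * (m * y) `^ k)); last first.
    rewrite ler_wpM2l// ?(ltW A0)//; apply: ge0_ler_powR; rewrite ?nnegrE// ?(ltW k0)// ?(ltW x0)//.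
  rewrite powRM ?(ltW m0)// ?(ltW y0)// /y -powRrM mulVf ?gt_eqF// powRr1 ?invr_ge0 ?(ltW A0)//.
  by rewrite mulrCA mulfV ?mulr1// gt_eqF.
have T2 : 2 ^- L <= A by rewrite -[leRHS]invrK lef_pV2 ?posrE ?invr_gt0.
have key : B%:R ^+ p * 2 ^+ (L * (q - 2)) * beta <= c1 * (A * (beta `^ gamma) `^ eta) ^+ 2.
  have e1 : B%:R ^+ p <= 2 ^+ p * (m ^+ p * y ^+ p).
    by rewrite -!exprMn lerXn2r// nnegrE ?ltW// mulr_gt0.
  have e2 : 2 ^+ (L * (q - 2)) <= 2 ^+ (q - 2) * A^-1 ^+ (q - 2).
    rewrite exprM -exprMn lerXn2r// ?nnegrE ?(ltW L2)// ?mulr_ge0// ?(ltW p2)// ltW//.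
    by rewrite invr_gt0.
  have e3 : A `^ s = A ^+ (q - 2) * A ^+ 2 * (y ^+ p)^-1.
    rewrite /s powRD; last by rewrite (gt_eqF A0) implybT.
    rewrite powR_mulrn ?(ltW A0)// -{1}(subnK q2) exprD; congr (_ * _).
    rewrite mulrC powRrM /y powR_mulrn ?powR_ge0// -exprVn; congr (_ ^+ _).
    have -> : A^-1 = A `^ (-1) by rewrite powR_inv1// ltW.
    by rewrite -powRrM mulN1r powRN invrK.
  have e4 : m ^+ p * beta <= A `^ s * ((beta `^ gamma) `^ eta) ^+ 2.
    rewrite -[((_ `^ _) `^ _) ^+ 2]powR_mulrn ?powR_ge0// -!powRrM.
    rewrite /A powRM ?(ltW m0) ?(ltW bg0)// -powRrM -mulrA -powRD; last by rewrite (gt_eqF beta0) implybT.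
    have -> : gamma * s + gamma * (eta * 2) = 1.
      by rewrite /eta; field; rewrite gt_eqF.
    rewrite powRr1 ?(ltW beta0)// ler_wpM2r ?(ltW beta0)//.
    rewrite -powR_mulrn ?(ltW m0)//; apply: ler_powR => //.
    by rewrite /s (@le_trans _ _ q%:R)// ?ler_nat// lerDl divr_ge0// ltW.
  have yp : 0 < y ^+ p by exact: exprn_gt0.
  have Aq : 0 < A ^+ (q - 2) by exact: exprn_gt0.
  apply: (@le_trans _ _ (2 ^+ p * (m ^+ p * y ^+ p) * (2 ^+ (q - 2) * A^-1 ^+ (q - 2)) * beta)).
    by rewrite ler_wpM2r ?(ltW beta0)//; apply: ler_pM.
  have -> : 2 ^+ p * (m ^+ p * y ^+ p) * (2 ^+ (q - 2) * A^-1 ^+ (q - 2)) * beta =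
     c1 * (y ^+ p * A^-1 ^+ (q - 2)) * (m ^+ p * beta) by rewrite /c1; ring.
  apply: (@le_trans _ _ (c1 * (y ^+ p * A^-1 ^+ (q - 2)) * (A `^ s * ((beta `^ gamma) `^ eta) ^+ 2))).
    by rewrite ler_wpM2l// !mulr_ge0// ?exprn_ge0// ?(ltW y0)// invr_ge0 ltW.
  rewrite e3 exprVn le_eqVlt; apply/orP; left; apply/eqP.
  by field; rewrite !gt_eqF.
have bA : beta `^ gamma <= 2 * 2 ^- L.
  apply: (@le_trans _ _ A); first by rewrite ler_peMl// ltW.
  by rewrite -[leLHS]invrK -[leRHS]invrK lef_pV2 ?posrE ?invr_gt0 ?mulr_gt0// ?invr_gt0// invfM invrK -ler_pdivlMl ?invr_gt0// invrK ltW.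
have T3 : L%:R * Num.sqrt (B%:R ^+ p * 2 ^+ (L * (q - 2)) * beta) <= K3 * A.
  have z0 : 0 <= A * (beta `^ gamma) `^ eta by rewrite mulr_ge0 ?powR_ge0// ltW.
  apply: (@le_trans _ _ (L%:R * (Num.sqrt c1 * (A * (beta `^ gamma) `^ eta)))).
    rewrite ler_wpM2l//; apply: (le_trans (ler_wsqrtr key)).
    by rewrite sqrtrM ?mulr_ge0 ?exprn_ge0// sqrtr_sqr ger0_norm.
  have pw : 0 < (2 ^+ L : R) `^ eta by exact: powR_gt0.
  have pe : (beta `^ gamma) `^ eta <= 2 `^ eta / (2 ^+ L) `^ eta.
    rewrite ler_pdivlMr// -powRM ?(ltW p2) ?(ltW bg0)//.
    apply: ge0_ler_powR; rewrite ?nnegrE ?(ltW eta0)// ?mulr_ge0 ?(ltW p2) ?(ltW bg0)//.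
    by rewrite -ler_pdivlMr.
  have lin := pow2_absorbs_linear L eta0.
  have lin' : L%:R / (2 ^+ L) `^ eta <= (eta * ln 2)^-1.
    by rewrite ler_pdivrMr// mulrC ler_pdivlMr.
  apply: (@le_trans _ _ (Num.sqrt c1 * A * (2 `^ eta * (L%:R / (2 ^+ L) `^ eta)))).
    have -> : L%:R * (Num.sqrt c1 * (A * (beta `^ gamma) `^ eta)) =
      Num.sqrt c1 * A * (L%:R * (beta `^ gamma) `^ eta) by ring.
    apply: ler_wpM2l; first by apply: mulr_ge0; [exact: sqrtr_ge0|exact: ltW].
    by rewrite [leRHS]mulrCA; apply: ler_wpM2l.
  have -> : K3 * A = Num.sqrt c1 * A * (2 `^ eta * (eta * ln 2)^-1) by rewrite /K3; ring.
  apply: ler_wpM2l; first by apply: mulr_ge0; [exact: sqrtr_ge0|exact: ltW].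
  by apply: ler_wpM2l => //; exact: powR_ge0.
apply: (le_trans (h B L B0)).
rewrite !mulrDl mul1r -[K * K3 * A]mulrA; apply: lerD; last by rewrite ler_wpM2l.
by apply: lerD => //; rewrite ler_wpM2l.
Qed.

End rate.

(** * Quantitative rates *)

Section moments.
Context (R : realType) (d : nat) (E : set 'rV[R]_d) (E0 : E !=set0).
Local Notation T := (borel E0).
Variables (k : R) (k0 : 0 < k) (f : probability T R).

Lemma measurable_bracket_powR : measurable_fun setT (fun x : T => bracket (emb x) `^ k).
Proof.
apply: (measurableT_comp (f := fun y : R => y `^ k)); first exact: measurable_powR.
apply: (measurableT_comp (f := @Num.sqrt R)).
  by apply: continuous_measurable_fun; exact: sqrt_continuous.
rewrite (_ : (fun _ => _) = fun x : T => 1 + \sum_(i < d) coordinate i x ^+ 2); last first.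
  by apply/funext => x; rewrite enorm_sqr.
apply: measurable_funD => //; apply: measurable_sum => i.
by apply: measurable_funX; exact: measurable_coordinate.
Qed.

Lemma moment_ge (g : T -> R) : bmfun g -> (forall x, 0 <= g x <= bracket (emb x) `^ k) ->
  ((Ex f g)%:E <= moment k f)%E.
Proof.
move=> bg h; rewrite -ExE//; apply: ge0_le_integral => //.
- by move=> x _; rewrite lee_fin; have /andP[] := h x.
- by apply/measurable_EFinP; exact: bg.1.
- by apply/measurable_EFinP; exact: measurable_bracket_powR.
- by move=> x _; rewrite lee_fin; have /andP[] := h x.
Qed.

Lemma moment_ge1 : (1 <= moment k f)%E.
Proof.
rewrite -[X in (X <= _)%E]/(1%:E) -(Ex_cst f 1); apply: moment_ge; first exact: bm_cst.
move=> x; rewrite ler01/=; have := @ler_powR R _ (bracket_ge1 (emb x)) 0 k.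
by rewrite powRr0; apply; exact: ltW.
Qed.

(** The inequality of Markov, with [outside_bracket]. *)
Lemma outside_mass (b : nat) (t mu : R) : (0 < b)%N -> 0 <= t <= 1 -> (moment k f <= mu%:E)%E ->
  Ex f (fun x => (outside b t x)%:R) <= mu / b%:R `^ k.
Proof.
move=> b0 t01 fmu; have bk : 0 < b%:R `^ k :> R by rewrite powR_gt0// ltr0n.
rewrite ler_pdivlMr// mulrC -ExZ; last by apply: bm_bool; exact: measurable_outside.
rewrite -lee_fin; apply: le_trans fmu; apply: moment_ge.
  by apply: bmZ; apply: bm_bool; exact: measurable_outside.
move=> x; have [Ox|_] := boolP (outside b t x); rewrite ?mulr1 ?mulr0 ?lexx ?powR_ge0//=.
by apply: ge0_ler_powR; rewrite ?nnegrE ?(ltW k0) ?sqrtr_ge0//; exact: outside_bracket Ox.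
Qed.

End moments.

Section scales.
Context (R : realType) (d : nat) (d_gt0 : (0 < d)%N).

Lemma card_label_le b l : (0 < b)%N ->
  #|label_type d b l|%:R <= (8 * b%:R * 2 ^+ l) ^+ d :> R.
Proof.
move=> b0; apply: (le_trans (card_label R d_gt0 b l)).
have p2 : (0 : R) <= 2 ^+ l by rewrite exprn_ge0.
rewrite lerXn2r ?nnegrE ?mulr_ge0// ler_wpM2r//.
have b1 : (1 : R) <= b%:R by rewrite ler1n.
rewrite -natr1; lra.
Qed.

(** Since [2 <= q], the square root grows at least as fast as the sides decrease, so
    that none of the [L] terms exceeds the bound for the finest scale. *)
Lemma sum_scales b L (p q : nat) (K beta : R) (v : nat -> R) : (2 <= q)%N -> 0 <= K -> 0 <= beta ->
  (forall l, (l < L)%N -> #|label_type d b l.+1|%:R * v l <=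
     K * (b%:R ^+ p * 2 ^+ (l.+1 * q)) * beta) ->
  \sum_(l < L) side R d l.+1 * Num.sqrt (#|label_type d b l.+1|%:R * v l) <=
  (d%:R * Num.sqrt K) * (L%:R * Num.sqrt (b%:R ^+ p * 2 ^+ (L * (q - 2)) * beta)).
Proof.
move=> q2 K0 beta0 h.
have -> : (d%:R * Num.sqrt K) * (L%:R * Num.sqrt (b%:R ^+ p * 2 ^+ (L * (q - 2)) * beta)) =
   \sum_(l < L) (d%:R * Num.sqrt K) * Num.sqrt (b%:R ^+ p * 2 ^+ (L * (q - 2)) * beta).
  by rewrite sumr_const card_ord -[RHS]mulr_natl mulrCA.
apply: ler_sum => l _; rewrite /side -!mulrA; apply: ler_wpM2l => //.
have p2 : (0 : R) < 2 ^+ l.+1 by exact: exprn_gt0.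
rewrite mulrC ler_pdivrMr// -sqrtrM//.
rewrite -[X in _ <= _ * X]gtr0_norm// -sqrtr_sqr -sqrtrM; last first.
  by rewrite !mulr_ge0// ?exprn_ge0.
apply: ler_wsqrtr; apply: (le_trans (h l (ltn_ord l))).
rewrite -!mulrA ler_wpM2l// ler_wpM2l ?exprn_ge0//.
rewrite [leRHS]mulrCA [leRHS]mulrC ler_wpM2r//.
rewrite -exprM -exprD; apply: ler_weXn2l; first by rewrite ler1n.
have lL := ltn_ord l; have : (l.+1 * (q - 2) <= L * (q - 2))%N by rewrite leq_mul2r lL orbT.
have -> : (l.+1 * q = l.+1 * (q - 2) + l.+1 * 2)%N by rewrite -mulnDr subnK.
by lia.
Qed.

End scales.

Section quantitative.
Context (R : realType) (d : nat) (d_gt0 : (0 < d)%N) (k gamma : R).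
Hypotheses (k0 : 0 < k) (gamma0 : 0 < gamma).

(** With [N] shifts, the error of order [1 / N] made by replacing the mean over all
    translations of the grid by a finite one is of the same order as the
    contribution of the diagonal to the second moments. *)
Lemma w1_empirical_rate : gamma < (d%:R + 1 + d%:R / k)^-1 ->
  exists2 C : R, 0 < C & forall (E : set 'rV[R]_d) (E0 : E !=set0) (N : nat) (N2 : (2 <= N)%N)
    (G : probability (N.-tuple (borel E0)) R) (f : probability (borel E0) R) (m : R),
    symmetric_law G -> 1 <= m -> (moment k f <= (m `^ k)%:E)%E ->
    Ex G (w1_empirical (N := N) (@dE R d E E0) f) <=
      C * m * (omega (@dE R d E E0) G f N2 + N%:R^-1) `^ gamma.
Proof.
move=> gs.
pose K1 : R := 8 ^+ d * (13 * d%:R).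
have K10 : 0 <= K1 by rewrite mulr_ge0 ?exprn_ge0// mulr_ge0.
pose K := d%:R + d%:R * Num.sqrt K1.
have K0 : 0 <= K by rewrite addr_ge0// mulr_ge0// sqrtr_ge0.
have q2 : (2 <= d.+1)%N by [].
have gs' : gamma < (d.+1%:R + d%:R / k)^-1 by rewrite -natr1.
have [C C0 HC] := rate_optimization k0 gamma0 q2 (leqnSn d) K0 gs'.
exists C => // E E0 N N2 G f m Gsym m1 fm.
have N0 : (0 < N)%N := ltnW N2.
have cP := dE_bounded_metric E0.
have cM := bounded_metric_measurable cP; have c01 := bounded_metric01 cP.
have N1 : (0 : R) < N%:R^-1 by rewrite invr_gt0 ltr0n.
have /andP[om0 om1] := omega01 cM c01 G f N2.
set beta := _ + N%:R^-1.
have beta0 : 0 < beta by rewrite ltr_wpDl.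
apply: HC => //.
  apply: Ex_le_cst; first exact: (bm_w1_empirical cP N0 f).
  by move=> X; have /andP[] := w1_empirical01 cP N0 f X.
move=> b L b0.
have [p pc pe] := omega_approx cM c01 G f N2 N1.
(* 13 = 1 + 3 * 4: the factor 3 is that of [Ex_discrepancy_le], which
   multiplies at most [4 * d * 2 ^ l.+1 * beta] separated points for each shift,
   and [1 / N] is at most [d * 2 ^ l.+1 * beta]. *)
pose v l : R := 13 * d%:R * 2 ^+ l.+1 * beta.
have v0 l : 0 < v l by rewrite !mulr_gt0 ?exprn_gt0// ltr0n.
have sh01 (m' : 'I_N) : 0 <= (m'%:R / N%:R : R) <= 1.
  by rewrite divr_ge0//= ler_pdivrMr ?ltr0n// mul1r ler_nat ltnW.
have tlP (m' : 'I_N) : Ex f (fun y => (outside b (m'%:R / N%:R) y)%:R) <= m `^ k / b%:R `^ k.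
  exact: outside_mass.
have bsep (m' : 'I_N) l : bmfun (separations (E0 := E0) b m' l : _ -> R).
  by apply: bmD; apply: bm_separated => j; exact: measurable_label.
have vP l : (l < L)%N -> \sum_(m' < N) (N%:R^-1 + 3 * Ex p (separations b m' l.+1)) <= N%:R * v l.
  move=> _; rewrite big_split/= sumr_const card_ord -[X in X + _]mulr_natl mulfV; last by rewrite pnatr_eq0 -lt0n.
  rewrite -mulr_sumr -Ex_sum//.
  have btd := bm_cost (@measurable_tuple_dist _ _ _ _ cM c01 2) (@tuple_dist01 _ _ _ _ c01 2).
  have p2 : (1 : R) <= 2 ^+ l.+1 by rewrite exprn_ege1// ler1n.
  have d1 : (1 : R) <= d%:R by rewrite ler1n.
  have Np : (0 : R) < N%:R by rewrite ltr0n.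
  have S : Ex p (fun z => \sum_(m' < N) separations b m' l.+1 z) <=
      d%:R * 2 ^+ l.+1 * (2 * N%:R * Ex p (fun z => tuple_dist (@dE R d E E0) z.1 z.2) + 2).
    rewrite -ExZ// -[X in _ * (_ + X)](Ex_cst p 2) -ExD; [|exact: bmZ|exact: bm_cst].
    have b2 : bmfun (fun z : 2.-tuple (borel E0) * 2.-tuple (borel E0) =>
        2 * N%:R * tuple_dist (@dE R d E E0) z.1 z.2 + 2).
      by apply: bmD; [exact: bmZ|exact: bm_cst].
    rewrite -ExZ//; apply: Ex_le; [by apply: bm_sum => m'; exact: bsep|exact: bmZ|move=> z].
    rewrite big_split/=.
    have s1 := label_separation d_gt0 b l.+1 (tnth z.1 ord0) (tnth z.2 ord0) N0.
    have s2 := label_separation d_gt0 b l.+1 (tnth z.1 (lift ord0 ord0)) (tnth z.2 (lift ord0 ord0)) N0.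
    apply: (le_trans (lerD s1 s2)).
    rewrite /tuple_dist big_ord_recl big_ord_recl big_ord0 addr0 -mulrDr.
    rewrite le_eqVlt; apply/orP; left; apply/eqP; congr (_ * _).
    by field.
  have dp : 0 <= d%:R * 2 ^+ l.+1 :> R by apply: mulr_ge0 => //; lra.
  have dp1 : 1 <= d%:R * 2 ^+ l.+1 :> R by rewrite mulr_ege1.
  have pe' : Ex p (fun z => tuple_dist (@dE R d E E0) z.1 z.2) <= beta by rewrite /beta.
  have S' : Ex p (fun z => \sum_(m' < N) separations b m' l.+1 z) <= d%:R * 2 ^+ l.+1 * (4 * (N%:R * beta)).
    apply: (le_trans S); apply: ler_wpM2l => //.
    have Nb : 1 <= N%:R * beta by rewrite mulrDr mulfV ?gt_eqF// lerDr mulr_ge0.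
    have : N%:R * Ex p (fun z => tuple_dist (@dE R d E E0) z.1 z.2) <= N%:R * beta by rewrite ler_pM2l.
    rewrite -[2 * _ * _]mulrA; move: Nb; clear; move: (N%:R * Ex p _) (N%:R * beta) => a1 a2; lra.
  have Nb : 1 <= d%:R * 2 ^+ l.+1 * (N%:R * beta).
    by rewrite mulr_ege1// mulrDr mulfV ?gt_eqF// lerDr mulr_ge0.
  rewrite /v; set D := d%:R * 2 ^+ l.+1 in S' Nb *.
  have -> : N%:R * (13 * d%:R * 2 ^+ l.+1 * beta) = 13 * (D * (N%:R * beta)) by rewrite /D; ring.
  have e4 : D * (4 * (N%:R * beta)) = 4 * (D * (N%:R * beta)) by ring.
  rewrite e4 in S'; move: S' Nb; clear.
  move: (Ex p _) (D * (N%:R * beta)) => a1 a2; lra.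
have CB := w1_empirical_multiscale d_gt0 N0 Gsym pc v0 tlP vP.
apply: (le_trans CB).
rewrite -!addrA lerD2l; apply: lerD.
  by rewrite /side ler_wpM2r ?invr_ge0 ?exprn_ge0// lerDl mulr_ge0// sqrtr_ge0.
have SS := sum_scales d_gt0 (b := b) (L := L) (p := d) (v := v) q2 K10 (ltW beta0).
apply: (le_trans (SS _)).
  move=> l _.
  apply: (@le_trans _ _ ((8 * b%:R * 2 ^+ l.+1) ^+ d * v l)).
    by apply: ler_wpM2r; [exact: ltW|exact: card_label_le].
  rewrite le_eqVlt; apply/orP; left; apply/eqP.
  by rewrite /v /K1 mulnS exprD exprM !exprMn; ring.
by apply: ler_wpM2r; [rewrite mulr_ge0 ?sqrtr_ge0|rewrite lerDr].
Qed.

(** The two-particle marginal is the product law itself, and its diagonal coupling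
    separates nothing, whatever the grid: one grid is enough. *)
Lemma w1_empirical_iid_rate : gamma < ((maxn d 2)%:R + (maxn d 2)%:R / k)^-1 ->
  exists2 C : R, 0 < C & forall (E : set 'rV[R]_d) (E0 : E !=set0) (N : nat) (N0 : (0 < N)%N)
    (f : probability (borel E0) R) (m : R),
    1 <= m -> (moment k f <= (m `^ k)%:E)%E ->
    Ex (tensor_power f N) (w1_empirical (N := N) (@dE R d E E0) f) <=
      C * m * N%:R^-1 `^ gamma.
Proof.
set d' := maxn d 2 => gs.
have q2 : (2 <= d')%N by rewrite leq_maxr.
pose K1 : R := 8 ^+ d'.
have K10 : 0 <= K1 by rewrite exprn_ge0.
pose K := d%:R + d%:R * Num.sqrt K1.
have K0 : 0 <= K by rewrite addr_ge0// mulr_ge0// sqrtr_ge0.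
have [C C0 HC] := rate_optimization k0 gamma0 q2 (leqnn d') K0 gs.
exists (C + 1); first by rewrite addr_gt0.
move=> E E0 N N0 f m m1 fm.
have cP := dE_bounded_metric E0.
have N1 : (0 : R) < N%:R^-1 by rewrite invr_gt0 ltr0n.
have w1 : Ex (tensor_power f N) (w1_empirical (N := N) (@dE R d E E0) f) <= 1.
  apply: Ex_le_cst; first exact: (bm_w1_empirical cP N0 f).
  by move=> X; have /andP[] := w1_empirical01 cP N0 f X.
have mb0 : 0 <= m * N%:R^-1 `^ gamma by rewrite mulr_ge0 ?powR_ge0// (le_trans _ m1).
rewrite -mulrA mulrDl mul1r.
have [N2|] := leqP 2 N; last first.
  rewrite ltnS => Nle; have N_1 : N = 1%N by apply/eqP; rewrite eqn_leq Nle.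
  apply: (le_trans w1); rewrite [X in X%:R^-1]N_1 invr1 powR1 mulr1.
  by rewrite (le_trans m1)// lerDr mulr_ge0 ?(ltW C0)// (le_trans _ m1).
apply: (@le_trans _ _ (C * (m * N%:R^-1 `^ gamma))); last by rewrite lerDl.
rewrite mulrA; apply: HC => // b L b0.
have mdiag : measurable_fun setT (fun X : 2.-tuple (borel E0) => (X, X)).
  exact: measurable_fun_pair.
pose p := image_law mdiag (tensor_power f 2).
have pc : couplings (marginal N2 (tensor_power f N)) (tensor_power f 2) p.
  by move=> A mA; split => //; exact/esym/marginal_tensor_power.
have tlP (m' : 'I_1) : Ex f (fun y => (outside b (m'%:R / 1%:R) y)%:R) <= m `^ k / b%:R `^ k.
  by apply: outside_mass => //; rewrite ord1 mul0r lexx ler01.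
have vP l : (l < L)%N -> \sum_(m' < 1) (N%:R^-1 + 3 * Ex p (separations b m' l.+1)) <= 1%:R * (N%:R^-1 : R).
  move=> _; rewrite big_ord1 mul1r Ex_image_law; last first.
    by apply: bmD; apply: bm_separated => j; exact: measurable_label.
  rewrite (_ : (fun _ => _) = fun _ => 0) ?Ex_cst ?mulr0 ?addr0//.
  by apply/funext => X; rewrite /separations !eqxx addr0.
have CB := w1_empirical_multiscale d_gt0 (ltnSn 0) (@tensor_power_symmetric _ _ _ f N) pc (fun=> N1) tlP vP.
apply: (le_trans CB).
rewrite -!addrA lerD2l; apply: lerD.
  by rewrite /side ler_wpM2r ?invr_ge0 ?exprn_ge0// lerDl mulr_ge0// sqrtr_ge0.
have SS := sum_scales d_gt0 (b := b) (L := L) (p := d') (v := fun=> N%:R^-1) q2 K10 (ltW N1).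
apply: (le_trans (SS _)).
  move=> l _; rewrite ler_wpM2r ?(ltW N1)//.
  apply: (le_trans (card_label_le R d_gt0 l.+1 b0)).
  have b1 : (1 : R) <= b%:R by rewrite ler1n.
  have p1 : (1 : R) <= 2 ^+ l.+1 by rewrite exprn_ege1// ler1n.
  apply: (@le_trans _ _ ((8 * b%:R * 2 ^+ l.+1) ^+ d')).
    apply: ler_weXn2l; last exact: leq_maxl.
    by rewrite !mulr_ege1// ler1n.
  by rewrite /K1 !exprMn exprM mulrA.
by apply: ler_wpM2r; [rewrite mulr_ge0 ?sqrtr_ge0|rewrite lerDr].
Qed.

End quantitative.

(** * Chaos estimates for Borel laws *)

Section omega_real.
Context (R : realType) (d : nat) (E : set 'rV[R]_d) (E0 : E !=set0).
Variables (N : nat) (G : probability (N.-tuple (borel E0)) R) (f : probability (borel E0) R).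

Let cP := dE_bounded_metric E0.

Lemma Omega_omega j (jN : (j <= N)%N) :
  Omega jN G f = (omega (@dE R d E E0) G f jN)%:E.
Proof.
exact: (omegaE (bounded_metric_measurable cP) (bounded_metric01 cP) G f jN).
Qed.

Lemma Omega_oo_w1_empirical (N0 : (0 < N)%N) :
  Omega_oo G f = (Ex G (w1_empirical (@dE R d E E0) f))%:E.
Proof.
rewrite -ExE; last exact: (bm_w1_empirical cP N0 f).
by apply: eq_integral => X _; exact: (wasserstein1_empirical cP N0 f X).
Qed.

End omega_real.

Lemma fin_num_moment_root (R : realType) (k : R) (S : \bar R) : 0 < k ->
  (1 <= S)%E -> S != +oo%E -> exists2 m : R, 1 <= m & (S `^ k^-1 = m%:E /\ S = (m `^ k)%:E)%E.
Proof.
case: S => [s| |]// k0; rewrite lee_fin => s1 _; exists (s `^ k^-1).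
  have := @ler_powR R s s1 0 k^-1; rewrite powRr0; apply.
  by rewrite invr_ge0 ltW.
by rewrite poweR_EFin -powRrM mulVf ?gt_eqF// powRr1// (le_trans _ s1).
Qed.

Set Strict Implicit.
Unset Implicit Arguments.
Local Open Scope ereal_scope.

Theorem theorem4 (R : realType) (d : nat) (d_gt0 : (0 < d)%N) :
  (* (i) and (ii) *)
  (forall (E : set 'rV[R]_d) (Ecl : closed E) (E0 : E !=set0)
      (N : nat) (N_gt0 : (0 < N)%N)
      (G : probability (N.-tuple (borel E0)) R) (Gsym : symmetric_law G)
      (f : probability (borel E0) R),
    (forall (j l : nat) (j_gt0 : (0 < j)%N) (jl : (j <= l)%N) (lN : (l <= N)%N),
       Omega (leq_trans jl lN) G f <= 2%:E * Omega lN G f) /\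
    (forall (j : nat) (j_gt0 : (0 < j)%N) (jN : (j <= N)%N),
       Omega jN G f <= Omega_oo G f + (j%:R ^+ 2 / N%:R)%:E)) /\
  (* (iii) *)
  (forall (k gamma : R), (0 < k)%R -> (0 < gamma)%R ->
     (gamma < (d%:R + 1 + d%:R / k)^-1)%R ->
   exists C : R, (0 < C)%R /\
   forall (E : set 'rV[R]_d) (Ecl : closed E) (E0 : E !=set0)
      (N : nat) (N_ge2 : (2 <= N)%N)
      (G : probability (N.-tuple (borel E0)) R) (Gsym : symmetric_law G)
      (f : probability (borel E0) R),
     Omega_oo G f <=
       C%:E * (moment k f + moment1 (ltnW N_ge2) k G) `^ k^-1
            * (Omega N_ge2 G f + (N%:R^-1)%:E) `^ gamma) /\
  (* (iv) *)
  (forall (k gamma : R), (0 < k)%R -> (0 < gamma)%R ->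
     (gamma < ((maxn d 2)%:R + (maxn d 2)%:R / k)^-1)%R ->
   exists C : R, (0 < C)%R /\
   forall (E : set 'rV[R]_d) (Ecl : closed E) (E0 : E !=set0)
      (N : nat) (N_gt0 : (0 < N)%N)
      (G : probability (N.-tuple (borel E0)) R) (Gsym : symmetric_law G)
      (f : probability (borel E0) R),
     `| Omega (leqnn N) G f - Omega_oo G f | <=
       C%:E * moment k f `^ k^-1 * ((N%:R `^ gamma)^-1)%:E).
Proof.
split; [|split].
- move=> E _ E0 N N0 G Gsym f; have cP := dE_bounded_metric E0.
  have cM := bounded_metric_measurable cP; have c01 := bounded_metric01 cP.
  split=> [j l j0 jl lN|j j0 jN].
    rewrite !Omega_omega lee_fin.
    have := omega_monotone cM c01 f Gsym j0 jl (leq_trans jl lN) lN.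
    have /andP[] := omega01 cM c01 G f lN; lra.
  rewrite Omega_omega (Omega_oo_w1_empirical G f N0) lee_fin.
  exact: omega_le_w1_empirical.
- move=> k gamma k0 gamma0 gs.
  have [C C0 HC] := w1_empirical_rate d_gt0 k0 gamma0 gs.
  exists C; split=> // E _ E0 N N2 G Gsym f.
  have cP := dE_bounded_metric E0.
  have cM := bounded_metric_measurable cP; have c01 := bounded_metric01 cP.
  rewrite (Omega_oo_w1_empirical G f (ltnW N2)) Omega_omega.
  have /andP[om0 _] := omega01 cM c01 G f N2.
  have beta0 : (0 < omega (@dE R d E E0) G f N2 + N%:R^-1)%R.
    by rewrite ltr_wpDl// invr_gt0 ltr0n ltnW.
  rewrite -EFinD poweR_EFin.
  have f1 := moment_ge1 k0 f.
  set S := moment k f + _.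
  have fS : moment k f <= S.
    by rewrite leeDl//; apply: integral_ge0 => x _; rewrite lee_fin powR_ge0.
  have S1 : 1 <= S by exact: le_trans fS.
  have [Soo|Sfin] := eqVneq S +oo.
    rewrite Soo poweRyr ?gt_eqF ?invr_gt0// gt0_muley ?lte_fin//.
    by rewrite gt0_mulye ?leey// lte_fin powR_gt0.
  have [m m1 [Sm Smk]] := fin_num_moment_root k0 S1 Sfin.
  rewrite Sm -!EFinM lee_fin; apply: HC => //.
  by rewrite -Smk.
- move=> k gamma k0 gamma0 gs.
  have [C C0 HC] := w1_empirical_iid_rate d_gt0 k0 gamma0 gs.
  exists C; split=> // E _ E0 N N0 G Gsym f.
  have cP := dE_bounded_metric E0.
  rewrite (Omega_oo_w1_empirical G f N0) Omega_omega.
  have h1 := w1_empirical_le_omega cP N0 G f.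
  have h2 := omega_le_w1_empirical_iid cP N0 f Gsym.
  have f1 := moment_ge1 k0 f.
  have Ng : (0 < (N%:R `^ gamma)^-1 :> R)%R by rewrite invr_gt0 powR_gt0// ltr0n.
  have [foo|ffin] := eqVneq (moment k f) +oo.
    rewrite foo poweRyr ?gt_eqF ?invr_gt0// gt0_muley ?lte_fin//.
    by rewrite gt0_mulye ?leey// lte_fin.
  have [m m1 [fm fmk]] := fin_num_moment_root k0 f1 ffin.
  have mf : moment k f <= (m `^ k)%:E by rewrite -fmk.
  have := HC E E0 N N0 f m m1 mf.
  have -> : (N%:R^-1 `^ gamma = (N%:R `^ gamma)^-1 :> R)%R.
    by rewrite -powR_inv1// -powRrM mulN1r powRN.
  rewrite fm -EFinB abse_EFin -!EFinM lee_fin; apply: le_trans.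
  by rewrite ler_norml; apply/andP; split; lra.
Qed.
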